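(* Let $\mathcal{O}$ be an odometer and $\mathcal{M}$ be an abelian adelic one-dimensional nilmanifold. There exists an infinite minimal subshift with $\lim_{q\to\infty} p(q)/q=1$ which has maximal equicontinuous factor the product of $\mathcal{O}$ and a rotation on $\mathcal{M}$. If $\mathcal{M}$ is not a finite group extension of $S^1$ or $\mathcal{O}$ is infinite (or both), then for every $0<\delta<\frac12$ there exists a minimal uniquely ergodic subshift with $\limsup_{q\to\infty} p(q)/q=1+\delta$ which has maximal equicontinuous factor of the same type (the product of $\mathcal{O}$ and a rotation on $\mathcal{M}$).
   Context: A subshift is a closed subset $X\subset\mathcal{A}^{\mathbb{Z}}$ ($\mathcal{A}$ a finite alphabet) invariant under the left shift $\sigma$; $p(q)$ is the number of words of length $q$ appearing in points of $X$. The maximal equicontinuous factor is the largest equicontinuous topological factor of $(X,\sigma)$. An odometer is an inverse limit $\varprojlim_k\mathbb{Z}/o_1o_2\cdots o_k\mathbb{Z}$ under coordinatewise addition of $1$; it may be finite. For $0\le\ell_p\le\infty$ ($p$ ranging over primes), $Q_{(\ell_p)}$ is the group of $q\in\mathbb{Q}$ for which there are primes $p_1,\dots,p_t$ with $p_1\cdots p_tq\in\mathbb{Z}$ and each prime $p$ occurring at most $\ell_p$ times among them. Let $\mathbb{A}$ be the ring of adeles of $\mathbb{Q}$ (elements of $\mathbb{R}\times\prod_p\mathbb{Q}_p$ with all but finitely many $p$-components in $\mathbb{Z}_p$) and $\mathbb{A}_{(\ell_p)}=\{(a_\infty,(a_p))\in\mathbb{A}:a_p\in p^{-\ell_p}\mathbb{Z}_p\text{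 for all }p\}$, with $p^{-\infty}\mathbb{Z}_p=\mathbb{Q}_p$. $Q_{(\ell_p)}$ is embedded diagonally in $\mathbb{A}_{(\ell_p)}$ by $q\mapsto(q,(-q)_p)$. An abelian adelic one-dimensional nilmanifold is a compact group of the form $\mathbb{A}_{(\ell_p)}/Q_{(\ell_p)}$. It is a finite group extension of $S^1$ if it has a continuous surjective homomorphism onto the circle $S^1$ with finite kernel. A rotation on a compact abelian group is translation by a fixed element. *)

(* Defs.v *)
From HB Require Import structures.
From mathcomp Require Import all_boot all_order all_algebra.
From mathcomp Require Import all_classical all_reals all_analysis.
From mathcomp Require Import generic_quotient ring_quotient.
From mathcomp Require Import zify.

Set Implicit Arguments.
Unset Strict Implicit.
Unset Printing Implicit Defensive.

Import Order.TTheory GRing.Theory Num.Theory numFieldNormedType.Exports.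

Local Open Scope classical_set_scope.
Local Open Scope ring_scope.

(** * Factors and the maximal equicontinuous factor *)

(* [Y] is a factor of the system [(X, f)], [X] being a subset of [T] invariant
   under [f]; only the restriction of [pi] to [X] is relevant. *)
Definition factor_map (T : topologicalType) (X : set T) (f : T -> T)
    (Y : topologicalType) (g : Y -> Y) (pi : T -> Y) : Prop :=
  [/\ {within X, continuous pi}, pi @` X = [set: Y] &
      forall x, X x -> pi (f x) = g (pi x)].

(* The last clause is [equicontinuous [set: nat] (fun n => iter n g)] for a
   uniform space without a distinguished point.  A compact Hausdorff space
   carries exactly one uniformity inducing its topology. *)
Definition equicontinuous_system (Y : uniformType) (g : Y -> Y) : Prop :=
  [/\ compact [set: Y], hausdorff_space Y, continuous g &
      forall (x : Y) (E : set (Y * Y)), entourage E ->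
        \forall y \near x, forall n : nat, E (iter n g x, iter n g y)].

Definition has_maximal_equicontinuous_factor (T : topologicalType)
    (X : set T) (f : T -> T) (Y : uniformType) (g : Y -> Y) : Prop :=
  equicontinuous_system g /\
  exists2 pi : T -> Y, factor_map X f g pi &
    forall (Z : uniformType) (h : Z -> Z) (phi : T -> Z),
      equicontinuous_system h -> factor_map X f h phi ->
      exists2 psi : Y -> Z, factor_map [set: Y] g h psi &
        forall x, X x -> phi x = psi (pi x).

(** * Subshifts *)

(* Measurable spaces are pointed, so alphabets come with a distinguished
   letter. *)
#[short(type="alphabetType")]
HB.structure Definition Alphabet := {A of Finite A & Pointed A}.

Definition full_shift (A : alphabetType) : Type :=
  prod_topology (fun _ : int => discrete_topology A).

HB.instance Definition _ (A : alphabetType) := Topological.on (full_shift A).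
HB.instance Definition _ (A : alphabetType) :=
  isPointed.Build (full_shift A) (fun=> (point : A)).

Definition left_shift (A : alphabetType) (x : full_shift A) : full_shift A :=
  fun i => x (i + 1).

Definition subshift (A : alphabetType) (X : set (full_shift A)) : Prop :=
  closed X /\ @left_shift A @` X = X.

Definition minimal_subshift (A : alphabetType) (X : set (full_shift A)) : Prop :=
  [/\ subshift X, X !=set0 &
      forall Y, subshift Y -> Y !=set0 -> Y `<=` X -> Y = X].

Definition language (A : alphabetType) (X : set (full_shift A)) (q : nat) :
    {set q.-tuple A} :=
  [set w : q.-tuple A | `[< exists2 x, X x &
     exists i : int, forall j : 'I_q, tnth w j = x (i + j%:Z) >]]%SET.

Definition complexity (A : alphabetType) (X : set (full_shift A)) (q : nat) : nat :=
  #|language X q|.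

Notation borel_full_shift A := (g_sigma_algebraType (@open (full_shift A))).

(* Invariant Borel probability measures on [X], viewed as measures on the full
   shift which give mass 1 to [X]. *)
Definition invariant_probability (R : realType) (A : alphabetType)
    (X : set (full_shift A)) (mu : probability (borel_full_shift A) R) : Prop :=
  mu X = 1%E /\
  forall B : set (borel_full_shift A),
    measurable B -> mu (@left_shift A @^-1` B) = mu B.

Definition uniquely_ergodic (R : realType) (A : alphabetType)
    (X : set (full_shift A)) : Prop :=
  exists2 mu : probability (borel_full_shift A) R,
    invariant_probability X mu &
    forall nu : probability (borel_full_shift A) R,
      invariant_probability X nu ->
      forall B : set (borel_full_shift A), measurable B -> nu B = mu B.

(** * Odometers *)

(* Z/mZ is ['I_m], on which addition of 1 is [ordS]; the k-th modulus is
   [o 0 * ... * o (k - 1)]. *)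
Definition odometer_modulus (o : nat -> nat) (k : nat) : nat :=
  (\prod_(i < k) o i)%N.

Definition odometer_space (o : nat -> nat) : Type :=
  prod_topology (fun k => discrete_topology 'I_(odometer_modulus o k)).

HB.instance Definition _ (o : nat -> nat) := Uniform.on (odometer_space o).

Definition odometer (o : nat -> nat) : set (odometer_space o) :=
  [set x | forall k, (x k.+1 %% odometer_modulus o k)%N = x k].
Arguments odometer : clear implicits.

Lemma odometer_succ_subproof (o : nat -> nat) (x : odometer o) :
  (fun k => ordS (set_val x k)) \in odometer o.
Proof.
have ox k : (set_val x k.+1 %% odometer_modulus o k)%N = set_val x k.
  exact: (set_mem (valP x)) k.
apply/mem_set => k /=.
have dvd_k : (odometer_modulus o k %| odometer_modulus o k.+1)%N.
  by rewrite /odometer_modulus big_ord_recr /= dvdn_mulr.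
by rewrite modn_dvdm// -addn1 -modnDml ox addn1.
Qed.

Definition odometer_succ (o : nat -> nat) (x : odometer o) : odometer o :=
  SigSub (odometer_succ_subproof x).

(** * Quotients of topological abelian groups *)

Section QuotientGroup.
Context (G : topologicalZmodType) (H : zmodClosed G).

Definition quotient_group : Type := quotient_topology (Quotient.quot H).

HB.instance Definition _ := Topological.on quotient_group.
HB.instance Definition _ := GRing.isZmodule.Build quotient_group
  (@Quotient.addqA G H) (@Quotient.addqC G H) (@Quotient.add0q G H)
  (@Quotient.addNq G H).

Definition quotient_proj (x : G) : quotient_group :=
  \pi_(Quotient.quot H)%qT x.

Lemma quotient_projB x y :
  quotient_proj (x - y) = quotient_proj x - quotient_proj y.
Proof. exact: (raddfB (\pi_(Quotient.quot H)%qT)). Qed.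

Lemma quotient_proj_eq x y : quotient_proj x = quotient_proj y <-> x - y \in H.
Proof.
rewrite Quotient.idealrBE; split=> [e|/eqP//].
by apply/eqP; exact: e.
Qed.

Lemma quotient_proj_surj (u : quotient_group) : exists x, quotient_proj x = u.
Proof. by exists (repr (u : Quotient.quot H)); exact: reprK. Qed.

(* The uniformity of the topological group G / H. *)
Definition quotient_entourage : set_system (quotient_group * quotient_group) :=
  [set E | exists2 U : set G, nbhs 0 U &
     forall x y, U (x - y) -> E (quotient_proj x, quotient_proj y)].

Let quotient_entourage_filter : Filter quotient_entourage.
Proof.
split; first by exists setT => //; exact: filterT.
  move=> P Q [U U0 UP] [V V0 VQ]; exists (U `&` V); first exact: filterI.
  by move=> x y [/UP ? /VQ ?].
by move=> P Q PQ [U U0 UP]; exists U => // x y /UP /PQ.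
Qed.

Let quotient_entourage_diagonal E : quotient_entourage E -> diagonal `<=` E.
Proof.
move=> [U U0 UE] [u v]; rewrite /diagonal /= => ->; have [x <-] := quotient_proj_surj v.
by apply: UE; rewrite subrr; exact: nbhs_singleton.
Qed.

Let quotient_entourage_inv E :
  quotient_entourage E -> quotient_entourage E^-1%relation.
Proof.
move=> [U U0 UE]; exists (-%R @^-1` U).
  by apply: (@opp_continuous G 0); rewrite oppr0.
by move=> x y; rewrite /= opprB; exact: UE.
Qed.

Let quotient_entourage_split_ex E : quotient_entourage E ->
  exists2 F, quotient_entourage F & (F \; F `<=` E)%relation.
Proof.
move=> [U U0 UE].
have := @add_continuous G (0, 0); rewrite /continuous_at /= addr0.
move=> /(_ U U0)[[V W] [/= V0 W0] VWU].
exists [set uv | exists x y,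
    [/\ (V `&` W) (x - y), quotient_proj x = uv.1 & quotient_proj y = uv.2]].
  by exists (V `&` W); [exact: filterI|move=> x y xy; exists x, y].
move=> [u v] /= [w [x [y [[Vxy _] <- <-]]]] [y' [z [[_ Wyz] + <-]]].
move=> /quotient_proj_eq y'yH.
have -> : quotient_proj z = quotient_proj (z - (y' - y)).
  by apply/quotient_proj_eq; rewrite opprB addrC subrK.
apply: UE; have -> : x - (z - (y' - y)) = (x - y) + (y' - z).
  by rewrite opprB -[RHS]addrA [y' - y]addrC -[in LHS]addrA.
exact: (VWU (x - y, y' - z)).
Qed.

Let quotient_nbhsE :
  (nbhs : quotient_group -> _) = nbhs_ quotient_entourage.
Proof.
apply: funext => u; apply: funext => A; apply: propext; split.
  rewrite nbhsE => -[W [oW Wu] WA]; have [x xu] := quotient_proj_surj u.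
  have Wx : nbhs x (quotient_proj @^-1` W).
    by apply: open_nbhs_nbhs; split; [exact: oW|rewrite /= xu].
  exists [set vw | exists a b, [/\ (quotient_proj @^-1` W) (x - (a - b)),
      quotient_proj a = vw.1 & quotient_proj b = vw.2]].
    exists [set z | (quotient_proj @^-1` W) (x - z)].
      apply: (@continuous_comp _ _ _ (fun z => (x, z))
        (fun z : G * G => z.1 - z.2)).
      - by apply: cvg_pair => /=; [exact: cvg_cst|exact: cvg_id].
      - exact: sub_continuous.
      - by rewrite /= subr0.
    by move=> a b ab; exists a, b.
  move=> w /xsectionP [a [b [/= + au bw]]].
  by rewrite !quotient_projB au bw xu subKr => /WA.
move=> [E [U + UE] EA]; rewrite nbhsE => -[V [oV V0] VU].
have [x xu] := quotient_proj_surj u.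
pose O := [set v | exists2 y, quotient_proj y = v & V (x - y)].
rewrite nbhsE; exists O; last first.
  move=> _ [y <- /VU/UE Exy]; apply/EA/xsectionP.
  by rewrite -xu.
split; last by exists x; rewrite ?subrr.
rewrite /open /= /quotient_open openE => y [y' y'y Vxy'].
rewrite /interior /=.
have : nbhs y [set t | V (x - (t - (y - y')))].
  apply: (@continuous_comp _ _ _ (fun t => (x, (t - (y - y'))))
    (fun z : G * G => z.1 - z.2)).
  - apply: cvg_pair => /=; first exact: cvg_cst.
    apply: (@continuous_comp _ _ _ (fun t => (t, y - y'))
      (fun z : G * G => z.1 - z.2)); last exact: sub_continuous.
    by apply: cvg_pair => /=; [exact: cvg_id|exact: cvg_cst].
  - exact: sub_continuous.
  - by apply: open_nbhs_nbhs; split=> //=; rewrite subKr.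
apply: filterS => t Vt; exists (t - (y - y')) => //.
rewrite !quotient_projB y'y.
by rewrite subrr subr0.
Qed.

HB.instance Definition _ := Nbhs_isUniform_mixin.Build quotient_group
  quotient_entourage_filter quotient_entourage_diagonal
  quotient_entourage_inv quotient_entourage_split_ex quotient_nbhsE.

End QuotientGroup.

(** * p-adic numbers *)

Definition prime_nat : Type := {p : nat | prime p}.

Definition padic_val (p : nat) (q : rat) : int :=
  (logn p `|numq q|)%:Z - (logn p `|denq q|)%:Z.

Definition padic_norm (p : nat) (q : rat) : rat :=
  if q == 0 then 0 else p%:Q ^ (- padic_val p q).

Section PadicNumbers.
Variable p : prime_nat.
Let pn : nat := val p.
Let p_prime : prime pn := valP p.

Let p_gt0 : 0 < pn%:Q.
Proof. by rewrite ltr0n prime_gt0. Qed.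

Let p_gt1 : 1 < pn%:Q.
Proof. by rewrite ltr1n prime_gt1. Qed.

Lemma padic_val_div (a b : int) : a != 0 -> b != 0 ->
  padic_val pn (a%:Q / b%:Q) = (logn pn `|a|)%:Z - (logn pn `|b|)%:Z.
Proof.
move=> a0 b0; set q := _ / _.
have q0 : q != 0 by rewrite mulf_neq0 ?invr_eq0 ?intr_eq0.
have : numq q * b = a * denq q.
  have qb : q * b%:Q = a%:Q by rewrite /q divfK // intr_eq0.
  by apply: (@intr_inj rat); rewrite !intrM numqE mulrAC qb.
move=> /(congr1 absz); rewrite !abszM => /(congr1 (logn pn)).
rewrite !lognM ?absz_gt0 ?numq_eq0 ?denq_eq0 // => /(congr1 Posz).
rewrite !PoszD /padic_val => e; apply/eqP.
by rewrite subr_eq addrAC -subr_eq opprK; apply/eqP.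
Qed.

Lemma padic_norm_ge0 (q : rat) : 0 <= padic_norm pn q.
Proof. by rewrite /padic_norm; case: eqP => // _; rewrite exprz_ge0 // ltW. Qed.

Lemma padic_normN (q : rat) : padic_norm pn (- q) = padic_norm pn q.
Proof. by rewrite /padic_norm oppr_eq0 /padic_val numqN denqN abszN. Qed.

Lemma padic_norm_le (q : rat) (n : int) : q != 0 ->
  (padic_norm pn q <= pn%:Q ^ (- n)) = (n <= padic_val pn q).
Proof.
by move=> q0; rewrite /padic_norm (negPf q0) ler_eXz2l // lerN2.
Qed.

Lemma padic_normD (q r : rat) :
  padic_norm pn (q + r) <= Num.max (padic_norm pn q) (padic_norm pn r).
Proof.
have [->|q0] := eqVneq q 0; first by rewrite add0r le_max lexx orbT.
have [->|r0] := eqVneq r 0; first by rewrite addr0 le_max lexx.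
have [->|qr0] := eqVneq (q + r) 0.
  by rewrite le_max {1}/padic_norm eqxx padic_norm_ge0.
pose m := Num.min (padic_val pn q) (padic_val pn r).
have -> : Num.max (padic_norm pn q) (padic_norm pn r) = pn%:Q ^ (- m).
  rewrite /padic_norm (negPf q0) (negPf r0) /m.
  by case: leP; case: leP => //;
    rewrite ?ler_eXz2l ?ltr_eXz2l// => ? ?; congr (_ ^ _); lia.
rewrite padic_norm_le //.
have [dq dr] : denq q != 0 /\ denq r != 0 by rewrite !denq_eq0.
pose x : int := numq q * denq r; pose y : int := numq r * denq q.
have qrE : q + r = (x + y)%:Q / (denq q * denq r)%:Q.
  rewrite -{1}[q]divq_num_den -{1}[r]divq_num_den addf_div ?intr_eq0//.
  by rewrite intrD !intrM.
have N0 : x + y != 0.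
  apply: contra_neq qr0 => N0; by rewrite qrE N0 mul0r.
rewrite qrE padic_val_div // ?mulf_neq0 //.
have leN k : (pn ^ k %| absz x)%N -> (pn ^ k %| absz y)%N ->
    (k <= logn pn (absz (x + y)%R))%N.
  move=> d1 d2; rewrite -pfactor_dvdn ?absz_gt0 //.
  have : ((pn ^ k)%N%:Z %| x + y)%Z by apply: rpredD; rewrite dvdzE.
  by rewrite dvdzE.
have := leN (minn (logn pn (absz x)) (logn pn (absz y))).
rewrite !pfactor_dvdn ?absz_gt0 ?mulf_neq0 ?numq_eq0//.
rewrite geq_minl geq_minr => /(_ isT isT).
move=> le_v; rewrite lerBrDr; apply: le_trans (_ : _ <= Posz _) _; last by rewrite lez_nat; exact: le_v.
rewrite /m /padic_val /x /y !abszM !lognM ?absz_gt0 ?numq_eq0 //.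
move: (logn pn _) (logn pn _) (logn pn _) (logn pn _); lia.
Qed.

Lemma padic_normB_le (q r c : rat) :
  padic_norm pn q <= c -> padic_norm pn r <= c -> padic_norm pn (q - r) <= c.
Proof.
move=> qc rc; apply: le_trans (padic_normD q (- r)) _.
by rewrite padic_normN ge_max qc.
Qed.

Lemma padic_normB_lt (q r c : rat) :
  padic_norm pn q < c -> padic_norm pn r < c -> padic_norm pn (q - r) < c.
Proof.
move=> qc rc; apply: le_lt_trans (padic_normD q (- r)) _.
by rewrite padic_normN gt_max qc.
Qed.

Definition padic_cauchy : {pred (nat -> rat)} := fun u =>
  `[< forall e : rat, 0 < e -> exists N, forall i j,
        (N <= i)%N -> (N <= j)%N -> padic_norm pn (u i - u j) < e >].

Lemma padic_cauchy_zmod_closed : zmod_closed padic_cauchy.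
Proof.
split=> [|u v /asboolP uc /asboolP vc]; apply/asboolP => e e0.
  by exists 0%N => i j _ _; rewrite subrr /padic_norm eqxx.
have [[N uN] [M vM]] := (uc e e0, vc e e0); exists (maxn N M) => i j.
rewrite !geq_max => /andP[Ni Mi] /andP[Nj Mj].
have -> : (u - v) i - (u - v) j = (u i - u j) - (v i - v j).
  have -> k : (u - v) k = u k - v k by [].
  by rewrite opprD addrACA -opprD.
exact: padic_normB_lt (uN _ _ Ni Nj) (vM _ _ Mi Mj).
Qed.

HB.instance Definition _ :=
  GRing.isZmodClosed.Build (nat -> rat) padic_cauchy padic_cauchy_zmod_closed.

Record padic_seq := PadicSeq {
  padic_seq_val :> nat -> rat; _ : padic_seq_val \in padic_cauchy }.

HB.instance Definition _ := [isSub for padic_seq_val].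
HB.instance Definition _ := [Choice of padic_seq by <:].
HB.instance Definition _ := [SubChoice_isSubZmodule of padic_seq by <:].

Definition padic_null : {pred padic_seq} := fun u =>
  `[< forall e : rat, 0 < e -> exists N, forall i,
        (N <= i)%N -> padic_norm pn (u i) < e >].

Lemma padic_null_zmod_closed : zmod_closed padic_null.
Proof.
split=> [|u v /asboolP un /asboolP vn]; apply/asboolP => e e0.
  by exists 0%N => i _; rewrite /= /padic_norm eqxx.
have [[N uN] [M vM]] := (un e e0, vn e e0); exists (maxn N M) => i.
rewrite geq_max => /andP[Ni Mi]; exact: padic_normB_lt (uN _ Ni) (vM _ Mi).
Qed.

HB.instance Definition _ :=
  GRing.isZmodClosed.Build padic_seq padic_null padic_null_zmod_closed.

(* The additive group of Q_p, the completion of Q for the p-adic norm. *)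
Definition padic : Type := Quotient.quot padic_null.

HB.instance Definition _ := GRing.Zmodule.on padic.

(* p^n Z_p, i.e. the ball of radius p^-n around 0. *)
Definition padic_ball (n : int) : {pred padic} := fun x =>
  `[< exists N, forall i, (N <= i)%N ->
        padic_norm pn ((repr x : padic_seq) i) <= pn%:Q ^ (- n) >].

Lemma padic_ballP n (u : padic_seq) :
  reflect (exists N, forall i, (N <= i)%N -> padic_norm pn (u i) <= pn%:Q ^ (- n))
    ((\pi_(Quotient.quot padic_null)%qT u : padic) \in padic_ball n).
Proof.
set x := \pi_(_)%qT u.
have pn0 : 0 < pn%:Q ^ (- n) by rewrite exprz_gt0.
have : exists M, forall i, (M <= i)%N ->
    padic_norm pn ((repr x : padic_seq) i - u i) < pn%:Q ^ (- n).
  have : repr x - u \in padic_null by rewrite Quotient.idealrBE reprK.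
  by move=> /asboolP; exact.
move=> xu; apply: (iffP (asboolP _)); case: xu => M uM [N xN];
    exists (maxn N M) => i; rewrite geq_max => /andP[Ni Mi].
  rewrite -[u i](subKr ((repr x : padic_seq) i)).
  by apply: padic_normB_le; [exact: xN|exact: ltW (uM _ Mi)].
rewrite -[_ i](subrK (u i)) -[X in _ + X]opprK.
apply: padic_normB_le; first exact: ltW (uM _ Mi).
by rewrite padic_normN; exact: xN.
Qed.

Lemma padic_ball_zmod_closed n : zmod_closed (padic_ball n).
Proof.
split=> [|x y].
  rewrite -[0](@raddf0 _ _ (\pi_(Quotient.quot padic_null)%qT)).
  apply/padic_ballP; exists 0%N => i _.
  by rewrite /= /padic_norm eqxx exprz_ge0 // ltW.
rewrite -[x]reprK -[y]reprK -raddfB.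
move=> /padic_ballP[N xN] /padic_ballP[M yM]; apply/padic_ballP.
exists (maxn N M) => i; rewrite geq_max => /andP[Ni Mi].
exact: padic_normB_le (xN _ Ni) (yM _ Mi).
Qed.

HB.instance Definition _ n :=
  GRing.isZmodClosed.Build padic (padic_ball n) (padic_ball_zmod_closed n).

Lemma padic_ball_le m n x : (m <= n)%R -> x \in padic_ball n -> x \in padic_ball m.
Proof.
move=> mn /asboolP[N xN]; apply/asboolP; exists N => i /xN /le_trans -> //.
by rewrite ler_eXz2l // lerN2.
Qed.

Lemma padic_const_subproof (q : rat) : (fun=> q) \in padic_cauchy.
Proof.
apply/asboolP => e e0; exists 0%N => i j _ _.
by rewrite subrr /padic_norm eqxx.
Qed.

Definition padic_of_rat (q : rat) : padic :=
  \pi_(Quotient.quot padic_null)%qT (PadicSeq (padic_const_subproof q)).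

Lemma padic_of_ratB : zmod_morphism padic_of_rat.
Proof.
move=> q r; rewrite /padic_of_rat -raddfB; congr (\pi_(_)%qT _).
exact: val_inj.
Qed.

HB.instance Definition _ :=
  GRing.isZmodMorphism.Build rat padic padic_of_rat padic_of_ratB.

End PadicNumbers.
Arguments padic_ball : clear implicits.
Arguments padic_of_rat : clear implicits.

(** * Adeles *)

(* Additive groups only, as rings play no role; [None] stands for infinity, and
   the value of [ell] at a number which is not prime is irrelevant. *)
Section PadicProduct.

Definition padic_product : Type := forall p : prime_nat, padic p.

Let addA : associative (fun x y : padic_product => (fun p => x p + y p)).
Proof. by move=> x y z; apply: functional_extensionality_dep => p; rewrite addrA. Qed.

Let addC : commutative (fun x y : padic_product => (fun p => x p + y p)).
Proof. by move=> x y; apply: functional_extensionality_dep => p; rewrite addrC. Qed.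

Let add0 : left_id (fun p => 0) (fun x y : padic_product => (fun p => x p + y p)).
Proof. by move=> x; apply: functional_extensionality_dep => p; rewrite add0r. Qed.

Let addN : left_inverse (fun p => 0) (fun x : padic_product => (fun p => - x p))
  (fun x y : padic_product => (fun p => x p + y p)).
Proof. by move=> x; apply: functional_extensionality_dep => p; rewrite addNr. Qed.

HB.instance Definition _ := Choice.copy padic_product (forall p, padic p).
HB.instance Definition _ :=
  GRing.isZmodule.Build padic_product addA addC add0 addN.

End PadicProduct.

Section Adeles.
Variable R : realType.

Definition adele_product : Type := (R * padic_product)%type.

HB.instance Definition _ := GRing.Zmodule.on adele_product.

Definition is_adele (a : adele_product) : Prop :=
  finite_set [set p : prime_nat | a.2 p \notin padic_ball p 0].

Variable ell : nat -> option nat.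

Definition adeles_ell_pred : {pred adele_product} := fun a =>
  `[< is_adele a /\ forall (p : prime_nat) (l : nat),
        ell (val p) = Some l -> a.2 p \in padic_ball p (- l%:Z) >].

Lemma adeles_ell_zmod_closed : zmod_closed adeles_ell_pred.
Proof.
split=> [|a b /asboolP[fa la] /asboolP[fb lb]]; apply/asboolP; split.
- apply: sub_finite_set (finite_set0 _) => p /=.
  by move=> /negP; apply; exact: rpred0.
- by move=> p l _; exact: rpred0.
- have fab : finite_set ([set p | a.2 p \notin padic_ball p 0] `|`
      [set p | b.2 p \notin padic_ball p 0]) by rewrite finite_setU; split.
  apply: sub_finite_set fab => p /=; apply: contraNP => /not_orP[].
  by move=> /negP/negPn ap /negP/negPn bp; apply: rpredB.
- by move=> p l e; apply: rpredB; [exact: la e|exact: lb e].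
Qed.

HB.instance Definition _ :=
  GRing.isZmodClosed.Build adele_product adeles_ell_pred adeles_ell_zmod_closed.

(* The group A_(l_p). *)
Record adeles_ell := AdelesEll {
  adeles_ell_val :> adele_product; _ : adeles_ell_val \in adeles_ell_pred }.

HB.instance Definition _ := [isSub for adeles_ell_val].
HB.instance Definition _ := [Choice of adeles_ell by <:].
HB.instance Definition _ := [SubChoice_isSubZmodule of adeles_ell by <:].

(* The basic neighbourhood of 0 in the restricted product topology given by
   the interval ]-e, e[ and the subgroups p^(n p) Z_p, where n p = 0 for all
   but finitely many p. *)
Definition adele_box (e : R) (n : prime_nat -> nat) : set adele_product :=
  [set a | `|a.1| < e /\ forall p, a.2 p \in padic_ball p (n p)%:Z].

Definition adeles_ell_nbhs (a : adeles_ell) : set_system adeles_ell :=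
  [set U | exists (e : R) (n : prime_nat -> nat),
     [/\ 0 < e, finite_set [set p | n p != 0%N] &
         forall b : adeles_ell, adele_box e n (b - a) -> U b]].

Lemma adele_box_in e n a b :
  adele_box e n b -> adele_box (e - `|b.1|) n (a - b) -> adele_box e n a.
Proof.
move=> [b1 b2] [ab1 ab2]; split.
  rewrite -[a.1](subrK b.1).
  by apply: le_lt_trans (ler_normD _ _) _; rewrite -ltrBrDr; exact: ab1.
move=> p; have -> : a.2 p = (a - b).2 p + b.2 p by rewrite /= subrK.
by apply: rpredD; [exact: ab2|exact: b2].
Qed.

Lemma adele_box0 e n : 0 < e -> adele_box e n 0.
Proof.
move=> e0; split; first by rewrite normr0.
by move=> p; exact: rpred0.
Qed.

Let adeles_ell_nbhs_filter a : ProperFilter (adeles_ell_nbhs a).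
Proof.
split.
  by move=> [e [n [e0 _ /(_ a)]]]; apply; rewrite subrr; exact: adele_box0.
split.
- exists 1, (fun=> 0%N); split=> //.
  by apply: sub_finite_set (finite_set0 _).
- move=> U V [e [n [e0 fn eU]]] [f [m [f0 fm fV]]].
  exists (Num.min e f), (fun p => maxn (n p) (m p)); split.
  + by rewrite lt_min e0.
  + have fnm : finite_set ([set p | n p != 0%N] `|` [set p | m p != 0%N]).
      by rewrite finite_setU; split.
    apply: sub_finite_set fnm => p /=; rewrite -!lt0n leq_max.
    by move=> /orP.
  + move=> b [b1 b2]; split; [apply: eU|apply: fV]; split.
    * by move: b1; rewrite lt_min => /andP[].
    * by move=> p; apply: padic_ball_le (b2 p); rewrite lez_nat leq_maxl.
    * by move: b1; rewrite lt_min => /andP[].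
    * by move=> p; apply: padic_ball_le (b2 p); rewrite lez_nat leq_maxr.
- move=> U V UV [e [n [e0 fn eU]]]; exists e, n; split=> // b /eU; exact: UV.
Qed.

Let adeles_ell_nbhs_singleton a (U : set adeles_ell) :
  adeles_ell_nbhs a U -> U a.
Proof.
by move=> [e [n [e0 _ /(_ a)]]]; apply; rewrite subrr; exact: adele_box0.
Qed.

Let adeles_ell_nbhs_nbhs a (U : set adeles_ell) :
  adeles_ell_nbhs a U -> adeles_ell_nbhs a (adeles_ell_nbhs^~ U).
Proof.
move=> [e [n [e0 fn eU]]]; exists e, n; split=> // b ba.
exists (e - `|(val (b - a)).1|), n; split=> //; first by rewrite subr_gt0; case: ba.
move=> c cb; apply: eU; apply: adele_box_in ba _.
have -> : val (c - a) - val (b - a) = val (c - b).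
  by rewrite -raddfB opprB addrA subrK.
exact: cb.
Qed.

HB.instance Definition _ := hasNbhs.Build adeles_ell adeles_ell_nbhs.
HB.instance Definition _ := Nbhs_isNbhsTopological.Build adeles_ell
  adeles_ell_nbhs_filter adeles_ell_nbhs_singleton adeles_ell_nbhs_nbhs.

Let adeles_ell_sub_continuous :
  continuous (fun ab : adeles_ell * adeles_ell => ab.1 - ab.2).
Proof.
move=> [a b] U [e [n [e0 fn eU]]].
pose V c := [set d : adeles_ell | adele_box (e / 2) n (d - c)].
have Vnbhs c : nbhs c (V c).
  by exists (e / 2), n; split=> //; rewrite divr_gt0.
exists (V a, V b); first by split; exact: Vnbhs.
move=> [c d] [/= [ca1 ca2] [db1 db2]]; apply: eU => /=.
have E : c - d - (a - b) = (c - a) - (d - b).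
  by rewrite !opprB addrACA [RHS]addrACA [- d - a]addrC.
suff : adele_box e n (val (c - a) - val (d - b)) by rewrite -raddfB -E.
split.
  rewrite [e]splitr; apply: le_lt_trans (ler_normB _ _) _.
  exact: ltrD.
by move=> p; apply: rpredB; [exact: ca2|exact: db2].
Qed.

HB.instance Definition _ :=
  PreTopologicalNmodule_isTopologicalZmodule.Build adeles_ell
    adeles_ell_sub_continuous.

Definition rat_ell : set rat :=
  [set q | exists s : seq nat,
     [/\ all prime s,
         forall p l : nat, prime p -> ell p = Some l -> (count_mem p s <= l)%N &
         (\prod_(p <- s) p)%N%:R * q \is a Num.int]].

Let prime_list_diff (s t : seq nat) : all prime t ->
  exists d : seq nat, [/\ all prime d,
    forall p, count_mem p d = (count_mem p t - count_mem p s)%N &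
    ((\prod_(p <- t) p) %| (\prod_(p <- s) p) * \prod_(p <- d) p)%N].
Proof.
elim: s t => [|x s IHs] t tp.
  by exists t; split=> // [p|]; rewrite ?subn0// big_nil mul1n.
have [|d [dp dc dd]] := IHs (rem x t).
  by apply/allP => p /mem_rem; exact: (allP tp).
exists d; split=> // [p|]; first by rewrite dc count_mem_rem /= subnDA eq_sym.
rewrite big_cons -mulnA.
have [xt|xt] := boolP (x \in t); last by rewrite rem_id // in dd; exact: dvdn_mull.
by rewrite (perm_big _ (perm_to_rem xt)) /= big_cons dvdn_mul.
Qed.

Lemma rat_ell_zmod_closed : rat_ell 0 /\
  forall q r, rat_ell q -> rat_ell r -> rat_ell (q - r).
Proof.
split; first by exists [::]; split=> //; rewrite mulr0.
move=> q r [s [sp sl sq]] [t [tp tl tr]].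
have [d [dp dc dd]] := prime_list_diff s tp.
exists (s ++ d); split; first by rewrite all_cat sp.
  move=> p l pp e; rewrite count_cat dc -maxnE geq_max.
  by rewrite (sl _ _ pp e) (tl _ _ pp e).
rewrite big_cat /= mulrBr; apply: rpredB.
  by rewrite mulnC natrM -mulrA rpredM ?rpred_nat.
by move: dd => /dvdnP[k ->]; rewrite natrM -mulrA rpredM ?rpred_nat.
Qed.

Definition rat_adele (q : rat) : adele_product :=
  (ratr q, fun p => padic_of_rat p (- q)).

Lemma rat_adeleB : zmod_morphism rat_adele.
Proof.
move=> q r; rewrite /rat_adele; congr (_, _); first exact: raddfB.
by apply: functional_extensionality_dep => p; rewrite opprD raddfB.
Qed.

Let prime_prod_gt0 (s : seq nat) : all prime s -> (0 < \prod_(p <- s) p)%N.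
Proof.
elim: s => [|p s IHs] /=; first by rewrite big_nil.
by move=> /andP[pp /IHs s0]; rewrite big_cons muln_gt0 prime_gt0.
Qed.

Lemma rat_adele_in_adeles_ell (q : rat) :
  rat_ell q -> rat_adele q \in adeles_ell_pred.
Proof.
move=> [s [sp sl /intrP[m sq]]].
have s0 : (0 < \prod_(p <- s) p)%N.
  exact: prime_prod_gt0.
have ball (p : prime_nat) :
    padic_of_rat p (- q) \in padic_ball p (- (count_mem (val p) s)%:Z).
  rewrite raddfN rpredN; apply/padic_ballP; exists 0%N => i _ /=.
  have [->|q0] := eqVneq q 0.
    by rewrite /padic_norm eqxx exprz_ge0 // ler0n.
  have qE : q = m%:~R / (\prod_(p <- s) p)%N%:Z%:~R.
    by rewrite -sq mulrC mulKf // pnatr_eq0 -lt0n.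
  have m0 : m != 0 by apply: contra_neq q0 => m0; rewrite qE m0 mul0r.
  rewrite padic_norm_le // qE padic_val_div -?lt0n //=.
  have -> : logn (val p) (\prod_(p <- s) p) = count_mem (val p) s.
    elim: s sp {sl sq s0 qE} => [_|x s IHs /= /andP[px sp]].
      by rewrite big_nil logn1.
    rewrite big_cons lognM; [|exact: prime_gt0|exact: prime_prod_gt0].
    by rewrite IHs // logn_prime // eq_sym.
  by move: (logn _ _) (count_mem _ _) => u v; lia.
apply/asboolP; split=> [|p l pl] /=; last first.
  by apply: padic_ball_le (ball p); rewrite lerN2 lez_nat sl // (valP p).
have fs : finite_set [set p : prime_nat | val p \in s].
  apply: (@finite_preimage _ _ [set` s] (val : prime_nat -> nat)).
    by move=> p r _ _; exact: val_inj.
  exact: finite_seq.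
apply: sub_finite_set fs => p /=; apply: contraNP => /negP ps.
by have := ball p; rewrite (count_memPn ps) oppr0.
Qed.

(* The diagonal image of Q_(l_p) in A_(l_p). *)
Definition rat_ell_in_adeles : {pred adeles_ell} := fun a =>
  `[< exists2 q, rat_ell q & adeles_ell_val a = rat_adele q >].

Lemma rat_ell_in_adeles_zmod_closed : zmod_closed rat_ell_in_adeles.
Proof.
split=> [|a b /asboolP[q lq aq] /asboolP[r lr br]]; apply/asboolP.
  exists 0; first exact: rat_ell_zmod_closed.1.
  by have := rat_adeleB 0 0; rewrite !subrr => ->.
exists (q - r); first exact: rat_ell_zmod_closed.2.
by rewrite rat_adeleB -aq -br.
Qed.

HB.instance Definition _ := GRing.isZmodClosed.Build adeles_ell
  rat_ell_in_adeles rat_ell_in_adeles_zmod_closed.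

Definition adelic_nilmanifold : Type := quotient_group rat_ell_in_adeles.

HB.instance Definition _ := GRing.Zmodule.on adelic_nilmanifold.
HB.instance Definition _ := Uniform.on adelic_nilmanifold.

End Adeles.

(** * The circle *)

Section Circle.
Variable R : realType.

Definition integers : {pred R} := fun x => x \is a Num.int.

Lemma integers_zmod_closed : zmod_closed integers.
Proof. by split=> [|x y]; [exact: rpred0|exact: rpredB]. Qed.

HB.instance Definition _ :=
  GRing.isZmodClosed.Build R integers integers_zmod_closed.

(* The circle S^1, as R / Z. *)
Definition circle : Type := quotient_group integers.

HB.instance Definition _ := GRing.Zmodule.on circle.
HB.instance Definition _ := Uniform.on circle.

End Circle.

Definition finite_group_extension_of_circle (R : realType)
    (M : PreTopologicalZmodule.type) : Prop :=
  exists f : M -> circle R,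
    [/\ continuous f, {morph f : x y / x + y}, range f = [set: circle R] &
        finite_set [set x | f x = 0]].

Definition odometer_rotation (o : nat -> nat) (M : PreTopologicalZmodule.type)
    (alpha : M) (z : odometer o * M) : odometer o * M :=
  (odometer_succ z.1, z.2 + alpha).

(* Main.v *)
Require Import Defs.
From HB Require Import structures.
From mathcomp Require Import all_boot all_order all_algebra.
From mathcomp Require Import all_classical all_reals all_analysis.
From mathcomp Require Import generic_quotient ring_quotient.
From mathcomp Require Import measurable_realfun.
From mathcomp Require Import zify ring lra.
Set Implicit Arguments.
Unset Strict Implicit.
Unset Printing Implicit Defensive.
Import Order.TTheory GRing.Theory Num.Theory numFieldNormedType.Exports.
Local Open Scope classical_set_scope.
Local Open Scope ring_scope.

(** The same construction serves both parts. Let [u_0 = 0], [v_0 = 1] and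
    [u_(k+1) = u_k^(a_k) v_k], [v_(k+1) = u_k^(a_k + d_k) v_k] with
    [1 <= d_k <= a_k]; for [d_k = 1] this is a Sturmian step. The subshift consists
    of the sequences in which every position lies in a block [u_k] or [v_k] of
    each level. Parsing into blocks is unique ([blk_disj]), all pairs of
    consecutive blocks recur, and the subshift is minimal.

    Complexity: two points with the same past that differ at 0 are compared level
    by level. There is one right special word of each length, and a second one
    exactly for the [(d_k - 1) |u_k|] lengths that follow a number [low k] of order
    [a_k |u_k|] ([right_special_le], [right_special_ge2]). Hence if [a_k] tends to
    infinity, the upper limit of [p(q) / q] is 1 plus the upper limit of
    [d_k / (a_k + d_k)] ([complexity_limsup]). As blocks of level [k+1] are mostly
    repetitions of [u_k], frequencies are uniform and the subshift is uniquely
    ergodic.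

    Factor: let [n_k(x)] be the distance of the origin to the left end of its
    block of level [k] and [m_k(x)] the number of letters 1 on the way. They change
    with [k] by multiples of the length and of the number of 1 of [u_k]. If the
    vectors (length, number of 1) of [u_k] and [v_k] span a rectangular lattice
    [O_k Z x N_k Z], then [n_k] converges in the limit of the [Z / O_k Z], which is
    the odometer when [O_k] exhausts its moduli, and [m_k] converges in the
    profinite integers when every integer divides some [N_k]. With [theta] the
    density of 1, the real number [n_k theta - m_k] converges as well. The shift
    adds 1 to the first limit, and [(theta, 0)] to the pair of the two others up to
    the diagonal integer [x_0]. This defines a factor map onto the product of the
    odometer with [(R x lim Z / N Z) / Z], which is the adelic nilmanifold
    whatever the [ell_p] are ([sol_eqP], [sol_dense]). If two points have the same
    image, their positions in the blocks differ by a short vector of the lattice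
    ([lattice_coordinates]); at a Sturmian level this forces them to share a
    long block in their past ([address_fiber_block]). Every equicontinuous factor
    then takes the same value at both
    ([past_agree_equicontinuous]), so this factor is the maximal one.

    Arithmetic: the lattice remains rectangular through stages of three levels.
    Two Sturmian levels bring the two vectors to suitable residues
    ([prepare_residue]), after which a level with [d_k] equal to the wanted factor
    multiplies [O_k] or [N_k] by it. The factors of [O_k] are prescribed and taken
    with [d_k / (a_k + d_k)] tending to 0; the factors of [N_k] are free, and are
    taken with [d_k / (a_k + d_k)] tending to [delta]. *)

(** * Blocks and the uniqueness of parsings *)

Section Blocks.
Variables a d : nat -> nat.
Hypothesis a_gt1 : forall k, (1 < a k)%N.
Hypothesis d_gt0 : forall k, (0 < d k)%N.

(** The recursion satisfied by every quantity additive on words, as [u_(k+1) =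
    u_k^(a_k) v_k] and [v_(k+1) = u_k^(a_k + d_k) v_k]; the second component
    is the excess of [v_k] over [u_k]. *)
Fixpoint vec (x x' : nat) (k : nat) : nat * nat :=
  if k is j.+1 then
    (((a j).+1 * (vec x x' j).1 + (vec x x' j).2)%N, (d j * (vec x x' j).1)%N)
  else (x, x').

(** [hl k] is the length of [u_k], and [hl k + hp k] that of [v_k]. *)
Definition hl k := (vec 1 0 k).1.
Definition hp k := (vec 1 0 k).2.
Definition len k (t : bool) := (hl k + t * hp k)%N.
(** A block of level [k.+1] consists of [nu k t] blocks [u_k] and a final
    [v_k]; type [false] stands for [u], type [true] for [v]. *)
Definition nu k (t : bool) := (a k + t * d k)%N.

Lemma hlS k : hl k.+1 = ((a k).+1 * hl k + hp k)%N. Proof. by []. Qed.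
Lemma hpS k : hp k.+1 = (d k * hl k)%N. Proof. by []. Qed.

Lemma lenE k t : len k t = (hl k + t * hp k)%N. Proof. by []. Qed.
Lemma nuE k t : nu k t = (a k + t * d k)%N. Proof. by []. Qed.
Lemma len0 t : len 0 t = 1%N. Proof. by rewrite /len /hl /hp /= muln0. Qed.

Lemma lenS k t : len k.+1 t = (nu k t * hl k + len k true)%N.
Proof. by rewrite /len /nu hlS hpS; case: t; nia. Qed.

Lemma hl_gt0 k : (0 < hl k)%N.
Proof. by elim: k => // k IH; rewrite hlS; nia. Qed.

Lemma len_gt0 k t : (0 < len k t)%N.
Proof. by rewrite /len; have := hl_gt0 k; lia. Qed.

(** An occurrence at [i] of a block in a point that is a concatenation of
    blocks: besides its own sub-blocks, the [v_j] that ends the preceding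
    block is required. Without it the block at [i] could start in the middle
    of a longer run of [u_j]. *)
Fixpoint blk (x : int -> bool) (k : nat) (i : int) (t : bool) : bool :=
  if k is j.+1 then
    [&& blk x j (i - (len j true)%:Z) true,
        [forall c : 'I_(nu j t), blk x j (i + (c * hl j)%:Z) false] &
        blk x j (i + (nu j t * hl j)%:Z) true]
  else x i == t.

Lemma blkSP x k i t : reflect
  [/\ blk x k (i - (len k true)%:Z) true,
      forall c, (c < nu k t)%N -> blk x k (i + (c * hl k)%:Z) false &
      blk x k (i + (nu k t * hl k)%:Z) true] (blk x k.+1 i t).
Proof.
apply: (iffP and3P) => -[H1 H2 H3]; split=> //.
  by move=> c cn; move/forallP: H2 => /(_ (Ordinal cn)).
by apply/forallP => c; exact: H2.
Qed.

Lemma blk_sub x k i t (c : nat) : blk x k.+1 i t -> (c <= nu k t)%N ->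
  blk x k (i + (c * hl k)%:Z) (c == nu k t).
Proof.
move=> /blkSP[_ H2 H3]; rewrite leq_eqVlt => /predU1P[->|cn]; first by rewrite eqxx.
by rewrite (ltn_eqF cn) H2.
Qed.

Lemma sub_cover x k i t p : blk x k.+1 i t ->
  i <= p < i + (len k.+1 t)%:Z ->
  exists2 c : nat, (c <= nu k t)%N &
    i + (c * hl k)%:Z <= p < i + (c * hl k)%:Z + (len k (c == nu k t))%:Z.
Proof.
move=> _ /andP[ip pi]; have h0 := hl_gt0 k.
have [r pE] : exists r : nat, p = i + r%:Z by exists `|p - i|%N; lia.
have [cn|nc] := ltnP (r %/ hl k) (nu k t).
  exists (r %/ hl k)%N; first exact: ltnW.
  have := divn_eq r (hl k); have := ltn_mod r (hl k); rewrite h0 (ltn_eqF cn).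
  rewrite /len mul0n addn0 {cn}pE.
  move: (r %/ hl k)%N (r %% hl k)%N (hl k) => q s h sh rE; by apply/andP; split; lia.
exists (nu k t) => //; rewrite eqxx.
have nr : (nu k t * hl k <= r)%N.
  by rewrite (leq_trans _ (leq_trunc_div r (hl k))) // leq_mul2r nc orbT.
move: pi nr; rewrite lenS pE PoszD; move: (nu k t * hl k)%N => w pi nr.
apply/andP; split; lia.
Qed.

Lemma cover_down x k K i t p : (k <= K)%N -> blk x K i t ->
  i <= p < i + (len K t)%:Z ->
  exists i' t', blk x k i' t' /\ i' <= p < i' + (len k t')%:Z.
Proof.
move=> kK; rewrite -(subnK kK); elim: (K - k)%N i t => [|j IH] i t.
  by rewrite add0n; exists i, t.
rewrite addSn => xb ip; have [c cn cp] := sub_cover xb ip.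
exact: IH (blk_sub xb cn) cp.
Qed.

(** Parsings are unique: a block of level [k.+1] begins right after a
    sub-block of type [true], and has only one such sub-block, at its end.
    Hence two blocks of level [k.+1] cannot overlap unless they begin
    together, and then the position of that sub-block gives the type. *)
Lemma blk_disj x k i t i' t' : blk x k i t -> blk x k i' t' ->
  i <= i' < i + (len k t)%:Z -> i = i' /\ t = t'.
Proof.
elim: k i t i' t' => [|k IH] i t i' t'.
  have -> : len 0 t = 1%N by rewrite /len /hl /hp /= muln0.
  move=> /= /eqP xi /eqP xi' ii'.
  have e : i = i' by lia.
  by split=> //; rewrite -xi -xi' e.
move=> xi xi' ii'.
have [ei|ni] := eqVneq i i'; last first.
  have ip : i <= i' - 1 < i + (len k.+1 t)%:Z by lia.
  have [c cn cp] := sub_cover xi ip.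
  have [pr _ _] := blkSP _ _ _ _ xi'.
  have l0 := len_gt0 k true.
  have b1 := blk_sub xi cn.
  have [e1 e2] : i + (c * hl k)%:Z = i' - (len k true)%:Z /\ (c == nu k t) = true.
    have [h|h] := leP (i + (c * hl k)%:Z) (i' - (len k true)%:Z).
      by apply: IH b1 pr _; lia.
    have hh : i' - (len k true)%:Z <= i + (c * hl k)%:Z < i' - (len k true)%:Z + (len k true)%:Z by lia.
    have [e1 e2] := IH _ _ _ _ pr b1 hh.
    by split.
  move: e1; rewrite (eqP e2) => e1; move: ii'; rewrite lenS; lia.
split=> //; rewrite -ei in xi'.
have hh := hl_gt0 k; have ll := len_gt0 k true.
have key s s' : blk x k.+1 i s -> blk x k.+1 i s' -> (nu k s < nu k s')%N -> False.
  move=> /blkSP[_ _ bs] bs' lt; have := blk_sub bs' (ltnW lt); rewrite (ltn_eqF lt) => b2.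
  by have [] // := IH _ _ _ _ bs b2 _; rewrite lexx ltrDl ltz_nat len_gt0.
case: (ltngtP (nu k t) (nu k t')) => [lt|lt|].
- by case: (key _ _ xi xi' lt).
- by case: (key _ _ xi' xi lt).
move: (d_gt0 k); rewrite /nu; case: t t' {xi xi' ii'} => -[] //=; lia.
Qed.
End Blocks.

Section Parsing.
Variables a d : nat -> nat.
Hypothesis a_gt1 : forall k, (1 < a k)%N.
Hypothesis d_gt0 : forall k, (0 < d k)%N.
Local Notation blk := (blk a d).
Local Notation hl := (hl a d).
Local Notation hp := (hp a d).
Local Notation len := (len a d).
Local Notation nu := (nu a d).

Lemma same_letters x y k i i' t : blk x k i t -> blk y k i' t ->
  forall j : nat, (j < len k t)%N -> x (i + j%:Z) = y (i' + j%:Z).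
Proof.
elim: k i i' t => [|k IH] i i' t.
  by rewrite len0 => /= /eqP xi /eqP yi [|//] _; rewrite !addr0 xi yi.
move=> bx by_ j jl.
have [|c cn cj] := @sub_cover a d x k i t (i + j%:Z) bx; first by lia.
have [r rE] : exists r : nat, (j = c * hl k + r)%N.
  by exists (j - c * hl k)%N; lia.
have := IH _ _ _ (blk_sub bx cn) (blk_sub by_ cn) r.
rewrite rE PoszD !addrA; apply; move: cj; rewrite rE; lia.
Qed.

Lemma blk_shift x k i t s : blk (fun n => x (n + s)) k i t = blk x k (i + s) t.
Proof.
have E k' i1 i2 t1 : i1 = i2 -> blk x k' i1 t1 = blk x k' i2 t1 by move->.
elim: k i t => [|k IH] i t //=.
rewrite !IH; congr [&& _, _ & _]; try by apply: E; ring.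
by apply: eq_forallb => c; rewrite IH; apply: E; ring.
Qed.

(** A window around a position that decides whether a block occurs there. *)
Fixpoint radius k := if k is j.+1 then (radius j + len k true + len j true)%N else 1%N.

Lemma blk_local x y k i t :
  (forall n, i - (radius k)%:Z <= n < i + (radius k)%:Z -> x n = y n) ->
  blk x k i t = blk y k i t.
Proof.
elim: k i t => [|k IH] i t xy /=.
  by rewrite xy //=; lia.
have l0 := len_gt0 a d k true.
have hs c : (c <= nu k t)%N -> (c * hl k <= len k.+1 true)%N.
  move=> cn; rewrite lenS (leq_trans _ (leq_addr _ _)) // leq_mul2r.
  by rewrite (leq_trans cn) ?orbT // !nuE; case: t {xy cn}; lia.
congr [&& _, _ & _].
- by apply: IH => n nb; apply: xy => /=; lia.
- apply: eq_forallb => c; have := hs c (ltnW (ltn_ord c)) => hc.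
  by apply: IH => n nb; apply: xy => /=; lia.
- have := hs _ (leqnn (nu k t)) => hc.
  by apply: IH => n nb; apply: xy => /=; lia.
Qed.

Definition covered (x : int -> bool) := forall k p, exists i t,
  blk x k i t /\ i <= p < i + (len k t)%:Z.

Lemma covered_shift x s : covered x -> covered (fun n => x (n + s)).
Proof.
move=> cx k p; have [i [t [bi ip]]] := cx k (p + s).
by exists (i - s), t; rewrite blk_shift subrK; split=> //; lia.
Qed.

Definition boundary x k p := exists t, blk x k p t.

Section Covered.
Variable x : int -> bool.
Hypothesis cx : covered x.

Lemma next_block k i t : blk x k i t -> boundary x k (i + (len k t)%:Z).
Proof.
move=> bi; have [i' [t' [bi' ii']]] := cx k (i + (len k t)%:Z).
exists t'; have [<- //|ne] := eqVneq i' (i + (len k t)%:Z).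
have [h|h] := leP i i'.
  have [|e1 e2] := blk_disj d_gt0 bi bi'; first by lia.
  by move: ii'; rewrite -e1 -e2 => ?; lia.
have [|e1 _] := blk_disj d_gt0 bi' bi; lia.
Qed.

Lemma prev_block k i : boundary x k i -> exists t, blk x k (i - (len k t)%:Z) t.
Proof.
move=> [t bi]; have [i' [t' [bi' ii']]] := cx k (i - 1).
exists t'; suff -> : i - (len k t')%:Z = i' by [].
have [h|h] := leP (i' + (len k t')%:Z) i; first by lia.
have [|e1 _] := blk_disj d_gt0 bi' bi; lia.
Qed.

Lemma up_block k i : blk x k i true -> boundary x k.+1 (i + (len k true)%:Z).
Proof.
move=> bi; have [i' [t' [bi' ii']]] := cx k.+1 i.
have [c cn ci] := sub_cover bi' ii'.
have [e1 e2] := blk_disj d_gt0 (blk_sub bi' cn) bi ci.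
have := next_block bi'; rewrite lenS -e1 (eqP e2) PoszD addrA.
by [].
Qed.

(** Both blocks of level [k.+1] end with [a k] blocks of type [false] and one
    of type [true] of level [k], which is how the shorter one is spelled. *)
Lemma boundary_left k p : boundary x k.+1 p -> forall c : nat, (c <= a k)%N ->
  blk x k (p - (hl k.+1)%:Z + (c * hl k)%:Z) (c == a k).
Proof.
move=> /prev_block[t bt] c ca.
have := blk_sub bt (c := (c + t * d k)%N).
rewrite nuE leq_add2r => /(_ ca); rewrite eqn_add2r.
suff -> : p - (len k.+1 t)%:Z + ((c + t * d k) * hl k)%N%:Z =
  p - (hl k.+1)%:Z + (c * hl k)%:Z by [].
by rewrite lenE hpS; lia.
Qed.

Lemma boundary_left_down k p : boundary x k.+1 p -> boundary x k (p - (hl k.+1)%:Z).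
Proof. by move=> bp; have := boundary_left bp (leq0n _); rewrite mul0n addr0; exists (0 == a k)%N. Qed.

End Covered.

(** The length of the longest word that precedes all boundaries of level [k]:
    it consists of [u_k], preceded by the corresponding word of the level
    below. *)
Fixpoint common k := if k is j.+1 then (hl k + common j)%N else 0%N.

(** Before a boundary of level [k.+1] all points read [u_(k+1)], as this word
    is a suffix of [v_(k+1)]; what precedes it is a boundary of level [k], and
    so on downwards. *)
Lemma agree_left x y k p p' : covered x -> covered y ->
  boundary x k p -> boundary y k p' ->
  forall j : nat, (0 < j <= common k)%N -> x (p - j%:Z) = y (p' - j%:Z).
Proof.
move=> cx cy; elim: k p p' => [|k IH] p p' bx by_ j /=; first by lia.
move=> jl; have [jh|hj] := leqP j (hl k.+1); last first.
  have := IH _ _ (boundary_left_down cx bx) (boundary_left_down cy by_) (j - hl k.+1)%N.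
  rewrite (_ : forall q, q - (hl k.+1)%:Z - (j - hl k.+1)%N%:Z = q - j%:Z); last by lia.
  by rewrite (_ : forall q, q - (hl k.+1)%:Z - (j - hl k.+1)%N%:Z = q - j%:Z); [apply; lia|lia].
have h0 := hl_gt0 a d k.
pose r := (hl k.+1 - j)%N; pose c := minn (r %/ hl k) (a k).
have ca : (c <= a k)%N by exact: geq_minr.
pose s := (r - c * hl k)%N.
have cr : (c * hl k <= r)%N.
  by rewrite (leq_trans _ (leq_trunc_div r (hl k))) // leq_mul2r geq_minl orbT.
have := same_letters (boundary_left cx bx ca) (boundary_left cy by_ ca) (j := s).
have E q : q - (hl k.+1)%:Z + (c * hl k)%:Z + s%:Z = q - j%:Z by rewrite /s; lia.
rewrite !E; apply; rewrite /s /c /minn.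
have := divn_eq r (hl k); have := ltn_mod r (hl k); rewrite h0.
have rl : (r < a k * hl k + len k true)%N by rewrite /r lenE hlS; nia.
case: (ltnP (r %/ hl k) (a k)) => [ra|ar].
  rewrite (ltn_eqF ra) lenE mul0n addn0.
  by move: (r %/ hl k)%N (r %% hl k)%N => ? ?; lia.
by rewrite eqxx => _ _; have := len_gt0 a d k true; lia.
Qed.

(** Before the common suffix [u_(k+1)] of the two blocks, one point shows a
    [u_k] inside [v_(k+1)] and the other one the final [v_k] of the preceding
    block, so the comparison continues one level below. *)
Lemma disagree_left x y k p p' t r : covered x -> covered y ->
  blk x k (p - (len k t)%:Z) t -> blk y k (p' - (len k (~~ t))%:Z) (~~ t) ->
  (forall j : nat, (0 < j <= r)%N -> x (p - j%:Z) = y (p' - j%:Z)) ->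
  (r <= common k)%N.
Proof.
elim: k x y p p' t r => [|k IH] x y p p' t r cx cy.
  rewrite !len0 => /= /eqP xp /eqP yp xy; case: r xy => // r /(_ 1%N isT).
  by rewrite xp yp; case: t {xp yp}.
wlog: x y p p' t cx cy / t.
  move=> W; case: t; first exact: W.
  by move=> bx by_ xy; apply: (W y x p' p true) => //= j jr; rewrite xy.
move=> -> bx by_ xy /=.
have [rh|hr] := leqP r (hl k.+1); first by rewrite (leq_trans rh) // leq_addr.
rewrite -leq_subLR.
apply: (IH x y (p - (hl k.+1)%:Z) (p' - (hl k.+1)%:Z) false) => //=.
- have dn : (d k - 1 <= nu k true)%N by rewrite nuE; have := d_gt0 k; lia.
  have := blk_sub bx dn; rewrite (_ : (_ == _) = false); last first.
    by apply/eqP; rewrite nuE; have := a_gt1 k; lia.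
  rewrite (_ : _ + ((d k - 1) * hl k)%N%:Z = p - (hl k.+1)%:Z - (len k false)%:Z) //.
  rewrite !lenE hpS mul1n mul0n addn0 mulnBl mul1n; have := d_gt0 k; have := hl_gt0 a d k; nia.
- have [b1 _ _] := blkSP _ _ _ _ _ _ by_; move: b1.
  by rewrite lenE /= mul0n addn0.
- move=> j jr; have := xy (j + hl k.+1)%N.
  rewrite (_ : forall q, q - (j + hl k.+1)%N%:Z = q - (hl k.+1)%:Z - j%:Z); last by lia.
  by rewrite (_ : forall q, q - (j + hl k.+1)%N%:Z = q - (hl k.+1)%:Z - j%:Z); [apply; lia|lia].
Qed.
End Parsing.

(** * The words spelled by blocks *)

Section PartialSums.
Variable V : nmodType.
Implicit Type f : int -> V.

Definition psum f (i : int) (n : nat) : V := \sum_(j < n) f (i + j%:Z).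

Lemma psumD f i n m : psum f i (n + m) = psum f i n + psum f (i + n%:Z) m.
Proof.
rewrite /psum big_split_ord /=; congr (_ + _).
by apply: eq_bigr => j _; rewrite PoszD addrA.
Qed.

Lemma psum1 f i : psum f i 1 = f i.
Proof. by rewrite /psum big_ord1 addr0. Qed.

Lemma psum_mul f i c h : psum f i (c * h) = \sum_(j < c) psum f (i + (j * h)%:Z) h.
Proof.
elim: c => [|c IH]; first by rewrite mul0n /psum !big_ord0.
by rewrite mulSnr psumD IH big_ord_recr.
Qed.

End PartialSums.

Section Words.
Variables a d : nat -> nat.
Hypothesis a_gt1 : forall k, (1 < a k)%N.
Hypothesis d_gt0 : forall k, (0 < d k)%N.
Local Notation blk := (blk a d).
Local Notation hl := (hl a d).
Local Notation hp := (hp a d).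
Local Notation len := (len a d).
Local Notation nu := (nu a d).

Fixpoint lett (k : nat) (t : bool) (j : nat) : bool :=
  if k is k'.+1 then
    if (j < nu k' t * hl k')%N then lett k' false (j %% hl k')%N
    else lett k' true (j - nu k' t * hl k')%N
  else t.

Lemma lettS k t j : lett k.+1 t j = if (j < nu k t * hl k)%N
  then lett k false (j %% hl k)%N else lett k true (j - nu k t * hl k)%N.
Proof. by []. Qed.

(** The inequality makes blocks of level [k] longer than any fixed window. *)
Lemma hl_gt k : (k < hl k)%N.
Proof.
elim: k => [//|k IH]; rewrite hlS; have := a_gt1 k; nia.
Qed.

Lemma lett_tail k j : (0 < k)%N -> lett k true (hp k + j) = lett k false j.
Proof.
case: k => // k _; rewrite !lettS hpS !nuE mul1n mul0n addn0.
rewrite [(a k + d k)%N]addnC mulnDl ltn_add2l modnMDl; case: ifP => // _.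
by rewrite subnDl.
Qed.

Lemma lett_prefix k m j : (j < hl k)%N -> lett (k + m) false j = lett k false j.
Proof.
elim: m => [|m IH] jk; first by rewrite addn0.
have jm : (j < hl (k + m))%N.
  elim: m {IH} => [|m IH]; first by rewrite addn0.
  by rewrite addnS hlS; have := a_gt1 (k + m); nia.
rewrite addnS lettS modn_small // IH // nuE mul0n addn0 ifT //.
by have := a_gt1 (k + m); nia.
Qed.

Lemma lett_suffix k m j : (0 < k)%N -> (0 < j <= hl k)%N ->
  lett (k + m) false (hl (k + m) - j) = lett k false (hl k - j).
Proof.
move=> k0 /andP[j0 jk]; elim: m => [|m IH]; first by rewrite addn0.
have jm : (j <= hl (k + m))%N.
  elim: m {IH} => [|m IH]; first by rewrite addn0.
  by rewrite addnS hlS; have := a_gt1 (k + m); nia.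
rewrite -IH addnS lettS nuE mul0n addn0 hlS ifF; last by apply/negbTE; nia.
rewrite -[RHS]lett_tail ?addn_gt0 ?k0 //; congr (lett _ _ _); nia.
Qed.

(** Occurrence of a word, without the condition on what precedes it. *)
Definition occ (x : int -> bool) i k t :=
  forall j : nat, (j < len k t)%N -> x (i + j%:Z) = lett k t j.

Lemma occ_sub x i k t c : occ x i k.+1 t -> (c <= nu k t)%N ->
  occ x (i + (c * hl k)%:Z) k (c == nu k t).
Proof.
move=> ox cn j jl; rewrite -addrA -PoszD ox; last first.
  by rewrite lenS; move: jl cn; have [->|ne] := eqVneq c (nu k t); rewrite ?lenE; nia.
rewrite lettS; move: jl; have [->|ne] := eqVneq c (nu k t).
  by move=> _; rewrite ltnNge leq_addr /= addKn.
rewrite lenE mul0n addn0 => jl; rewrite ifT ?modnMDl ?modn_small //.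
by have : (c < nu k t)%N by [rewrite ltn_neqAle ne]; nia.
Qed.

Lemma occ_tail x i k : (0 < k)%N -> occ x i k true -> occ x (i + (hp k)%:Z) k false.
Proof.
move=> k0 ox j jl; rewrite -addrA -PoszD ox ?lett_tail //.
by move: jl; rewrite !lenE; lia.
Qed.

(** When [u_k] precedes, the last [v] of that word is the delimiter that an
    occurrence of a block needs, at all levels below [k]. *)
Lemma occ_blk x i k t : occ x i k t ->
  ((0 < k)%N -> occ x (i - (hl k)%:Z) k false) -> blk x k i t.
Proof.
elim: k i t => [|k IH] i t ox.
  by move=> _; have := ox 0%N; rewrite len0 addr0 /= => ->.
move=> /(_ isT) ol; have a1 := a_gt1 k.
have lE : hl k.+1 = (a k * hl k + len k true)%N by rewrite hlS lenE mul1n; lia.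
have nuf : nu k false = a k by rewrite nuE mul0n addn0.
have ov : occ x (i - (len k true)%:Z) k true.
  have := occ_sub ol (leqnn _); rewrite eqxx nuf lE.
  by rewrite (_ : _ + (a k * hl k)%N%:Z = i - (len k true)%:Z) //; lia.
apply/blkSP; split.
- apply: IH ov _ => _; have := occ_sub ol (c := (a k - 1)%N); rewrite nuf lE.
  rewrite leq_subr => /(_ isT); rewrite (_ : (_ == _) = false); last by apply/eqP; lia.
  rewrite (_ : _ + ((a k - 1) * hl k)%N%:Z = i - (len k true)%:Z - (hl k)%:Z) //.
  have hk : (hl k <= a k * hl k)%N by nia.
  by rewrite mulnBl mul1n; lia.
- move=> [|c] cn.
    have := occ_sub ox (leq0n _); rewrite mul0n addr0 (ltn_eqF cn) => o1.
    apply: IH o1 _ => k0; have := occ_tail k0 ov.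
    by rewrite (_ : _ + (hp k)%:Z = i - (hl k)%:Z) // lenE mul1n; lia.
  have := occ_sub ox (ltnW cn); rewrite (ltn_eqF cn) => o1.
  apply: IH o1 _ => _; have := occ_sub ox (ltnW (ltnW cn)); rewrite (ltn_eqF (ltnW cn)).
  by rewrite (_ : _ + (c * hl k)%N%:Z = i + (c.+1 * hl k)%N%:Z - (hl k)%:Z) // mulSn; lia.
- have := occ_sub ox (leqnn _); rewrite eqxx => o1.
  apply: IH o1 _ => _; have n0 : (0 < nu k t)%N by rewrite nuE; lia.
  have := occ_sub ox (leq_pred (nu k t)); rewrite (_ : (_ == _) = false); last by apply/eqP; lia.
  rewrite (_ : _ + ((nu k t).-1 * hl k)%N%:Z = i + (nu k t * hl k)%N%:Z - (hl k)%:Z) //.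
  by case: (nu k t) n0 => // n _; rewrite mulSn /=; lia.
Qed.

(** The two-sided limit of the words of type [false], which are prefixes and
    suffixes of each other. *)
Definition base_point (i : int) : bool :=
  match i with
  | Posz n => lett n false n
  | Negz n => lett n.+1 false (hl n.+1 - n.+1)
  end.

Lemma base_right k : occ base_point 0 k false.
Proof.
move=> j; rewrite lenE mul0n addn0 add0r /= => jk.
have [jk'|kj] := leqP j k.
  by rewrite -[in RHS](subnKC jk') lett_prefix // hl_gt.
by rewrite -{1}(subnKC (ltnW kj)) lett_prefix.
Qed.

Lemma base_left k : (0 < k)%N -> occ base_point (- (hl k)%:Z) k false.
Proof.
move=> k0 j; rewrite lenE mul0n addn0 => jk.
pose n := (hl k - j).-1.
have nE : n.+1 = (hl k - j)%N by rewrite /n; lia.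
have -> : - (hl k)%:Z + j%:Z = Negz n by rewrite NegzE nE; lia.
have -> : j = (hl k - n.+1)%N by rewrite nE; lia.
rewrite /base_point; have [nk|kn] := leqP n.+1 k.
  by rewrite -(subnKC nk) lett_suffix //= ltnW // hl_gt.
rewrite -{1 2}(subnKC (ltnW kn)) lett_suffix //=; last by rewrite nE leq_subr.
Qed.

Lemma base_blk k : blk base_point k 0 false.
Proof.
by apply: occ_blk => [|k0]; [exact: base_right|rewrite sub0r; exact: base_left].
Qed.

Lemma base_covered : covered a d base_point.
Proof.
move=> k p; pose K := (maxn k `|p|).
have kK : (k <= K)%N by exact: leq_maxl.
have pK : (`|p| < hl K)%N by rewrite (leq_ltn_trans (leq_maxr k _)) // hl_gt.
have [p0|p0] := leP 0 p.
  by apply: cover_down kK (base_blk K) _; rewrite lenE; lia.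
have /blkSP[b _ _] := base_blk K.+1.
by apply: cover_down kK b _; rewrite lenE; lia.
Qed.

(** The number of letters 1 in [u_k] or [v_k]; it follows the recursion of the
    lengths from the initial vector [(0, 1)]. *)
Definition mlen k (t : bool) := ((vec a d 0 1 k).1 + t * (vec a d 0 1 k).2)%N.

Lemma mlenS k t : mlen k.+1 t = (nu k t * mlen k false + mlen k true)%N.
Proof. by rewrite /mlen nuE /=; case: t; nia. Qed.

Lemma psum_blk (V : nmodType) (f : int -> V) k i t : psum f i (len k.+1 t) =
  \sum_(c < nu k t) psum f (i + (c * hl k)%:Z) (hl k) +
  psum f (i + (nu k t * hl k)%:Z) (len k true).
Proof. by rewrite lenS psumD psum_mul. Qed.

Lemma ones_blk x k i t : blk x k i t ->
  psum (fun n => (x n)%:Z) i (len k t) = (mlen k t)%:Z.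
Proof.
elim: k i t => [|k IH] i t; first by rewrite len0 psum1 /= => /eqP ->; rewrite /mlen /= muln1.
move=> bx; rewrite psum_blk; have := IH _ _ (blk_sub bx (leqnn _)).
rewrite eqxx => ->; rewrite mlenS PoszD; congr (_ + _).
rewrite (eq_bigr (fun=> (mlen k false)%:Z)) => [|c _].
  by rewrite sumr_const card_ord -mulr_natl PoszM natz.
have := IH _ _ (blk_sub bx (ltnW (ltn_ord c))).
by rewrite (ltn_eqF (ltn_ord c)) lenE mul0n addn0.
Qed.

End Words.

(** * A criterion for the maximal equicontinuous factor *)

HB.instance Definition _ := Finite.on bool.

Section ShiftSpace.
Variable A : alphabetType.
Implicit Types (x y : full_shift A) (X : set (full_shift A)).

Definition agree (n : nat) x y := forall i : int, `|i| <= n%:Z -> x i = y i.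

Lemma agree_le m n x y : (m <= n)%N -> agree n x y -> agree m x y.
Proof. by move=> mn xy i im; apply: xy; rewrite (le_trans im) // lez_nat. Qed.

Lemma nbhs_agree x n : nbhs x (agree n x).
Proof.
have H i : nbhs x [set y : full_shift A | x i = y i].
  have H0 : nbhs (x i : discrete_topology A) [set z | x i = z].
    by apply: open_nbhs_nbhs; split=> //; exact: (@discrete_open (discrete_topology A)).
  exact: (@proj_continuous int (fun=> discrete_topology A) i x _ H0).
elim: n => [|n IH].
  by apply: filterS (H 0) => y xy i i0; have -> : i = 0 by lia.
apply: filterS (filterI IH (filterI (H n.+1%:Z) (H (- n.+1%:Z)))) => y [xy [x1 x2]] i iS.
have [e|ne] := eqVneq i n.+1%:Z; first by rewrite e.
have [e|ne'] := eqVneq i (- n.+1%:Z); first by rewrite e.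
by apply: xy; lia.
Qed.

Lemma nbhs_agreeP x (U : set (full_shift A)) :
  nbhs x U -> exists n, agree n x `<=` U.
Proof.
move=> nU; apply: contrapT => /forallNP H.
have /choice [u uP] n : exists y, agree n x y /\ ~ U y.
  by apply: contrapT => /forallNP h; apply: (H n) => y xy; apply: contrapT => ny; apply: (h y).
suff cu : u @ \oo --> x.
  by have [N _ /(_ N (leqnn _))] := cu _ nU; case: (uP N).
apply/cvg_sup => i W [_ [[V oV <-] Vx] sVU].
exists `|i|%N => // n /= ni; apply: sVU; rewrite /preimage /=.
have [ag _] := uP n; suff <- : x i = u n i by [].
by apply: ag; rewrite -abszE lez_nat.
Qed.

Lemma full_shift_compact : compact [set: full_shift A].
Proof.
have := @tychonoff int (fun=> discrete_topology A) (fun=> setT).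
rewrite (_ : [set f : forall i : int, _ | _] = setT); last first.
  by rewrite eqEsubset; split.
apply=> i; apply: finite_compact; exact: finite_finset.
Qed.

Definition shiftz (s : int) x : full_shift A := fun i => x (i + s).

Lemma shiftz0 x : shiftz 0 x = x.
Proof. by apply: funext => i; rewrite /shiftz addr0. Qed.

Lemma shiftzD s t x : shiftz s (shiftz t x) = shiftz (s + t) x.
Proof. by apply: funext => i; rewrite /shiftz addrA. Qed.

Lemma iter_left_shift n x : iter n (@left_shift A) x = shiftz n%:Z x.
Proof.
elim: n => [|n IH]; first by rewrite shiftz0.
by rewrite iterS IH; apply: funext => i; rewrite /left_shift /shiftz; congr x; lia.
Qed.

Lemma subshift_shiftz X s x : subshift X -> X x -> X (shiftz s x).
Proof.
move=> [_ XX] Xx.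
have fw y : X y -> X (left_shift y) by move=> Xy; rewrite -XX; exists y.
have bw y : X y -> X (shiftz (-1) y).
  move=> Xy; have : (@left_shift A @` X) y by rewrite XX.
  move=> [z Xz <-]; suff -> : shiftz (-1) (left_shift z) = z by [].
  by apply: funext => i; rewrite /shiftz /left_shift subrK.
case: s => n.
  by rewrite -iter_left_shift; elim: n => //= n /fw.
elim: n => [|n IH]; first exact: bw.
by have := bw _ IH; rewrite shiftzD; congr (X (shiftz _ x)); rewrite !NegzE; lia.
Qed.

(** Sequential compactness, in terms of windows. *)
Lemma closed_cluster X (u : nat -> full_shift A) : closed X ->
  (forall n, X (u n)) ->
  exists2 x, X x & forall n m, exists2 N, (m <= N)%N & agree n x (u N).
Proof.
move=> cX Xu; have kX : compact X.
  by apply: subclosed_compact cX full_shift_compact _.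
have [|x [Xx cx]] := kX (u @ \oo) (fmap_proper_filter u _); first by exists 0%N => // n _; exact: Xu.
exists x => // n m.
have [|_ [[N /= mN <-] ag]] := cx (u @` [set N | (m <= N)%N]) (agree n x) _ (nbhs_agree _ _).
  by exists m => // N /= mN; exists N.
by exists N.
Qed.

End ShiftSpace.

Section MaximalFactor.
Variables (A : alphabetType) (X : set (full_shift A)).
Hypothesis sX : subshift X.

Let compactX : compact X.
Proof. by apply: subclosed_compact sX.1 (@full_shift_compact A) _. Qed.

(** The images of the points shifted to the windows in the past are close, and
    equicontinuity carries this closeness forward in time, back to [x] and [y]. *)
Lemma past_agree_equicontinuous (Z : uniformType) (h : Z -> Z)
    (phi : full_shift A -> Z) (x y : full_shift A) :
  equicontinuous_system h -> factor_map X (@left_shift A) h phi -> X x -> X y ->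
  (forall N, exists n : nat, agree N (shiftz (- n%:Z) x) (shiftz (- n%:Z) y)) ->
  phi x = phi y.
Proof.
move=> [cZ hZ ch eqh] [cphi _ phih] Xx Xy xy.
have phi_iter n u : X u -> phi (shiftz n%:Z u) = iter n h (phi u).
  elim: n u => [|n IH] u Xu; first by rewrite shiftz0.
  rewrite -iter_left_shift iterS phih ?iter_left_shift ?IH //.
  exact: subshift_shiftz.
apply: (close_eq hZ); rewrite closeEnbhs.
apply: contrapT => ncl.
have [E entE nE] : exists2 E, entourage E & ~ E (phi x, phi y).
  apply: contrapT => H; apply: ncl => U V /= nU; rewrite -nbhs_entourageE => -[E entE EV].
  exists (phi y); split.
    move: nU; rewrite -nbhs_entourageE => -[F entF FU]; apply: FU.
    by apply/xsectionP; apply: contrapT => nF; apply: H; exists F.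
  by apply: EV; apply/xsectionP; exact: entourage_refl.
pose F := split_ent E.
have /choice [u uP] N : exists uv : full_shift A * full_shift A,
    [/\ X uv.1, X uv.2, agree N uv.1 uv.2 & exists n, phi x = iter n h (phi uv.1) /\ phi y = iter n h (phi uv.2)].
  have [n ag] := xy N; exists (shiftz (- n%:Z) x, shiftz (- n%:Z) y).
  split=> //=; try exact: subshift_shiftz.
  by exists n; rewrite -!phi_iter ?shiftzD ?subrr ?shiftz0 //; exact: subshift_shiftz.
have [|w Xw wP] := @closed_cluster A X (fun N => (u N).1) sX.1; first by move=> N; case: (uP N).
have entF : entourage F by exact: entourage_split_ent.
have nb : \forall v \near w, X v -> forall n, (F `&` F^-1)%relation (iter n h (phi w), iter n h (phi v)).
  have e1 : \forall z \near phi w, forall n, (F `&` F^-1)%relation (iter n h (phi w), iter n h z).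
    by apply: eqh; apply: filterI => //; exact: entourage_inv.
  by have := cphi w _ e1; rewrite nbhs_simpl /= {1}/nbhs /= -nbhs_subspace_in.
have [m mP] := nbhs_agreeP nb.
have [N mN wN] := wP m m.
have [Xu1 Xu2 ag [n [xE yE]]] := uP N.
apply: nE; rewrite xE yE; apply: (entourage_split (iter n h (phi w))) => //.
  by have [_ ] := mP _ wN Xu1 n.
have wv : agree m w (u N).2.
  by move=> i im; rewrite wN // ag // (le_trans im) // lez_nat.
by have [] := mP _ wv Xu2 n.
Qed.

(** Any equicontinuous factor is constant on the fibres of [pi], hence factors
    through [pi] as a map; continuity of the quotient map follows from
    compactness of [X]. *)
Theorem maximal_equicontinuous_factor_criterion (Y : uniformType) (g : Y -> Y)
    (pi : full_shift A -> Y) :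
  equicontinuous_system g -> factor_map X (@left_shift A) g pi ->
  (forall x y, X x -> X y -> pi x = pi y ->
    forall N, exists n : nat, agree N (shiftz (- n%:Z) x) (shiftz (- n%:Z) y)) ->
  has_maximal_equicontinuous_factor X (@left_shift A) g.
Proof.
move=> eqg fpi fib; split=> //; exists pi => // Z h phi eqh fphi.
have [cpi spi pig] := fpi; have [cphi sphi phih] := fphi.
have /choice [s sP] z : exists x, X x /\ pi x = z.
  have : (pi @` X) z by rewrite spi.
  by move=> [x Xx <-]; exists x.
have psiE x : X x -> phi x = phi (s (pi x)).
  move=> Xx; have [Xs es] := sP (pi x).
  exact: past_agree_equicontinuous eqh fphi Xx Xs (fib _ _ Xx Xs (esym es)).
exists (phi \o s) => //; split.
- apply: continuous_subspaceT; apply/continuous_closedP => C cC.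
  have -> : (phi \o s) @^-1` C = pi @` (X `&` phi @^-1` C).
    rewrite eqEsubset; split=> z /=.
      by move=> Cz; have [Xs es] := sP z; exists (s z).
    by move=> [x [Xx Cx] <-]; rewrite -psiE.
  have [_ hY _ _] := eqg.
  suff kpi : compact (pi @` (X `&` phi @^-1` C)) by exact: (compact_closed hY kpi).
  apply: (@continuous_compact _ Y pi); first by apply: continuous_subspaceW cpi => ? [].
  move: cphi => /continuous_closedP /(_ _ cC) /closed_subspaceP[V cV VX].
  by rewrite setIC -VX setIC; apply: compact_closedI.
- rewrite eqEsubset; split=> // z _.
  have : (phi @` X) z by rewrite sphi.
  by move=> [x Xx <-]; exists (pi x) => //=; rewrite -psiE.
- move=> z _ /=; have [Xs es] := sP z.
  by rewrite -{1}es -pig // -psiE ?phih //; exact: (subshift_shiftz 1 sX Xs).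
Qed.
End MaximalFactor.

(** * The subshift of a sequence of block lengths *)

Section BlockSubshift.
Variables a d : nat -> nat.
Hypothesis a_gt1 : forall k, (1 < a k)%N.
Hypothesis d_gt0 : forall k, (0 < d k)%N.
Local Notation blk := (blk a d).
Local Notation hl := (hl a d).
Local Notation len := (len a d).
Local Notation nu := (nu a d).
Local Notation covered := (covered a d).
Local Notation boundary := (boundary a d).

Definition block_subshift : set (full_shift bool) := [set x | covered x].

Lemma len_le_true k t : (len k t <= len k true)%N.
Proof. by rewrite !lenE; case: t => //=; lia. Qed.

Lemma block_subshift_subshift : subshift block_subshift.
Proof.
split; last first.
  rewrite eqEsubset; split=> [_ [x cx <-]|x cx]; first exact: covered_shift.
  exists (fun i => x (i + -1)); first exact: covered_shift.
  by apply: funext => i; rewrite /left_shift addrK.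
move=> x clx k p.
pose n := (`|p| + len k true + radius a d k)%N.
have [y [cy xy]] := clx _ (nbhs_agree x n).
have [i [t [bi ip]]] := cy k p; exists i, t; split=> //.
rewrite (blk_local (y := y)) // => m mi; apply: xy.
by have := len_le_true k t; rewrite /n; lia.
Qed.

Lemma boundary_false x k p : boundary x k.+1 p -> blk x k p false.
Proof.
move=> [t bt]; have := blk_sub bt (leq0n _); rewrite mul0n addr0.
by rewrite (_ : (0 == nu k t)%N = false) //; apply/eqP; rewrite nuE; have := a_gt1 k; lia.
Qed.

(** The pairs [uu], [uv] and [vu] already occur in [u_(k+2)], and [vv] never
    occurs. *)
Lemma pair_occurs x y k i t t' : covered x -> covered y ->
  blk x k i t -> blk x k (i + (len k t)%:Z) t' ->
  exists p, blk y k p t /\ blk y k (p + (len k t)%:Z) t'.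
Proof.
move=> cx cy b1 b2; have [q [s [bq _]]] := cy k.+2 0.
have {bq} bq : blk y k.+1 q false by apply: boundary_false; exists s.
have a1 := a_gt1 k; have nuf : nu k false = a k by rewrite nuE mul0n addn0.
have u c : (c < a k)%N -> blk y k (q + (c * hl k)%:Z) false.
  by move=> ca; have := blk_sub bq (c := c); rewrite nuf (ltn_eqF ca); apply; exact: ltnW.
have v : blk y k (q + (a k * hl k)%:Z) true.
  by have := blk_sub bq (leqnn _); rewrite eqxx nuf.
have lf : len k false = hl k by rewrite lenE mul0n addn0.
case: t t' b1 b2 => -[] b1 b2.
- have := boundary_false (up_block d_gt0 cx b1).
  by move=> b3; have [|_ ] := blk_disj d_gt0 b2 b3; [have := len_gt0 a d k true; lia|].
- exists (q + (a k * hl k)%:Z); split=> //.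
  by apply: boundary_false; exact: up_block.
- exists (q + ((a k).-1 * hl k)%:Z); split; first by apply: u; lia.
  rewrite lf (_ : _ + _ = q + (a k * hl k)%:Z) //.
  by case: (a k) a1 => // n _; rewrite mulSn /=; lia.
- exists q; split; first by have := u 0%N; rewrite mul0n addr0; apply; lia.
  by rewrite lf -[hl k]mul1n; apply: u.
Qed.

(** A word of a point of the subshift lies in two consecutive blocks of a high
    level, and every pair of consecutive blocks occurs in every point. *)
Lemma block_subshift_minimal : minimal_subshift block_subshift.
Proof.
split; [exact: block_subshift_subshift|by exists (base_point a d); exact: base_covered|].
move=> Y sY [y Yy] YX; rewrite eqEsubset; split=> // x cx.
have cy := YX _ Yy.
apply: sY.1 => U /nbhs_agreeP[n nU].
pose k := (2 * n).+1; have hk := @hl_gt a d a_gt1 k.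
have [i [t [b1 ip]]] := cx k (- n%:Z).
have [t' b2] := next_block d_gt0 cx b1.
have [p [p1 p2]] := pair_occurs cx cy b1 b2.
exists (shiftz (p - i) y); split; first exact: subshift_shiftz.
apply: nU => j jn; rewrite /shiftz.
have ll : (2 * n < len k t')%N by rewrite lenE /k in hk *; lia.
have [jl|lj] := ltP j (i + (len k t)%:Z).
  have [r rE] : exists r : nat, j = i + r%:Z by exists `|j - i|%N; lia.
  rewrite rE (same_letters b1 p1); last by lia.
  by congr y; lia.
have [r rE] : exists r : nat, j = i + (len k t)%:Z + r%:Z by exists (absz (j - (i + (len k t)%:Z))%R); lia.
rewrite rE (same_letters b2 p2); last by lia.
by congr y; lia.
Qed.

End BlockSubshift.

(** * Right special words *)

Section RightSpecial.
Variables a d : nat -> nat.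
Hypothesis a_gt1 : forall k, (1 < a k)%N.
Hypothesis d_gt0 : forall k, (0 < d k)%N.
Local Notation blk := (blk a d).
Local Notation hl := (hl a d).
Local Notation len := (len a d).
Local Notation nu := (nu a d).
Local Notation covered := (covered a d).
Local Notation boundary := (boundary a d).
Local Notation common := (common a d).

Let hl0 k : (0 < hl k)%N := hl_gt0 a d k.
Let nu_false k : nu k false = a k. Proof. by rewrite nuE mul0n addn0. Qed.
Let nu_true k : nu k true = (a k + d k)%N. Proof. by rewrite nuE mul1n. Qed.
Let len_false k : len k false = hl k. Proof. by rewrite lenE mul0n addn0. Qed.
Let nu_le k t : (nu k t <= a k + d k)%N.
Proof. by case: t; rewrite ?nu_false ?nu_true ?leq_addr. Qed.

(** The length of the word [u_(k-1)^(a_(k-1)) ... u_0^(a_0)]. *)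
Fixpoint zl k := if k is j.+1 then (a j * hl j + zl j)%N else 0%N.

Lemma zlS k : zl k.+1 = (a k * hl k + zl k)%N. Proof. by []. Qed.

Lemma zl_ge k : (k <= zl k)%N.
Proof. by elim: k => //= k IH; have := hl0 k; have := a_gt1 k; nia. Qed.

(** This word is read to the left of the origin. Two points that differ at 0
    both read it, up to the level at which their pasts separate. *)
Definition chain x k := forall j, (j < k)%N -> forall c, (c < a j)%N ->
  blk x j (- (zl j.+1)%:Z + (c * hl j)%:Z) false.

Definition run x k i := forall c, (0 < c <= i)%N ->
  blk x k (- (zl k)%:Z - (c * hl k)%:Z) false.

Definition chain_run x k i :=
  [/\ chain x k, run x k i & boundary x k (- (zl k)%:Z - (i * hl k)%:Z)].

Lemma chain_run_le x k i m : covered x -> (m <= i)%N ->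
  chain_run x k i -> chain_run x k m.
Proof.
move=> cx mi [ch ru bo]; split=> //.
  by move=> c /andP[c0 cm]; apply: ru; rewrite c0 (leq_trans cm).
move: mi; rewrite leq_eqVlt => /predU1P[-> //|mi].
have /(next_block d_gt0 cx) := ru m.+1 mi.
by rewrite len_false (_ : _ + (hl k)%:Z = - (zl k)%:Z - (m * hl k)%:Z) // mulSn; lia.
Qed.

Lemma same_run x y k p p' n :
  (forall c, (c < n)%N -> blk x k (p + (c * hl k)%:Z) false) ->
  (forall c, (c < n)%N -> blk y k (p' + (c * hl k)%:Z) false) ->
  forall r : nat, (r < n * hl k)%N -> x (p + r%:Z) = y (p' + r%:Z).
Proof.
move=> bx by_ r rn; pose c := (r %/ hl k)%N.
have cn : (c < n)%N by rewrite ltn_divLR.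
have := same_letters (bx c cn) (by_ c cn) (j := (r %% hl k)%N).
by rewrite len_false ltn_mod hl0 -!addrA -PoszD -divn_eq; apply.
Qed.

Lemma chain_agree x y k : chain x k -> chain y k ->
  forall j : nat, (0 < j <= zl k)%N -> x (- j%:Z) = y (- j%:Z).
Proof.
elim: k => [|k IH] chx chy j; first by rewrite /=; lia.
move=> /andP[j0 jz]; have [jk|kj] := leqP j (zl k).
  by apply: IH; rewrite ?j0 //; move=> l lk; [apply: chx|apply: chy]; exact: ltnW.
have := same_run (chx _ (ltnSn k)) (chy _ (ltnSn k)) (r := (zl k.+1 - j)%N).
have -> : - (zl k.+1)%:Z + (zl k.+1 - j)%N%:Z = - j%:Z by lia.
by apply; move: jz kj; rewrite zlS; lia.
Qed.

Lemma chain_run_agree x y k m : covered x -> covered y ->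
  chain_run x k m -> chain_run y k m ->
  forall j : nat, (0 < j <= zl k + m * hl k + common k)%N -> x (- j%:Z) = y (- j%:Z).
Proof.
move=> cx cy [chx rx bx] [chy ry by_] j /andP[j0 jl].
have [jz|zj] := leqP j (zl k); first by apply: (chain_agree chx chy); rewrite j0.
have [jr|rj] := leqP j (zl k + m * hl k).
  have P w : run w k m -> forall c, (c < m)%N ->
      blk w k (- (zl k)%:Z - (m * hl k)%:Z + (c * hl k)%:Z) false.
    move=> rw c cm; have := rw (m - c)%N; rewrite leq_subr subn_gt0 cm => /(_ isT).
    have cm' : (c * hl k <= m * hl k)%N by rewrite leq_mul2r (ltnW cm) orbT.
    by rewrite mulnBl (_ : _ - (m * hl k - c * hl k)%N%:Z = - (zl k)%:Z - (m * hl k)%:Z + (c * hl k)%:Z) //; lia.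
  have := same_run (P _ rx) (P _ ry) (r := (zl k + m * hl k - j)%N).
  have -> : - (zl k)%:Z - (m * hl k)%:Z + (zl k + m * hl k - j)%N%:Z = - j%:Z by lia.
  by apply; lia.
have := agree_left d_gt0 cx cy bx by_ (j := (j - (zl k + m * hl k))%N).
have -> : - (zl k)%:Z - (m * hl k)%:Z - (j - (zl k + m * hl k))%N%:Z = - j%:Z by lia.
by apply; lia.
Qed.

(** The level-[K] blocks ending the windows of two points are compared towards
    the left: the runs of blocks of type [false] have different lengths, and
    then the common past has an explicit length, or they have the same length
    and the comparison moves to level [K.+1], with the two types exchanged. *)
Lemma special_step x y K q : covered x -> covered y -> chain x K -> chain y K ->
  blk x K (- (zl K)%:Z) false -> blk y K (- (zl K)%:Z) true ->
  (forall j : nat, (0 < j <= q)%N -> x (- j%:Z) = y (- j%:Z)) ->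
  (exists i, [/\ (i < a K + d K)%N, chain_run x K i, chain_run y K i &
     (q <= zl K + i * hl K + common K)%N]) \/
  [/\ chain x K.+1, chain y K.+1, blk x K.+1 (- (zl K.+1)%:Z) true &
      blk y K.+1 (- (zl K.+1)%:Z) false].
Proof.
move=> cx cy chx chy bx by_ xy.
have sub w t : covered w -> blk w K (- (zl K)%:Z) t -> exists s c,
   [/\ (c <= nu K s)%N, (c == nu K s) = t & blk w K.+1 (- (zl K)%:Z - (c * hl K)%:Z) s].
  move=> cw bw; have [i [s [bi ip]]] := cw K.+1 (- (zl K)%:Z).
  have [c cn cp] := sub_cover bi ip.
  have [e1 e2] := blk_disj d_gt0 (blk_sub bi cn) bw cp.
  by exists s, c; split=> //; rewrite -e1 addrK.
have [s [c [cn /negbT cs bxs]]] := sub _ _ cx bx.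
have [s' [c' [_ /eqP -> bys]]] := sub _ _ cy by_.
have {cs} cs : (c < nu K s)%N by rewrite ltn_neqAle cs.
have CR w m n t : covered w -> chain w K -> (m <= n <= nu K t)%N ->
    blk w K.+1 (- (zl K)%:Z - (n * hl K)%:Z) t -> chain_run w K m.
  move=> cw chw /andP[mn nn] bw.
  have B e : (e <= n)%N -> blk w K (- (zl K)%:Z - (e * hl K)%:Z) ((n - e)%N == nu K t).
    move=> en; have := blk_sub bw (leq_trans (leq_subr e n) nn).
    have en' : (e * hl K <= n * hl K)%N by rewrite leq_mul2r en orbT.
    by rewrite mulnBl (_ : _ + (n * hl K - e * hl K)%N%:Z = - (zl K)%:Z - (e * hl K)%:Z) //; lia.
  split=> //; last by exists ((n - m)%N == nu K t); exact: B.
  move=> e /andP[e0 em]; have := B e (leq_trans em mn).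
  by rewrite (_ : (_ == _) = false) //; apply/eqP; lia.
have [e|ne] := eqVneq c (nu K s').
  right; have ss : s = true /\ s' = false.
    by move: cs; rewrite e; case: s {bxs cn}; case: s' {e bys}; rewrite ?nu_false ?nu_true; lia.
  case: ss => es es'; move: e bxs bys; rewrite es es' nu_false => ->.
  have -> : - (zl K)%:Z - (a K * hl K)%:Z = - (zl K.+1)%:Z by rewrite zlS; lia.
  move=> bxs bys; split=> // j; rewrite ltnS leq_eqVlt => /predU1P[->|jK] e ea.
  - by have := blk_sub bxs (c := e); rewrite nu_true (_ : (_ == _) = false); [apply; lia|apply/eqP; lia].
  - exact: chx.
  - by have := blk_sub bys (c := e); rewrite nu_false (ltn_eqF ea); apply; exact: ltnW.
  - exact: chy.
left; exists (minn c (nu K s')).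
have cr1 : chain_run x K (minn c (nu K s')).
  by apply: CR bxs; rewrite // geq_minl.
have cr2 : chain_run y K (minn c (nu K s')).
  by apply: CR bys; rewrite // geq_minr leqnn.
split=> //; first by rewrite (leq_ltn_trans (geq_minl _ _)) // (leq_trans cs).
set m := minn _ _; rewrite -leq_subLR.
have xy' (w w' : int -> bool) : (forall j : nat, (0 < j <= q)%N -> w (- j%:Z) = w' (- j%:Z)) ->
   forall j : nat, (0 < j <= q - (zl K + m * hl K))%N ->
   w (- (zl K)%:Z - (m * hl K)%:Z - j%:Z) = w' (- (zl K)%:Z - (m * hl K)%:Z - j%:Z).
  move=> H j jq; have := H (zl K + m * hl K + j)%N.
  have -> : - (zl K + m * hl K + j)%N%:Z = - (zl K)%:Z - (m * hl K)%:Z - j%:Z by lia.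
  by apply; lia.
have E (w : int -> bool) n t : (m < n <= nu K t)%N -> blk w K.+1 (- (zl K)%:Z - (n * hl K)%:Z) t ->
    blk w K (- (zl K)%:Z - (m * hl K)%:Z - (len K false)%:Z) false.
  move=> /andP[mn nn] bw; have := blk_sub bw (c := (n - m.+1)%N).
  rewrite (_ : (_ == _) = false); last by apply/eqP; lia.
  have mn' : (m.+1 * hl K <= n * hl K)%N by rewrite leq_mul2r mn orbT.
  rewrite len_false mulnBl (_ : _ + (_ - _)%N%:Z = - (zl K)%:Z - (m * hl K)%:Z - (hl K)%:Z); first by apply; lia.
  by move: mn'; rewrite mulSn; lia.
move: ne; rewrite neq_ltn => /orP[lt|gt].
  have mE : m = c by rewrite /m /minn lt.
  apply: (disagree_left a_gt1 d_gt0 (t := true) cx cy _ _ (xy' _ _ xy)) => /=.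
    by rewrite mE; have [] := blkSP _ _ _ _ _ _ bxs.
  by apply: (E _ _ _ _ bys); rewrite mE lt leqnn.
have mE : m = nu K s' by apply/minn_idPr; exact: ltnW.
apply: (disagree_left a_gt1 d_gt0 (t := true) cy cx _ _ (xy' _ _ _)) => /=.
- by rewrite mE; have [] := blkSP _ _ _ _ _ _ bys.
- by apply: (E _ _ _ _ bxs); rewrite mE gt cn.
- by move=> j jq; rewrite xy.
Qed.

(** The normal form of the past of a right special word of length [q]: a
    chain, preceded by [i] blocks [u_k] and by the [common k] letters that
    precede any boundary of level [k]. As the next block can be [u_k] or
    [v_k], the run is shorter than the [a k + d k] blocks [u_k] of [v_(k+1)]. *)
Definition special_type x q k i :=
  [/\ covered x, chain_run x k i, (i < a k + d k)%N & (q <= zl k + i * hl k + common k)%N].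

(** The comparison of the two pasts climbs the levels until a level separates
    them or the chain is longer than [q]. *)
Lemma special_typeP x y q : covered x -> covered y ->
  (forall j : nat, (0 < j <= q)%N -> x (- j%:Z) = y (- j%:Z)) -> x 0 != y 0 ->
  exists k i, special_type x q k i.
Proof.
move=> cx cy xy xy0.
suff : forall K, (exists k i, special_type x q k i) \/
    exists t, [/\ chain x K, chain y K, blk x K (- (zl K)%:Z) t & blk y K (- (zl K)%:Z) (~~ t)].
  move=> /(_ q)[//|[t [chx _ bx _]]].
  exists q, 0%N; split=> //; rewrite ?mul0n ?addn0; [|by have := a_gt1 q; lia|by have := zl_ge q; lia].
  by split=> // [c|]; [lia|exists t; rewrite mul0n subr0].
elim=> [|K [?|[t [chx chy bx by_]]]]; [|by left|].
  by right; exists (x 0); split=> //=; rewrite oppr0 //; case: (x 0) (y 0) xy0 => -[].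
case: t bx by_ => /= bx by_; last first.
  have [[i [i1 i2 i3 i4]]|[H1 H2 H3 H4]] := special_step cx cy chx chy bx by_ xy.
    by left; exists K, i.
  by right; exists true.
have [|[i [i1 i2 i3 i4]]|[H1 H2 H3 H4]] := special_step cy cx chy chx by_ bx (q := q).
- by move=> j jq; rewrite xy.
- by left; exists K, i.
- by right; exists false.
Qed.

(** Right special words of length at most [low k] can also be read with a run
    of at most [a k] blocks, which is what a chain of higher level gives.
    Between [low k] and [high k] there is one more right special word. *)
Definition low k := (zl k + a k * hl k + common k)%N.
Definition high k := (zl k + (a k + d k - 1) * hl k + common k)%N.

Lemma highE k : high k = (low k + (d k - 1) * hl k)%N.
Proof. by rewrite /high /low; have := d_gt0 k; case: (d k) => // n _; rewrite subn1 subn1 addnS /=; lia. Qed.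

Lemma chain_run_down x k k' i : covered x -> chain_run x k' i -> (k < k')%N ->
  chain_run x k (a k).
Proof.
move=> cx [ch _ _] kk; split; first by move=> j jk; apply: ch; exact: ltn_trans kk.
  move=> c /andP[c0 ca]; have := ch _ kk (a k - c)%N.
  have ca' : (c * hl k <= a k * hl k)%N by rewrite leq_mul2r ca orbT.
  rewrite zlS mulnBl (_ : _ + (_ - _)%N%:Z = - (zl k)%:Z - (c * hl k)%:Z); first by apply; lia.
  by lia.
exists false; have := ch _ kk 0%N; have a1 := a_gt1 k; rewrite mul0n addr0 zlS.
by rewrite (_ : - _ = - (zl k)%:Z - (a k * hl k)%:Z); [apply; lia|lia].
Qed.

Definition exceptional q k i := (a k < i)%N && (low k < q)%N.

(** A chain of higher level contains a run of [a k] blocks [u_k]. Hence all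
    special pasts that are not exceptional agree, and two exceptional ones
    agree if they have the same level. *)
Lemma special_agree x y q k i k' i' : special_type x q k i -> special_type y q k' i' ->
  (k = k' \/ ~~ exceptional q k i /\ ~~ exceptional q k' i') ->
  forall j : nat, (0 < j <= q)%N -> x (- j%:Z) = y (- j%:Z).
Proof.
wlog kk : x y k i k' i' / (k <= k')%N.
  move=> W sx sy H; have [kk|kk] := leqP k k'; first exact: W sx sy H.
  move=> j jq; rewrite (W y x k' i' k i) // ?(ltnW kk) //.
  by case: H => [->|[]]; [left|right].
move=> [cx crx ix qx] [cy cry iy qy] H j /andP[j0 jq].
move: kk; rewrite leq_eqVlt => /predU1P[ek|kk].
  move: cry iy qy; rewrite -ek => cry iy qy.
  apply: (chain_run_agree cx cy (m := minn i i')).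
  - exact: chain_run_le (geq_minl _ _) crx.
  - exact: chain_run_le (geq_minr _ _) cry.
  - by rewrite j0 (leq_trans jq) //; case: (leqP i i').
have {}H : ~~ exceptional q k i by move: H => [e|[]] //; move: kk; rewrite e ltnn.
apply: (chain_run_agree cx cy (m := minn i (a k))).
- exact: chain_run_le (geq_minl _ _) crx.
- exact: (chain_run_le cy (geq_minr i (a k)) (chain_run_down cy cry kk)).
- rewrite j0 (leq_trans jq) //; case: (leqP i (a k)) => // ai.
  by move: H; rewrite /exceptional ai /= -leqNgt.
Qed.

Hypothesis d_le_a : forall k, (d k <= a k)%N.

Lemma high_le_low k k' : (k < k')%N -> (high k <= low k')%N.
Proof.
have S n : (high n <= low n.+1)%N.
  rewrite highE /low zlS -addnA [common n.+1]/=.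
  have : ((d n - 1) * hl n <= hl n.+1)%N.
    by rewrite hlS; have := d_le_a n; have := d_gt0 n; nia.
  by lia.
elim: k' => // k' IH; rewrite ltnS leq_eqVlt => /predU1P[-> //|/IH h].
by rewrite (leq_trans h) // (leq_trans _ (S k')) // highE leq_addr.
Qed.

Lemma special_exceptional x q k i : special_type x q k i -> exceptional q k i ->
  (low k < q <= high k)%N.
Proof.
move=> [_ _ ix qx] /andP[_ ->] /=; rewrite (leq_trans qx) // /high.
by rewrite leq_add2r leq_add2l leq_mul2r; apply/orP; right; lia.
Qed.

(** The intervals of exceptional lengths are disjoint because [d k <= a k], so
    at most one extra special word exists at each length. *)
Lemma window_unique q k k' :
  (low k < q <= high k)%N -> (low k' < q <= high k')%N -> k = k'.
Proof.
by move=> H H'; case: (ltngtP k k') => // /high_le_low; lia.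
Qed.

(** After [a k] sub-blocks, a block of level [k.+1] continues with [v_k] if it
    is [u_(k+1)], and with [u_k] if it is [v_(k+1)]: the type changes at each
    level. *)
Lemma chain_of_block x k t : blk x k (- (zl k)%:Z) t ->
  chain x k /\ x 0 = t (+) odd k.
Proof.
elim: k t => [|k IH] t bx.
  by split=> //; move: bx; rewrite /= oppr0 addbF => /eqP.
have ak : (a k <= nu k t)%N by case: t {bx}; rewrite ?nu_false ?nu_true ?leq_addr.
have := blk_sub bx ak; rewrite (_ : - (zl k.+1)%:Z + (a k * hl k)%N%:Z = - (zl k)%:Z); last by rewrite zlS; lia.
have -> : (a k == nu k t) = ~~ t.
  have d0 := d_gt0 k; case: t {bx ak}; rewrite ?nu_false ?nu_true ?eqxx //=.
  by apply/negbTE/eqP; lia.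
move=> /IH[ch ->]; split; last by rewrite /= addbN addNb.
move=> j; rewrite ltnS leq_eqVlt => /predU1P[->|jk] c cj; last exact: ch.
have := blk_sub bx (leq_trans (ltnW cj) ak).
by rewrite (_ : (_ == _) = false) //; apply/eqP; lia.
Qed.

(** Inside [v_(k+1)], after [i] blocks [u_k] one may find a further [u_k] or
    the final [v_k]; the chains below turn this into a difference at the
    origin. *)
Lemma special_exists k i : (i < a k + d k)%N -> exists x y,
  [/\ special_type x (zl k + i * hl k + common k) k i,
      special_type y (zl k + i * hl k + common k) k i & x 0 != y 0].
Proof.
move=> ib; pose b := base_point a d; have cb : covered b by exact: base_covered.
have /blkSP[bP _ _] := base_blk d a_gt1 k.+2.
set P := (0 - _) in bP.
pose w c := fun n => b (n + (P + (c * hl k)%:Z + (zl k)%:Z)).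
have key c : (i <= c <= a k + d k)%N -> special_type (w c) (zl k + i * hl k + common k) k i /\
    w c 0 = (c == a k + d k)%N (+) odd k.
  move=> /andP[ic cb'].
  have B e : (e <= c)%N -> blk (w c) k (- (zl k)%:Z - (e * hl k)%:Z) ((c - e)%N == (a k + d k)%N).
    move=> ec; rewrite blk_shift; have := blk_sub bP (c := (c - e)%N).
    rewrite nu_true (leq_trans (leq_subr _ _) cb') => /(_ isT).
    have ec' : (e * hl k <= c * hl k)%N by rewrite leq_mul2r ec orbT.
    rewrite (_ : P + ((c - e) * hl k)%N%:Z = - (zl k)%:Z - (e * hl k)%:Z + (P + (c * hl k)%:Z + (zl k)%:Z)) //.
    by rewrite mulnBl; lia.
  have cw : covered (w c) by exact: covered_shift.
  have [|ch w0] := @chain_of_block (w c) k (c == a k + d k)%N.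
    by have := B 0%N; rewrite mul0n subr0 subn0; apply.
  split=> //; split=> //; split=> //.
    move=> e /andP[e0 ei]; have := B e (leq_trans ei ic).
    by rewrite (_ : (_ == _) = false) //; apply/eqP; lia.
  by exists ((c - i)%N == (a k + d k)%N); exact: B.
have [|s1 x1] := key i; first by rewrite leqnn ltnW.
have [|s2 x2] := key (a k + d k)%N; first by rewrite leqnn ltnW.
by exists (w i), (w (a k + d k)%N); split=> //; rewrite x1 x2 eqxx (ltn_eqF ib); case: odd.
Qed.

(** Inside a window [(low k, high k]] the exceptional right special word and
    the ordinary one differ: a block of type [false] against one of type [true]
    to the left of [a k] common blocks. *)
Lemma special_distinct x y q k i k' i' : (low k < q <= high k)%N ->
  (k.+1 < k')%N -> covered x -> covered y -> chain_run x k i -> chain_run y k' i' -> (a k < i)%N ->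
  ~ (forall j : nat, (0 < j <= q)%N -> x (- j%:Z) = y (- j%:Z)).
Proof.
move=> /andP[lq _] kk cx cy [_ rx _] [chy _ _] ai xy.
have bk : boundary y k.+1 (- (zl k.+1)%:Z).
  have := chy _ kk (a k.+1).-1; have a1 := a_gt1 k.+1.
  rewrite ltn_predL => /(_ (ltnW a1)) /(next_block d_gt0 cy); rewrite len_false.
  suff -> : - (zl k.+2)%:Z + ((a k.+1).-1 * hl k.+1)%N%:Z + (hl k.+1)%:Z = - (zl k.+1)%:Z by [].
  by rewrite (zlS k.+1); case: (a k.+1) a1 => // n _; rewrite mulSn [_.-1]/=; lia.
have yv := boundary_left d_gt0 cy bk (leqnn (a k)).
have xu := rx (a k).+1 ai.
have : (q - zl k.+1 <= common k)%N.
  apply: (disagree_left a_gt1 d_gt0 (t := false) (p := - (zl k.+1)%:Z) (p' := - (zl k.+1)%:Z) cx cy).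
  - rewrite len_false; have -> : - (zl k.+1)%:Z - (hl k)%:Z = - (zl k)%:Z - ((a k).+1 * hl k)%N%:Z.
      by rewrite zlS mulSn; lia.
    exact: xu.
  - have -> : - (zl k.+1)%:Z - (len k (~~ false))%:Z = - (zl k.+1)%:Z - (hl k.+1)%:Z + (a k * hl k)%N%:Z.
      by rewrite hlS lenE mul1n; lia.
    by move: yv; rewrite eqxx.
  - move=> j jq; have := xy (zl k.+1 + j)%N.
    have -> : - (zl k.+1 + j)%N%:Z = - (zl k.+1)%:Z - j%:Z by lia.
    by apply; lia.
by move: lq; rewrite /low zlS; lia.
Qed.

End RightSpecial.

(** * Complexity of the block subshift *)

Section Counting.
Variable X : set (full_shift bool).
Hypothesis sX : subshift X.

Definition window (x : int -> bool) (q : nat) : q.-tuple bool :=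
  [tuple x (- q%:Z + j%:Z) | j < q].

Lemma window_eq x y q : window x q = window y q <->
  (forall j : nat, (0 < j <= q)%N -> x (- j%:Z) = y (- j%:Z)).
Proof.
split=> [e j /andP[j0 jq]|e].
  have jl : (q - j < q)%N by lia.
  have := congr1 (fun w => tnth w (Ordinal jl)) e; rewrite !tnth_mktuple /=.
  by have -> : - q%:Z + (q - j)%N%:Z = - j%:Z by lia.
apply: eq_from_tnth => j; rewrite !tnth_mktuple; have jq := ltn_ord j.
have := e (q - j)%N; have -> : - (q - j)%N%:Z = - q%:Z + j%:Z by lia.
by apply; lia.
Qed.

Lemma languageP q (w : q.-tuple bool) :
  reflect (exists2 x, X x & w = window x q) (w \in language X q).
Proof.
rewrite inE; apply: (iffP (asboolP _)) => [[x Xx [i wi]]|[x Xx ->]].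
  exists (shiftz (i + q%:Z) x); first exact: subshift_shiftz.
  apply: eq_from_tnth => j; rewrite wi tnth_mktuple /shiftz; congr x; lia.
by exists x => //; exists (- q%:Z) => j; rewrite tnth_mktuple.
Qed.

Definition extendable q (b : bool) : {set q.-tuple bool} :=
  [set w : q.-tuple bool | rcons_tuple w b \in language X q.+1]%SET.

(** On two letters, the words that can be followed by both; their number is
    the increment of the complexity. *)
Definition right_special q : {set q.-tuple bool} :=
  (extendable q true :&: extendable q false)%SET.

Lemma window_rcons (x : int -> bool) q :
  window x q.+1 = rcons_tuple (window (shiftz (-1) x) q) (shiftz (-1) x 0).
Proof.
apply: eq_from_tnth => j; rewrite tnth_mktuple (tnth_nth false) /= nth_rcons size_map size_enum_ord.
have jq := ltn_ord j; case: ltngtP => jj.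
- by rewrite (nth_map (Ordinal jj)) ?size_enum_ord // nth_enum_ord // /shiftz; congr x; lia.
- by lia.
- by rewrite /shiftz; congr x; lia.
Qed.

Lemma extendableP q b (w : q.-tuple bool) :
  reflect (exists2 x, X x & w = window x q /\ b = x 0) (w \in extendable q b).
Proof.
rewrite inE; apply: (iffP (languageP _)) => [[x Xx e]|[x Xx [-> ->]]].
  exists (shiftz (-1) x); first exact: subshift_shiftz.
  have := congr1 val e; rewrite window_rcons => /= /rcons_inj[e1 e2].
  by split=> //; exact: val_inj.
exists (shiftz 1 x); first exact: subshift_shiftz.
by rewrite window_rcons shiftzD addNr shiftz0.
Qed.

Lemma right_specialP q (w : q.-tuple bool) :
  reflect (exists x y, [/\ X x, X y, w = window x q, w = window y q & x 0 != y 0])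
    (w \in right_special q).
Proof.
rewrite finset.in_setI; apply: (iffP andP).
  move=> [/extendableP[x Xx [wx x0]] /extendableP[y Xy [wy y0]]].
  by exists x, y; split=> //; rewrite -x0 -y0.
move=> [x [y [Xx Xy wx wy]]]; case ex : (x 0); case ey : (y 0) => // _.
  by split; apply/extendableP; [exists x|exists y].
by split; apply/extendableP; [exists y|exists x].
Qed.

(** The words of length [q.+1] are counted by their first [q] letters, the
    words that extend in two ways twice. *)
Lemma complexityS q : complexity X q.+1 = (complexity X q + #|right_special q|)%N.
Proof.
have -> : complexity X q = #|(extendable q true :|: extendable q false)%SET|.
  apply: eq_card => w; rewrite finset.in_setU; apply/languageP/orP.
    move=> [x Xx ->]; case e : (x 0); [left|right]; apply/extendableP; exists x => //.
  by case=> /extendableP[x Xx [-> _]]; exists x.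
rewrite cardsUI.
have inj b : injective (fun w : q.-tuple bool => rcons_tuple w b).
  by move=> w w' /(congr1 val) /= /rcons_inj[]; exact: val_inj.
rewrite -(card_imset _ (inj true)) -(card_imset _ (inj false)) -cardsUI.
rewrite [X in (_ + #|pred_of_set X|)%N](_ : _ = finset.set0); last first.
  apply/setP => w; rewrite finset.in_setI finset.in_set0; apply/negP => /andP[/imsetP[u _ ->]] /imsetP[v _] /(congr1 val) /=.
  by move=> /rcons_inj[].
rewrite cards0 addn0; apply: eq_card => w; rewrite finset.in_setU.
apply/idP/idP => [/languageP[x Xx ->]|].
  have Xx' := subshift_shiftz (-1) sX Xx.
  apply/orP; case e : (shiftz (-1) x 0); [left|right]; apply/imsetP.
    exists (window (shiftz (-1) x) q); last by rewrite window_rcons e.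
    by apply/extendableP; exists (shiftz (-1) x).
  exists (window (shiftz (-1) x) q); last by rewrite window_rcons e.
  by apply/extendableP; exists (shiftz (-1) x).
by move=> /orP[] /imsetP[u + ->]; rewrite inE.
Qed.

Lemma complexity0 : X !=set0 -> complexity X 0 = 1%N.
Proof.
move=> [x Xx]; rewrite /complexity.
have -> : language X 0 = [set window x 0]%SET.
  apply/setP => w; rewrite finset.in_set1; apply/languageP/eqP => [[y _ ->]|->]; last by exists x.
  by apply/window_eq => j; lia.
by rewrite cards1.
Qed.

(** The complexity of a finite subshift is bounded by its cardinal. *)
Lemma infinite_of_complexity : (forall q, (q < complexity X q)%N) -> infinite_set X.
Proof.
move=> cq /finite_seqP[s Xs].
have : (complexity X (size s) <= size s)%N.
  rewrite /complexity cardE; set L := enum _.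
  suff : (size L <= size (map (fun x => window x (size s)) s))%N by rewrite size_map.
  apply: uniq_leq_size; first exact: enum_uniq.
  move=> w; rewrite mem_enum => /languageP[x Xx ->]; apply/mapP; exists x => //.
  by move: Xx; rewrite Xs.
by rewrite leqNgt cq.
Qed.

End Counting.

Section BlockComplexity.
Variables a d : nat -> nat.
Hypothesis a_gt1 : forall k, (1 < a k)%N.
Hypothesis d_gt0 : forall k, (0 < d k)%N.
Hypothesis d_le_a : forall k, (d k <= a k)%N.
Local Notation X := (block_subshift a d).
Local Notation hl := (hl a d).
Local Notation low := (low a d).
Local Notation high := (high a d).
Local Notation zl := (zl a d).
Local Notation common := (common a d).
Local Notation p := (complexity X).
Local Notation RS := (right_special X).

Let sX : subshift X := block_subshift_subshift a d.

Lemma special_window q (w : q.-tuple bool) : w \in RS q ->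
  exists x k i, special_type a d x q k i /\ w = window x q.
Proof.
move=> /(right_specialP sX)[x [y [cx cy wx wy xy0]]].
have xy : window x q = window y q by rewrite -wx.
have [k [i H]] := special_typeP a_gt1 d_gt0 cx cy (proj1 (window_eq _ _ _) xy) xy0.
by exists x, k, i.
Qed.

Lemma window_special q k i : (i < a k + d k)%N -> (q <= zl k + i * hl k + common k)%N ->
  exists2 x, special_type a d x q k i & window x q \in RS q.
Proof.
move=> ib qb; have [x [y [[cx crx _ _] [cy cry _ _] xy0]]] := special_exists a_gt1 d_gt0 ib.
exists x => //; apply/(right_specialP sX); exists x, y; split=> //.
apply/window_eq => j /andP[j0 jq].
by apply: (chain_run_agree d_gt0 cx cy crx cry); rewrite j0 (leq_trans jq).
Qed.

Lemma right_special_ge1 q : (0 < #|RS q|)%N.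
Proof.
have [||x _ xR] := @window_special q q 0.
- by have := a_gt1 q; lia.
- by rewrite mul0n addn0 (leq_trans (zl_ge d a_gt1 q)) // leq_addr.
by apply/card_gt0P; exists (window x q).
Qed.

Lemma right_special_le q :
  (#|RS q| <= 1 + `[< exists k, low k < q <= high k >])%N.
Proof.
pose ordinary := [set w in RS q | `[< exists x k i,
  [/\ special_type a d x q k i, w = window x q & ~~ exceptional a d q k i] >]]%SET.
pose special := [set w in RS q | `[< exists x k i,
  [/\ special_type a d x q k i, w = window x q & exceptional a d q k i] >]]%SET.
have -> : RS q = (ordinary :|: special)%SET.
  apply/setP => w; rewrite finset.in_setU; apply/idP/orP => [wR|]; last by case=> /setIdP[].
  have [x [k [i [tx wx]]]] := special_window wR.
  case e : (exceptional a d q k i); [right|left]; apply/setIdP; split=> //;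
    by apply/asboolP; exists x, k, i; rewrite e.
rewrite (leq_trans (leq_card_setU _ _)) // leq_add //.
  apply/card_le1_eqP => w v /setIdP[_ /asboolP[x [k [i [tx -> nx]]]]].
  move=> /setIdP[_ /asboolP[y [k' [i' [ty -> ny]]]]].
  by apply/esym/window_eq; apply: (special_agree a_gt1 d_gt0 tx ty); right.
have sp w : w \in special -> exists k, (low k < q <= high k)%N.
  move=> /setIdP[_ /asboolP[x [k [i [tx _ ex]]]]].
  by exists k; exact: special_exceptional tx ex.
case: asboolP => [_|nk]; last first.
  by rewrite leqn0 cards_eq0 -finset.subset0; apply/fintype.subsetP => w /sp /nk.
apply/card_le1_eqP => w v /setIdP[_ /asboolP[x [k [i [tx -> ex]]]]].
move=> /setIdP[_ /asboolP[y [k' [i' [ty -> ey]]]]].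
apply/esym/window_eq; apply: (special_agree a_gt1 d_gt0 tx ty); left.
have wx := special_exceptional tx ex; have wy := special_exceptional ty ey.
exact: (window_unique d_gt0 d_le_a wx wy).
Qed.

(** The two special words are the one with a run of [a k + d k - 1] blocks
    [u_k] and the ordinary one, read at a level so high that its chain is
    longer than [q]. *)
Lemma right_special_ge2 q k : (low k < q <= high k)%N -> (2 <= #|RS q|)%N.
Proof.
move=> qk; have /andP[lq qh] := qk.
have d1 : (1 < d k)%N.
  by move: (leq_trans lq qh); rewrite highE //; have := d_gt0 k; case: (d k) => // -[] //; lia.
have [||x tx xR] := @window_special q k (a k + d k - 1)%N; [by lia|exact: qh|].
have [||y ty yR] := @window_special q (k.+2 + q) 0%N.
- by have := a_gt1 (k.+2 + q)%N; lia.
- by rewrite mul0n addn0 (leq_trans _ (leq_addr _ _)) // (leq_trans _ (zl_ge d a_gt1 _)) // leq_addl.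
rewrite ltnNge; apply/negP => /card_le1_eqP /(_ _ _ xR yR) /window_eq.
have [cx crx _ _] := tx; have [cy cry _ _] := ty.
move=> H; apply: (special_distinct a_gt1 d_gt0 qk _ cx cy crx cry) => [||j jq]; last by rewrite H.
  by lia.
by lia.
Qed.

Lemma complexity_ge q : (q < p q)%N.
Proof.
elim: q => [|q IH].
  by rewrite complexity0 //; exists (base_point a d); exact: base_covered.
by rewrite complexityS //; have := right_special_ge1 q; lia.
Qed.

Lemma complexity_high k q : (low k < q <= (high k).+1)%N -> (q + (q - low k) <= p q)%N.
Proof.
elim: q => // q IH /andP[]; rewrite ltnS leq_eqVlt => /predU1P[->|lq] qh.
  by have := complexity_ge q.+1; lia.
rewrite complexityS //; have := @right_special_ge2 q k; rewrite lq -ltnS qh => /(_ isT).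
by have := IH _; rewrite lq ltnW // => /(_ isT); lia.
Qed.

Lemma low_mono k k' : (k <= k')%N -> (low k <= low k')%N.
Proof.
rewrite leq_eqVlt => /predU1P[-> //|kk].
by rewrite (leq_trans _ (high_le_low d_gt0 d_le_a kk)) // highE // leq_addr.
Qed.

(** Only the lengths in some interval [low j < q <= high j] contribute twice,
    and the interval of level [j] has [(d j - 1) * hl j] elements. *)
Lemma complexity_le_sum k q : (q <= (low k.+1).+1)%N ->
  (p q <= q.+1 + \sum_(j < k.+1) minn (q.-1 - low j) ((d j - 1) * hl j))%N.
Proof.
elim: q => [|q IH] qk.
  by rewrite complexity0 ?leq_addr //; exists (base_point a d); exact: base_covered.
rewrite complexityS //; have {}IH := IH (ltnW qk).
have mono (j : 'I_k.+1) : (minn (q.-1 - low j) ((d j - 1) * hl j) <= minn (q - low j) ((d j - 1) * hl j))%N.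
  by rewrite leq_min geq_minr andbT (leq_trans (geq_minl _ _)) // leq_sub2r // leq_pred.
have := right_special_le q; case: asboolP => [[j /andP[lq qh]]|_] rs; last first.
  have : (\sum_(j < k.+1) minn (q.-1 - low j) ((d j - 1) * hl j) <=
    \sum_(j < k.+1) minn (q.+1.-1 - low j) ((d j - 1) * hl j))%N by apply: leq_sum => j _; exact: mono.
  by lia.
have jk : (j < k.+1)%N.
  by rewrite ltnNge; apply/negP => /low_mono; lia.
have : (\sum_(j < k.+1) minn (q.-1 - low j) ((d j - 1) * hl j) + 1 <=
    \sum_(j < k.+1) minn (q.+1.-1 - low j) ((d j - 1) * hl j))%N.
  rewrite (bigD1 (Ordinal jk)) //= [leqRHS](bigD1 (Ordinal jk)) //= addnAC leq_add //.
    by move: qh; rewrite highE //; lia.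
  by apply: leq_sum => i _; exact: mono.
by lia.
Qed.

Lemma zl_le k : (zl k <= 2 * hl k)%N.
Proof.
elim: k => // k IH; rewrite zlS hlS; have := hl_gt0 a d k; nia.
Qed.

Lemma common_le k : (common k <= 2 * hl k)%N.
Proof.
elim: k => //= k IH; rewrite hlS; have := hl_gt0 a d k; have := a_gt1 k; nia.
Qed.

Lemma complexity_le k q : (q <= low k.+1)%N ->
  (p q <= q.+1 + 2 * hl k + minn (q - low k) ((d k - 1) * hl k))%N.
Proof.
move=> qk; have := complexity_le_sum (leqW qk); rewrite big_ord_recr /=.
have S n : (\sum_(j < n) minn (q.-1 - low j) ((d j - 1) * hl j) <= zl n)%N.
  elim: n => [|n IH]; first by rewrite big_ord0.
  rewrite big_ord_recr zlS /= addnC leq_add // (leq_trans (geq_minr _ _)) // leq_mul2r.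
  by apply/orP; right; have := d_le_a n; lia.
have := S k; have := zl_le k.
have : (minn (q.-1 - low k) ((d k - 1) * hl k) <= minn (q - low k) ((d k - 1) * hl k))%N.
  by rewrite leq_min geq_minr andbT (leq_trans (geq_minl _ _)) // leq_sub2r // leq_pred.
move: (minn (q - _) _) (minn (q.-1 - _) _) (\sum_(j < k) _) => u v w; lia.
Qed.

Lemma high_le k : (high k <= (a k + d k + 4) * hl k)%N.
Proof.
have := zl_le k; have := common_le k; rewrite /high.
have : ((a k + d k - 1) * hl k <= (a k + d k) * hl k)%N by rewrite leq_mul2r leq_subr orbT.
by nia.
Qed.

End BlockComplexity.

(** * Measures on the full shift *)

Section WindowSets.
Variable A : alphabetType.
Implicit Types C D : set (full_shift A).

(** The sets that depend on finitely many coordinates, which are the clopen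
    sets. They form an algebra that generates the Borel sets. *)
Definition window_set C := exists n, forall x y, agree n x y -> C x -> C y.

Lemma agree_sym n (x y : full_shift A) : agree n x y -> agree n y x.
Proof. by move=> xy i /xy ->. Qed.

Lemma window_set0 : window_set set0.
Proof. by exists 0%N. Qed.

Lemma window_setC : setC_closed window_set.
Proof.
move=> C [n nC]; exists n => x y xy nCx Cy; apply: nCx.
exact: nC (agree_sym xy) Cy.
Qed.

Lemma window_setU : setU_closed window_set.
Proof.
move=> C D [n nC] [m mD]; exists (maxn n m) => x y xy [Cx|Dx].
  by left; apply: nC Cx; exact: agree_le (leq_maxl _ _) xy.
by right; apply: mD Dx; exact: agree_le (leq_maxr _ _) xy.
Qed.

Lemma window_setI : setI_closed window_set.
Proof.
move=> C D wC wD; rewrite -[C `&` D]setCK setCI.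
by apply: window_setC; apply: window_setU; exact: window_setC.
Qed.

Lemma window_set_open C : window_set C -> open C.
Proof.
by move=> [n nC]; rewrite openE => x Cx; apply: filterS (nbhs_agree x n) => y /nC; apply.
Qed.

Definition window_interior (U : set (full_shift A)) n : set (full_shift A) :=
  [set x | forall y, agree n x y -> U y].

Lemma window_interior_window U n : window_set (window_interior U n).
Proof.
exists n => x y xy Ux z yz; apply: Ux => i ni.
by rewrite xy // yz.
Qed.

Lemma open_window_interior U : open U -> U = \bigcup_n window_interior U n.
Proof.
move=> oU; rewrite eqEsubset; split=> [x Ux|x [n _]]; last exact.
have [n nU] := nbhs_agreeP (open_nbhs_nbhs (conj oU Ux)).
by exists n.
Qed.

Lemma borel_window : <<s @open (full_shift A) >> `<=` <<s window_set >>.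
Proof.
apply: smallest_sub; first exact: smallest_sigma_algebra.
move=> U /open_window_interior ->.
apply: (@bigcupT_measurable _ (g_sigma_algebraType window_set)) => n.
by apply: sub_sigma_algebra; exact: window_interior_window.
Qed.

Lemma window_measurable (C : set (borel_full_shift A)) : window_set C -> measurable C.
Proof. by move=> wC; apply: sub_sigma_algebra; exact: window_set_open. Qed.

Lemma probability_window_unique (R : realType)
    (mu nu : {measure set (borel_full_shift A) -> \bar R}) :
  mu setT = 1%E -> (forall C, window_set C -> mu C = nu C) ->
  forall B : set (borel_full_shift A), measurable B -> mu B = nu B.
Proof.
move=> mu1 munu B mB.
have wT : window_set [set: full_shift A].
  by rewrite -setC0; apply: window_setC; exact: window_set0.
have cT : \bigcup_(k : nat) [set: full_shift A] = setT by rewrite bigcup_const.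
have U := (@g_sigma_algebra_measure_unique _ R (borel_full_shift A) window_set window_measurable
  (fun=> setT) (fun=> wT) cT mu nu window_setI munu _ B (borel_window mB)).
by apply: U => k; rewrite mu1 ltry.
Qed.

Lemma left_shift_window C : window_set C -> window_set (@left_shift A @^-1` C).
Proof.
move=> [n nC]; exists n.+1 => x y xy; apply: nC => i ni.
by rewrite /left_shift xy //; lia.
Qed.

Lemma left_shift_measurable :
  measurable_fun [set: borel_full_shift A] (@left_shift A : borel_full_shift A -> borel_full_shift A).
Proof.
apply: (@measurability _ _ (borel_full_shift A) (borel_full_shift A) setT _ (@open (full_shift A)) erefl) => _ [U oU <-].
rewrite setTI (open_window_interior oU) preimage_bigcup.
apply: bigcupT_measurable => n; apply: window_measurable.
by apply: left_shift_window; exact: window_interior_window.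
Qed.

End WindowSets.

(** The full shift with the algebra of window sets in place of its Borel sets,
    so that a content can be declared on it. *)
Definition window_space (A : alphabetType) : Type := full_shift A.
HB.instance Definition _ A := Pointed.on (window_space A).
HB.instance Definition _ A := isAlgebraOfSets.Build default_measure_display
  (window_space A) (@window_set0 A) (@window_setU A) (@window_setC A).

Section WindowExtension.
Variables (R : realType) (A : alphabetType) (m : set (full_shift A) -> R).
Hypothesis m_ge0 : forall C, 0 <= m C.
Hypothesis mT : m setT = 1.
Hypothesis mU : forall C D, window_set C -> window_set D -> C `&` D = set0 ->
  m (C `|` D) = m C + m D.

Let content (C : set (window_space A)) : \bar R := (m C)%:E.

Let content0 : content set0 = 0%E.
Proof.
have := mU (@window_set0 A) (@window_set0 A) (setI0 _).
rewrite setU0 /content => /eqP; rewrite -subr_eq0 opprD addrA subrr sub0r oppr_eq0.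
by move=> /eqP ->.
Qed.

Let content_ge0 C : (0 <= content C)%E.
Proof. by rewrite lee_fin. Qed.

(** Compactness makes additivity automatically countable: a window set that is
    a disjoint union of window sets is a union of finitely many of them. *)
Let content_sigma_additive : semi_sigma_additive content.
Proof.
move=> F mF tF mUF.
have [N FN] : exists N, forall n, (N <= n)%N -> F n = set0.
  apply: contrapT => /forallNP H.
  have /choice [u uP] N : exists nx : nat * full_shift A, (N <= nx.1)%N /\ F nx.1 nx.2.
    have /existsNP[n /not_implyP[Nn /eqP/set0P[x Fx]]] := H N.
    by exists (n, x).
  have [||x [i _ Fx] xu] := @closed_cluster A (\bigcup_n F n) (fun N => (u N).2).
  - by rewrite -openC; apply/window_set_open/window_setC.
  - by move=> N; exists (u N).1 => //; case: (uP N).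
  have [n nF] := mF i.
  have [N iN xuN] := xu n i.+1.
  have [Nu Fu] := uP N.
  have := tF i (u N).1 I I; rewrite (_ : (i = _) = False).
    by apply; exists (u N).2; split=> //; exact: nF xuN Fx.
  by apply/propext; split=> // e; move: (leq_trans iN Nu); rewrite -e ltnn.
have fin k : (k <= N)%N -> content (\bigcup_(n < k) F n) = (\sum_(0 <= i < k) content (F i))%E.
  elim: k => [|k IH] kN; first by rewrite big_geq // bigcup_mkord big_ord0 content0.
  rewrite big_nat_recr //= -IH ?(ltnW kN) // -EFinD -mU ?bigcup_mkord.
  - by rewrite big_ord_recr.
  - apply: (@bigsetU_measurable _ (window_space A)) => i _; exact: mF.
  - exact: mF.
  - rewrite -bigcup_mkord setI_bigcupl bigcup0 // => i /= ik.
    apply: contrapT => /eqP/set0P ne; have := tF i k I I ne; lia.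
have UE : \bigcup_n F n = \bigcup_(n < N) F n.
  rewrite eqEsubset; split=> [x [n _ Fx]|x [n _ Fx]]; last by exists n.
  exists n => //=; rewrite ltnNge; apply/negP => /FN F0.
  by move: Fx; rewrite F0.
apply: cvg_near_cst; exists N => // k /= Nk.
rewrite UE fin // (big_cat_nat (leq0n N) Nk) /= [X in (_ + X)%E]big_nat_cond.
rewrite [X in (_ + X)%E]big1 ?adde0 // => i; rewrite andbT => /andP[Ni _].
by rewrite FN // content0.
Qed.

HB.instance Definition _ := isMeasure.Build default_measure_display
  (window_space A) R content content0 content_ge0 content_sigma_additive.

Let extension (B : set (borel_full_shift A)) : \bar R := measure_extension content B.

Let extension0 : extension set0 = 0%E.
Proof. exact: measure0. Qed.

Let extension_ge0 B : (0 <= extension B)%E.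
Proof. exact: measure_ge0. Qed.

Let extension_sigma_additive : semi_sigma_additive extension.
Proof.
move=> F mF tF mUF; apply: (@measure_semi_sigma_additive _ _ _ (measure_extension content)) => //.
  by move=> i; apply: borel_window; exact: mF.
by apply: borel_window; exact: mUF.
Qed.

HB.instance Definition _ := isMeasure.Build _ (borel_full_shift A) R extension
  extension0 extension_ge0 extension_sigma_additive.

Let extensionE C : window_set C -> extension C = (m C)%:E.
Proof. by move=> wC; rewrite /extension /= /measure_extension measurable_mu_extE. Qed.

Let extension_setT : extension setT = 1%E.
Proof. by rewrite extensionE ?mT // -setC0; apply: window_setC; exact: window_set0. Qed.

HB.instance Definition _ := Measure_isProbability.Build _ _ R extension extension_setT.

(** Caratheodory extension of a finitely additive function of window sets. *)
Lemma window_content_extends : exists mu : probability (borel_full_shift A) R,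
  forall C, window_set C -> mu C = (m C)%:E.
Proof. by exists extension. Qed.

End WindowExtension.

(** * Unique ergodicity from uniform frequencies *)

Section ShiftedMeasure.
Variables (R : realType) (A : alphabetType).
Variable mu : {measure set (borel_full_shift A) -> \bar R}.

Definition shifted_measure (B : set (borel_full_shift A)) : \bar R :=
  mu (@left_shift A @^-1` B).

Let shift_meas (B : set (borel_full_shift A)) : measurable B ->
  measurable (@left_shift A @^-1` B : set (borel_full_shift A)).
Proof. by move=> mB; rewrite -[X in measurable X]setTI; exact: left_shift_measurable. Qed.

Let shifted0 : shifted_measure set0 = 0%E.
Proof. by rewrite /shifted_measure preimage_set0 measure0. Qed.

Let shifted_ge0 B : (0 <= shifted_measure B)%E.
Proof. exact: measure_ge0. Qed.

Let shifted_sigma_additive : semi_sigma_additive shifted_measure.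
Proof.
move=> F mF tF mUF; rewrite /shifted_measure preimage_bigcup.
apply: measure_semi_sigma_additive.
- by move=> n; exact: shift_meas.
- apply/trivIsetP => /= i j _ _ ij; rewrite -preimage_setI.
  by move/trivIsetP : tF => /(_ _ _ _ _ ij) -> //; rewrite preimage_set0.
- by rewrite -preimage_bigcup; exact: shift_meas.
Qed.

HB.instance Definition _ := isMeasure.Build _ _ _ shifted_measure
  shifted0 shifted_ge0 shifted_sigma_additive.

End ShiftedMeasure.

Section UniformFrequencies.
Variables (R : realType) (A : alphabetType) (X : set (full_shift A)).
Implicit Types C D : set (full_shift A).

Definition visits C (x : full_shift A) (n : nat) : R :=
  \sum_(i < n) \1_C (shiftz i%:Z x).

Definition frequency C (c : R) := forall e : R, 0 < e -> exists n0, forall n, (n0 <= n)%N ->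
  forall x, X x -> `|visits C x n - c * n%:R| <= e * n%:R.

Hypothesis sX : subshift X.
Variable x0 : full_shift A.
Hypothesis Xx0 : X x0.
Hypothesis freqX : forall C, window_set C -> exists c, frequency C c.

Lemma frequency_unique C c c' : frequency C c -> frequency C c' -> c = c'.
Proof.
move=> fc fc'; apply/eqP; rewrite -subr_eq0 -normr_le0; apply/ler_addgt0Pr => e e0.
have e20 : 0 < e / 2 by rewrite divr_gt0.
have [n nP] := fc _ e20; have [n' nP'] := fc' _ e20.
pose N := (maxn n n').+1.
have N0 : 0 < N%:R :> R by rewrite ltr0n.
have := nP N (leqW (leq_maxl _ _)) x0 Xx0; have := nP' N (leqW (leq_maxr _ _)) x0 Xx0.
move=> h h'; rewrite add0r -(ler_pM2r N0).
have -> : `|c - c'| * N%:R = `|(c - c') * N%:R| by rewrite normrM (ger0_norm (ltW N0)).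
have -> : (c - c') * N%:R = (visits C x0 N - c' * N%:R) - (visits C x0 N - c * N%:R) by ring.
by rewrite (le_trans (ler_normB _ _)) // [e]splitr mulrDl lerD.
Qed.

Lemma frequency_ge0 C c : frequency C c -> 0 <= c.
Proof.
move=> fc; apply/ler_addgt0Pr => e e0; have [n nP] := fc _ e0.
have := nP n.+1 (leqnSn n) x0 Xx0; rewrite ler_norml => /andP[_ h].
have v0 : 0 <= visits C x0 n.+1 by apply: sumr_ge0 => i _; rewrite indicE ler0n.
rewrite -(pmulr_lge0 _ (ltr0Sn R n)) mulrDl; lra.
Qed.

Lemma visitsU C D x n : C `&` D = set0 -> visits (C `|` D) x n = visits C x n + visits D x n.
Proof.
move=> CD; rewrite /visits -big_split /=; apply: eq_bigr => i _.
rewrite !indicE in_setU; have [h|] := boolP (_ \in C); have [h'|] := boolP (_ \in D) => //=;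
  rewrite ?addr0 ?add0r //.
by have : (C `&` D) (shiftz i x) by [split; exact: set_mem]; rewrite CD.
Qed.

Lemma frequencyU C D c c' : C `&` D = set0 -> frequency C c -> frequency D c' ->
  frequency (C `|` D) (c + c').
Proof.
move=> CD fc fd e e0; have e20 : 0 < e / 2 by rewrite divr_gt0.
have [n nP] := fc _ e20; have [m mP] := fd _ e20.
exists (maxn n m) => k; rewrite geq_max => /andP[nk mk] x Xx; rewrite visitsU //.
have -> : visits C x k + visits D x k - (c + c') * k%:R =
  (visits C x k - c * k%:R) + (visits D x k - c' * k%:R) by ring.
by rewrite (le_trans (ler_normD _ _)) // [e]splitr mulrDl lerD // ?nP ?mP.
Qed.

Lemma frequencyT : frequency setT 1.
Proof.
move=> e e0; exists 0%N => n _ x _; rewrite /visits (eq_bigr (fun=> 1)) => [|i _].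
  by rewrite sumr_const card_ord mul1r subrr normr0 mulr_ge0 // ltW.
by rewrite indicE in_setT.
Qed.

Lemma frequency_left_shift C c : frequency C c -> frequency (@left_shift A @^-1` C) c.
Proof.
move=> fc e e0; have [n nP] := fc e e0; exists n => m nm x Xx.
have := nP m nm _ (subshift_shiftz 1 sX Xx).
congr (`|_ - _| <= _); apply: eq_bigr => i _; rewrite !indicE; congr (_%:R).
by congr nat_of_bool; rewrite shiftzD; apply/idP/idP => /set_mem h; apply/mem_set; move: h;
  rewrite /preimage /= -[left_shift _]/(shiftz 1 (shiftz i x)) shiftzD addrC.
Qed.

Lemma frequency_avoid C : (forall x, X x -> ~ C x) -> frequency C 0.
Proof.
move=> XC e e0; exists 0%N => n _ x Xx; rewrite /visits big1 => [|i _].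
  by rewrite mul0r subrr normr0 mulr_ge0 // ltW.
by rewrite indicE memNset //; apply: XC; exact: subshift_shiftz.
Qed.

Let freq C : R := xget 0 [set c | frequency C c].

Let freqE C c : frequency C c -> freq C = c.
Proof. by move=> fc; apply: frequency_unique (xgetPex 0 (ex_intro _ c fc)) fc. Qed.

Let freqP C : window_set C -> frequency C (freq C).
Proof. by move=> /freqX[c fc]; rewrite (freqE fc). Qed.

(** Integrating the number of visits over an invariant measure bounds the
    measure of [C] by its frequency. *)
Lemma measure_le_frequency (nu : probability (borel_full_shift A) R) C c :
  invariant_probability X nu -> window_set C -> frequency C c -> (nu C <= c%:E)%E.
Proof.
move=> [nuX inv] wC fc; apply/lee_addgt0Pr => e e0.
have [n nP] := fc e e0.
have mC i : measurable (shiftz i%:Z @^-1` C : set (borel_full_shift A)) /\ nu (shiftz i%:Z @^-1` C) = nu C.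
  elim: i => [|i [mi <-]].
    have -> : shiftz 0%:Z @^-1` C = C by apply: funext => x; rewrite /preimage /= shiftz0.
    by split=> //; exact: window_measurable.
  have -> : shiftz i.+1%:Z @^-1` C = @left_shift A @^-1` (shiftz i%:Z @^-1` C).
    apply: funext => x; rewrite /preimage /= -[left_shift x]/(shiftz 1 x) shiftzD.
    by congr (C (shiftz _ x)); lia.
  by split; [rewrite -[X in measurable X]setTI; exact: left_shift_measurable|exact: inv].
have mX : measurable (X : set (borel_full_shift A)).
  rewrite -[X]setCK; apply: measurableC; apply: sub_sigma_algebra.
  by rewrite openC; case: sX.
have nuXc : nu (~` X : set (borel_full_shift A)) = 0%E.
  by rewrite probability_setC // nuX subee.
have nuXC i : nu (shiftz i%:Z @^-1` C `&` X) = nu C.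
  have [mi <-] := mC i; apply/esym/(eq_trans (measureDI nu mi mX)).
  rewrite -[RHS]add0e; congr (_ + _)%E.
  apply/eqP; rewrite eq_le measure_ge0 andbT -nuXc le_measure ?inE //.
  - exact: measurableD.
  - exact: measurableC.
pose XB : set (borel_full_shift A) := X.
have mI i : measurable_fun XB (\1_(shiftz i%:Z @^-1` C : set (borel_full_shift A)) : borel_full_shift A -> R).
  by apply: measurable_indic; exact: (mC i).1.
have nuCE : nu C = (fine (nu C))%:E by rewrite fineK // fin_num_measure //; exact: window_measurable.
have I1 : (\int[nu]_(x in XB) (visits C x n.+1)%:E = (fine (nu C) * n.+1%:R)%:E)%E.
  under eq_integral do rewrite /visits -sumEFin.
  rewrite (@ge0_integral_sum _ _ _ _ XB mX 'I_n.+1 (fun i x => (\1_C (shiftz i%:Z x))%:E)); first last.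
  - by move=> i x _; rewrite lee_fin indicE ler0n.
  - by move=> i; apply/measurable_EFinP; exact: mI.
  rewrite (eq_bigr (fun=> (fine (nu C))%:E)) => [|i _].
    by rewrite sumEFin sumr_const card_ord mulr_natr.
  rewrite -nuCE.
  rewrite -(nuXC i) -(@integral_indic _ _ R nu XB mX) //; exact: (mC i).1.
have I2 : (\int[nu]_(x in XB) (visits C x n.+1)%:E <= ((c + e) * n.+1%:R)%:E)%E.
  have ce : 0 <= (c + e) * n.+1%:R.
    by rewrite mulr_ge0 // addr_ge0 ?(frequency_ge0 fc) // ltW.
  have <- : (\int[nu]_(x in XB) (cst ((c + e) * n.+1%:R)%:E x) = ((c + e) * n.+1%:R)%:E)%E.
    by rewrite integral_cst // -[X in (_ * X)%E]/(nu X) nuX mule1.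
  apply: ge0_le_integral => //.
  - by move=> x _; rewrite lee_fin; apply: sumr_ge0 => i _; rewrite indicE ler0n.
  - apply/measurable_EFinP; apply: measurable_sum => i; exact: mI.
  - move=> x Xx; rewrite lee_fin; have := nP n.+1 (leqnSn n) x Xx.
    by rewrite ler_norml => /andP[_]; rewrite mulrDl; lra.
by move: I2; rewrite I1 nuCE -EFinD !lee_fin ler_pM2r // ltr0n.
Qed.

(** The frequencies of window sets form a finitely additive function, which
    extends to an invariant measure. Any invariant measure is bounded by the
    frequencies, on a window set and on its complement, so it coincides with
    that extension. *)
Theorem uniquely_ergodic_of_frequencies : uniquely_ergodic R X.
Proof.
have freqT : freq setT = 1 by apply: freqE; exact: frequencyT.
have freq_ge0 C : 0 <= freq C.
  rewrite /freq; case: xgetP => [c _ fc|_ //]; exact: frequency_ge0 fc.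
have freqU C D : window_set C -> window_set D -> C `&` D = set0 ->
    freq (C `|` D) = freq C + freq D.
  by move=> wC wD CD; apply: freqE; apply: frequencyU => //; exact: freqP.
have [mu muE] := window_content_extends freq_ge0 freqT freqU.
have clX : closed X by case: sX.
have mX : measurable (X : set (borel_full_shift A)).
  rewrite -[X]setCK; apply: measurableC; apply: sub_sigma_algebra.
  by rewrite openC.
exists mu.
  split.
    have nX : mu (~` X : set (borel_full_shift A)) = 0%E.
      have := @open_window_interior A (~` X); rewrite openC => /(_ clX) ->.
      apply: measure_negligible.
        by apply: bigcupT_measurable => n; apply: window_measurable; exact: window_interior_window.
      apply: negligible_bigcup => n; exists (window_interior (~` X) n); split=> //.
        by apply: window_measurable; exact: window_interior_window.
      apply: (eq_trans (muE _ (window_interior_window _ _))).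
      by rewrite (freqE (frequency_avoid _)) // => x Xx /(_ x); apply.
    by rewrite -[X]setCK probability_setC ?nX ?sube0 //; exact: measurableC.
  move=> B mB.
  rewrite -[LHS]/(shifted_measure mu B).
  apply: probability_window_unique mB => [|C wC].
    exact: (probability_setT mu).
  apply: (eq_trans (muE _ (left_shift_window wC))); apply: (eq_trans _ (esym (muE _ wC))).
  by rewrite (freqE (frequency_left_shift (freqP wC))).
move=> nu inv B mB; apply: probability_window_unique => // [|C wC].
  exact: probability_setT.
have le C' : window_set C' -> (nu C' <= mu C')%E.
  by move=> wC'; rewrite muE //; apply: measure_le_frequency inv _ _ => //; exact: freqP.
apply/eqP; rewrite eq_le le //=.
have := le _ (window_setC wC); rewrite !probability_setC; try exact: window_measurable.
have f1 : (nu C : \bar R) \is a fin_num by rewrite fin_num_measure //; exact: window_measurable.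
have f2 : (mu C : \bar R) \is a fin_num by rewrite fin_num_measure //; exact: window_measurable.
by rewrite -(fineK f1) -(fineK f2) -!EFinB !lee_fin lerD2l lerN2.
Qed.

End UniformFrequencies.

(** * Frequencies in the block subshift *)

Section BlockFrequencies.
Variables (R : realType) (a d : nat -> nat).
Hypothesis a_gt1 : forall k, (1 < a k)%N.
Hypothesis d_gt0 : forall k, (0 < d k)%N.
Hypothesis d_le_a : forall k, (d k <= a k)%N.
Hypothesis a_unbounded : forall B, exists k, (B <= k)%N /\ (B <= a k)%N.
Local Notation X := (block_subshift a d).
Local Notation blk := (blk a d).
Local Notation hl := (hl a d).
Local Notation len := (len a d).
Local Notation nu := (nu a d).
Local Notation covered := (covered a d).

Lemma len_true_le k : (len k true <= 2 * hl k)%N.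
Proof.
rewrite lenE mul1n mul2n -addnn leq_add2l; case: k => [//|k].
by rewrite hlS hpS; have := d_le_a k; nia.
Qed.

Section OneWindowSet.
Variables (C : set (full_shift bool)) (N : nat).
Hypothesis CN : forall x y, agree N x y -> C x -> C y.

Let F (x : int -> bool) (m : int) : R := \1_C (shiftz m (x : full_shift bool)).

Let F01 x m : 0 <= F x m <= 1.
Proof. by rewrite /F indicE; case: (_ \in _); rewrite ?ler01 ?lexx. Qed.

Let F_agree x y m m' : agree N (shiftz m x) (shiftz m' y) -> F x m = F y m'.
Proof.
move=> xy; rewrite /F !indicE; congr (nat_of_bool _)%:R.
by apply/idP/idP => /set_mem h; apply/mem_set; apply: CN h => // ; exact: agree_sym.
Qed.

Let sum_lt n : (\sum_(j < n) (j < N)%N <= N)%N.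
Proof.
suff -> : (\sum_(j < n) (j < N)%N = minn n N)%N by exact: geq_minr.
by elim: n => [|n IH]; rewrite ?big_ord0 ?min0n // big_ord_recr /= IH; lia.
Qed.

Let sum_ge n : (\sum_(j < n) (n <= j + N)%N <= N)%N.
Proof.
rewrite (reindex_inj rev_ord_inj) /= (leq_trans _ (sum_lt n)) //.
by apply: leq_sum => j _; have := ltn_ord j; case: leqP; case: ltnP; lia.
Qed.

(** Two occurrences of the same block give the same visits, except near their
    ends, where the window that defines [C] leaves the block. *)
Lemma block_visits_close x y k i i' t : blk x k i t -> blk y k i' t ->
  `|psum (F x) i (len k t) - psum (F y) i' (len k t)| <= (2 * N)%:R.
Proof.
move=> bx by_; rewrite /psum -sumrB (le_trans (ler_norm_sum _ _ _)) //.
apply: (@le_trans _ _ (\sum_(j < len k t) ((j < N)%N + (len k t <= j + N)%N)%:R)).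
  apply: ler_sum => j _; have [h|h] := boolP ((j < N) || (len k t <= j + N))%N.
    apply: (@le_trans _ _ 1).
      by have := F01 x (i + j%:Z); have := F01 y (i' + j%:Z); rewrite ler_norml; lra.
    by rewrite ler1n; case: (j < N)%N h => //= ->.
  rewrite (F_agree (y := y) (m' := i' + j%:Z)) ?subrr ?normr0 ?ler0n // => v vN.
  have [r rE] : exists r : nat, v + j%:Z = r%:Z by exists (absz (v + j%:Z)); lia.
  have := same_letters bx by_ (j := r).
  rewrite /shiftz (_ : v + (i + j%:Z) = i + r%:Z); last by lia.
  by rewrite (_ : v + (i' + j%:Z) = i' + r%:Z); [apply; lia|lia].
by rewrite -natr_sum ler_nat big_split /= mul2n -addnn leq_add ?sum_lt ?sum_ge.
Qed.

Section Level.
Variables (k : nat) (e : R).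
Hypothesis e_gt0 : 0 < e.
Hypothesis hN : (4 * N)%:R <= e * (hl k)%:R.
Hypothesis ha : 4 <= e * (a k)%:R.

Let c : R := psum (F (base_point a d)) 0 (hl k) / (hl k)%:R.
Let G (x : int -> bool) (m : int) := F x m - c.

Let h0 : 0 < (hl k)%:R :> R.
Proof. by rewrite ltr0n hl_gt0. Qed.

Let psumG x i n : psum (G x) i n = psum (F x) i n - c * n%:R.
Proof. by rewrite /psum sumrB sumr_const card_ord mulr_natr. Qed.

Let psumF01 x i n : 0 <= psum (F x) i n <= n%:R.
Proof.
elim: n => [|n IH]; first by rewrite /psum big_ord0 lexx.
rewrite -addn1 psumD psum1 natrD; have := F01 x (i + n%:Z); move: IH; lra.
Qed.

Let c01 : 0 <= c <= 1.
Proof.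
have /andP[p0 p1] := psumF01 (base_point a d) 0 (hl k).
by rewrite /c divr_ge0 ?ler0n //= ler_pdivrMr // mul1r.
Qed.

Let G_trivial x i n : `|psum (G x) i n| <= n%:R.
Proof.
rewrite psumG ler_norml; have := psumF01 x i n; have := c01.
have : 0 <= n%:R :> R by rewrite ler0n.
by move: n%:R (psum _ _ _) => u v; nra.
Qed.

Let G_false x i : blk x k i false -> `|psum (G x) i (hl k)| <= (2 * N)%:R.
Proof.
move=> bx; have := block_visits_close bx (base_blk d a_gt1 k).
by rewrite lenE mul0n addn0 psumG /c divfK ?gt_eqF.
Qed.

Let G_block x i t : blk x k.+1 i t -> `|psum (G x) i (len k.+1 t)| <= e * (len k.+1 t)%:R.
Proof.
move=> bx; rewrite psum_blk (le_trans (ler_normD _ _)) // lenS natrD mulrDr.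
have na : (a k <= nu k t)%N by rewrite nuE leq_addr.
have s1 : `|\sum_(j < nu k t) psum (G x) (i + (j * hl k)%:Z) (hl k)| <= (nu k t)%:R * (2 * N)%:R.
  rewrite (le_trans (ler_norm_sum _ _ _)) //.
  rewrite (@le_trans _ _ (\sum_(j < nu k t) (2 * N)%:R)) //; last first.
    by rewrite sumr_const card_ord mulr_natl.
  by apply: ler_sum => j _; apply: G_false; have := blk_sub bx (ltnW (ltn_ord j)); rewrite (ltn_eqF (ltn_ord j)).
have s2 := G_trivial x (i + (nu k t * hl k)%:Z) (len k true).
have g2 : (len k true)%:R <= 2 * (hl k)%:R :> R.
  by rewrite -natrM ler_nat len_true_le.
have nar : (a k)%:R <= (nu k t)%:R :> R by rewrite ler_nat.
have g0 : 0 <= e * (len k true)%:R by rewrite mulr_ge0 // ltW.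
have key : (nu k t)%:R * (2 * N)%:R + 2 * (hl k)%:R <= e * (nu k t * hl k)%:R :> R.
  move: hN; rewrite !natrM; move: (nu k t)%:R (hl k)%:R N%:R nar h0 ha => v h M nar' h0' ha' hN'.
  have v0 : 0 <= v by apply: le_trans nar'; rewrite ler0n.
  have ev : 4 <= e * v by rewrite (le_trans ha') // ler_pM2l.
  have p1 : 0 <= v * (e * h - 4 * M) by rewrite mulr_ge0 // subr_ge0.
  have p2 : 0 <= h * (e * v - 4) by rewrite mulr_ge0 ?subr_ge0 // ltW.
  lra.
lra.
Qed.

Let G_boundary x n i : covered x -> boundary a d x k.+1 i ->
  `|psum (G x) i n| <= e * n%:R + (len k.+1 true)%:R.
Proof.
move=> cx; elim/ltn_ind: n i => n IH i [t bx].
have [nl|ln] := ltnP n (len k.+1 t).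
  rewrite (le_trans (G_trivial _ _ _)) // -[X in X <= _]add0r lerD //.
    by rewrite mulr_ge0 // ltW.
  by rewrite ler_nat (leq_trans (ltnW nl)) // len_le_true.
have l0 := len_gt0 a d k.+1 t.
rewrite -(subnKC ln) psumD (le_trans (ler_normD _ _)) // natrD mulrDr -addrA lerD //.
  exact: G_block.
by apply: IH; [lia|exact: next_block].
Qed.

(** A block of level [k.+1] consists of [a k] or more copies of [u_k], which
    have almost the same number of visits, and of one [v_k], which has a small
    relative length if [a k] is large. A long orbit is a concatenation of such
    blocks. *)
Lemma level_frequency : exists c n0, forall n, (n0 <= n)%N -> forall x, X x ->
  `|visits R C x n - c * n%:R| <= (2 * e) * n%:R.
Proof.
pose L := len k.+1 true.
have [n0 n0P] : exists n0 : nat, (2 * L)%:R / e <= n0%:R.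
  by exists (Num.trunc ((2 * L)%:R / e)).+1; rewrite ltW // truncnS_gt.
exists c, n0 => n nn x cx.
have -> : visits R C x n = psum (F x) 0 n by apply: eq_bigr => i _; rewrite add0r.
rewrite -psumG.
have nL : (2 * L)%:R <= e * n%:R.
  by rewrite mulrC -ler_pdivrMr // (le_trans n0P) // ler_nat.
suff : `|psum (G x) 0 n| <= e * n%:R + (2 * L)%:R by lra.
have [i [t [bx /andP[i0 ti]]]] := cx k.+1 0.
pose r := absz (i + (len k.+1 t)%:Z).
have rE : r%:Z = i + (len k.+1 t)%:Z by rewrite /r; lia.
have rL : (r <= L)%N by have := len_le_true a d k.+1 t; rewrite /L; lia.
have en : 0 <= e * n%:R by rewrite mulr_ge0 // ltW.
have [nr|rn] := leqP n r.
  rewrite (le_trans (G_trivial _ _ _)) // -[X in X <= _]add0r lerD // ler_nat.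
  by rewrite (leq_trans nr) // (leq_trans rL) // leq_pmull.
rewrite -[in X in X <= _](subnKC (ltnW rn)) psumD (le_trans (ler_normD _ _)) //.
have -> : (2 * L)%:R = L%:R + L%:R :> R by rewrite mul2n -addnn natrD.
have hA : `|psum (G x) 0 r| <= L%:R by rewrite (le_trans (G_trivial _ _ _)) // ler_nat.
have := G_boundary (n - r)%N cx (next_block d_gt0 cx bx); rewrite -rE add0r -/L => hB.
have hC : e * (n - r)%N%:R <= e * n%:R by rewrite ler_pM2l // ler_nat leq_subr.
lra.
Qed.

End Level.

Lemma approximate_frequency (e : R) : 0 < e -> exists c n0, forall n, (n0 <= n)%N ->
  forall x, X x -> `|visits R C x n - c * n%:R| <= e * n%:R.
Proof.
move=> e0; have e20 : 0 < e / 2 by rewrite divr_gt0.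
have [B BP] : exists B : nat, (4 * (N + 1))%:R / (e / 2) <= B%:R.
  by exists (Num.trunc ((4 * (N + 1))%:R / (e / 2))).+1; rewrite ltW // truncnS_gt.
have [k [Bk Ba]] := a_unbounded B.
move: BP; rewrite ler_pdivrMr // mulrC natrM natrD => BP.
have Bk' : B%:R <= (hl k)%:R :> R by rewrite ler_nat (leq_trans Bk) // ltnW // hl_gt.
have Ba' : B%:R <= (a k)%:R :> R by rewrite ler_nat.
have N0 : 0 <= N%:R :> R by rewrite ler0n.
have [||c [n0 H]] := @level_frequency k _ e20.
- by rewrite natrM; nra.
- by nra.
by exists c, n0 => n nn x Xx; have := H n nn x Xx; rewrite [2 * _]mulrC divfK // pnatr_eq0.
Qed.

(** The approximate frequencies of the preceding lemma are close to each
    other; any limit of them, for instance a lower frequency at one point, is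
    a frequency. *)
Lemma block_frequency : exists c : R, frequency X C c.
Proof.
have cb : X (base_point a d) by exact: base_covered.
pose v n := visits R C (base_point a d) n.
pose S := [set r : R | exists n0, forall n, (n0 <= n)%N -> r * n%:R <= v n].
exists (sup S) => e e0.
have e20 : 0 < e / 2 by rewrite divr_gt0.
have [c [n0 cP]] := approximate_frequency e20.
have cvS : S (c - e / 2).
  exists n0 => n nn; have := cP n nn _ cb; rewrite ler_norml -/(v n) mulrBl; lra.
have ubS : ubound S (c + e / 2).
  move=> r [n1 rP]; pose n := (maxn n0 n1).+1.
  have := cP n (leqW (leq_maxl _ _)) _ cb; have := rP n (leqW (leq_maxr _ _)).
  rewrite ler_norml -/(v n) => h1 /andP[_ h2].
  have n0' : 0 < n%:R :> R by rewrite ltr0n.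
  by rewrite -(ler_pM2r n0') mulrDl; lra.
have h1 : c - e / 2 <= sup S by apply: ub_le_sup cvS; exists (c + e / 2).
have h2 : sup S <= c + e / 2 by apply: ge_sup ubS; exists (c - e / 2).
exists n0 => n nn x Xx; have := cP n nn x Xx.
have n0' : 0 <= n%:R :> R by rewrite ler0n.
rewrite !ler_norml => /andP[g1 g2]; apply/andP; split; nra.
Qed.

End OneWindowSet.

Theorem block_subshift_uniquely_ergodic : uniquely_ergodic R X.
Proof.
apply: (@uniquely_ergodic_of_frequencies R _ X (block_subshift_subshift a d) (base_point a d)).
  exact: base_covered.
by move=> C [N CN]; exact: block_frequency CN.
Qed.

End BlockFrequencies.

(** * Integer sequences as p-adic numbers *)

Section PadicFacts.
Variable p : prime_nat.
Let pn : nat := val p.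
Let pr : prime pn := valP p.

Let pn0 : 0 < pn%:Q. Proof. by rewrite ltr0n prime_gt0. Qed.

Lemma padic_of_rat_ball (q : rat) (n : int) :
  (padic_of_rat p q \in padic_ball p n) = (padic_norm pn q <= pn%:Q ^ (- n)).
Proof.
apply/padic_ballP/idP => [[N /(_ N (leqnn _))] //|h].
by exists 0%N.
Qed.

Lemma padic_of_rat_integral (q : rat) : padic_of_rat p q \in padic_ball p 0 ->
  ~~ (pn %| `|denq q|)%N.
Proof.
rewrite padic_of_rat_ball; have [->|q0] := eqVneq q 0.
  by move=> _; rewrite dvdn1 gtn_eqF // prime_gt1.
rewrite padic_norm_le // /padic_val; apply: contraL => pd.
have : (0 < logn pn `|denq q|)%N by rewrite logn_gt0 mem_primes pr absz_gt0 denq_eq0.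
have : logn pn `|numq q| = 0%N.
  apply/eqP; rewrite -leqn0 leqNgt; apply/negP; rewrite logn_gt0 mem_primes => /and3P[_ _ pnq].
  have := coprime_num_den q; rewrite /coprime => /eqP g1.
  have : (pn %| gcdn `|numq q| `|denq q|)%N by rewrite dvdn_gcd pnq.
  by rewrite g1 dvdn1 gtn_eqF // prime_gt1.
by move=> ->; move: (logn _ _) => u u0; rewrite -ltNge; lia.
Qed.

Lemma padic_of_frac_ball (z : int) (y e n : nat) : coprime y pn ->
  ((pn ^ (e + n))%N %| `|z|)%N ->
  padic_of_rat p (z%:Q / (y * pn ^ e)%N%:Q) \in padic_ball p n%:Z.
Proof.
move=> cy dz; rewrite padic_of_rat_ball.
have [->|z0] := eqVneq z 0.
  by rewrite mul0r /padic_norm eqxx exprz_ge0 // ltW.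
have y0 : (0 < y)%N.
  by case: y cy => //; rewrite /coprime gcd0n => /eqP e1; move: (prime_gt1 pr); rewrite e1.
have ye0 : (0 < y * pn ^ e)%N by rewrite muln_gt0 y0 expn_gt0 prime_gt0.
have q0 : z%:Q / (y * pn ^ e)%N%:Q != 0.
  by rewrite mulf_neq0 ?invr_eq0 ?intr_eq0 // -lt0n.
rewrite padic_norm_le // -[(y * pn ^ e)%N%:Q]/((Posz (y * pn ^ e)%N)%:~R).
rewrite padic_val_div // -?lt0n //= lognM // ?expn_gt0 ?prime_gt0 //.
have -> : logn pn y = 0%N.
  apply/eqP; rewrite -leqn0 leqNgt; apply/negP; rewrite logn_gt0 mem_primes => /and3P[_ _ pny].
  have := prime_gt1 pr; rewrite ltnNge -(eqP cy) => /negP; apply.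
  by apply: dvdn_leq; rewrite ?gcdn_gt0 ?y0 // dvdn_gcd pny /=.
rewrite pfactorK //; move: dz; rewrite pfactor_dvdn // ?absz_gt0 //.
by move: (logn _ _); lia.
Qed.

Lemma padic_of_int_ball (z : int) (n : nat) : ((pn ^ n)%N %| `|z|)%N ->
  padic_of_rat p z%:~R \in padic_ball p n%:Z.
Proof.
move=> dz; have := @padic_of_frac_ball z 1 0 n (coprime1n _) dz.
by rewrite expn0 muln1 divr1.
Qed.

Lemma padic_of_int_ball_dvd (z : int) (n : nat) :
  padic_of_rat p z%:~R \in padic_ball p n%:Z -> ((pn ^ n)%N %| `|z|)%N.
Proof.
rewrite padic_of_rat_ball; have [->|z0] := eqVneq z 0; first by rewrite dvdn0.
rewrite padic_norm_le ?intr_eq0 // -[z%:~R]divr1 -[1]/(1%:~R : rat) padic_val_div //.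
by rewrite logn1 subr0 lez_nat pfactor_dvdn // absz_gt0.
Qed.

Lemma padic_pow_small (e : rat) : 0 < e -> exists n : nat, pn%:Q ^ (- n%:Z) < e.
Proof.
move=> e0; exists (Num.trunc e^-1).+1; set t := _.+1.
have et : e^-1 < t%:R by exact: truncnS_gt.
have tp : t%:R <= pn%:Q ^+ t by rewrite -pmulrn -natrX ler_nat ltnW // ltn_expl // prime_gt1.
rewrite -exprnN -[e]invrK ltf_pV2 ?posrE ?invr_gt0 ?exprn_gt0 //.
exact: lt_le_trans et tp.
Qed.

Lemma padic_separated (x : padic p) : (forall n : nat, x \in padic_ball p n%:Z) -> x = 0.
Proof.
rewrite -[x]reprK => H; rewrite -[0](@raddf0 _ _ (\pi_(Quotient.quot (@padic_null p))%qT)).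
apply/eqP; rewrite -Quotient.idealrBE subr0; apply/asboolP => e e0.
have [n ne] := padic_pow_small e0.
have [N NP] := padic_ballP _ _ (H n).
by exists N => i /NP h; exact: le_lt_trans h ne.
Qed.

Lemma padic_approx (x : padic p) (n : int) :
  exists q, x - padic_of_rat p q \in padic_ball p n.
Proof.
have /asboolP := valP (repr x : padic_seq p); move=> uc.
have [|N NP] := uc (pn%:Q ^ (- n)); first by rewrite exprz_gt0.
exists ((repr x : padic_seq p) N); rewrite -{1}[x]reprK -raddfB.
apply/padic_ballP; exists N => i iN; apply: ltW.
by rewrite /=; apply: NP.
Qed.

Lemma padic_bounded (x : padic p) : exists e : nat, x \in padic_ball p (- e%:Z).
Proof.
have [q xq] := padic_approx x 0; exists (logn pn `|denq q|).
rewrite -[x](subrK (padic_of_rat p q)); apply: rpredD.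
  by apply: padic_ball_le xq; lia.
rewrite padic_of_rat_ball; have [->|q0] := eqVneq q 0.
  by rewrite /padic_norm eqxx exprz_ge0 // ltW.
by rewrite padic_norm_le // /padic_val; move: (logn _ _) (logn _ _) => u v; lia.
Qed.

Definition padic_of_seq (s : nat -> int) : padic p :=
  \pi_(Quotient.quot (@padic_null p))%qT (insubd 0 (fun i => (s i)%:~R) : padic_seq p).

(** Sequences of integers that converge in the profinite completion of the
    integers; [padic_of_seq] gives the components of the limit. *)
Definition profinite_cauchy (s : nat -> int) := forall N : nat, (0 < N)%N ->
  exists K, forall i, (K <= i)%N -> (N %| `|s i - s K|)%N.

Lemma padic_of_seq_val s : profinite_cauchy s ->
  val (insubd 0 (fun i => (s i)%:~R) : padic_seq p) = (fun i => (s i)%:~R).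
Proof.
move=> sc; rewrite insubdK //; apply/asboolP => e e0.
have [n ne] := padic_pow_small e0.
have [|K KP] := sc (pn ^ n)%N; first by rewrite expn_gt0 prime_gt0.
exists K => i j Ki Kj; apply: le_lt_trans ne.
have := padic_of_int_ball (z := s i - s j) (n := n).
rewrite padic_of_rat_ball intrB; apply.
have -> : s i - s j = (s i - s K) - (s j - s K) by ring.
have D t : (K <= t)%N -> ((pn ^ n)%N%:Z %| s t - s K)%Z by move=> Kt; rewrite dvdzE; exact: KP.
have : ((pn ^ n)%N%:Z %| (s i - s K) - (s j - s K))%Z by apply: rpredB; exact: D.
by rewrite dvdzE.
Qed.

Lemma padic_of_seq_ball s (c : int) (n K : nat) : profinite_cauchy s ->
  (forall i, (K <= i)%N -> ((pn ^ n)%N %| `|s i - c|)%N) ->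
  padic_of_seq s - padic_of_rat p c%:~R \in padic_ball p n%:Z.
Proof.
move=> sc sK; rewrite /padic_of_seq /padic_of_rat -raddfB; apply/padic_ballP.
exists K => i iK; rewrite /= padic_of_seq_val //.
have := padic_of_int_ball (sK i iK).
by rewrite padic_of_rat_ball intrB.
Qed.

End PadicFacts.

(** * The solenoid as a quotient of R times the profinite integers *)

Lemma padic_of_int0 p : padic_of_rat p (0 : int)%:~R = 0.
Proof. by rewrite mulr0z; exact: (raddf0 (padic_of_rat p)). Qed.

Lemma int_dvd_by_primes (N : nat) (z : int) : (0 < N)%N ->
  (forall p : prime_nat, ((val p ^ logn (val p) N)%N %| `|z|)%N) -> (N %| `|z|)%N.
Proof.
move=> N0 H; apply/dvdn_partP => // p; rewrite mem_primes => /and3P[pp _ _].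
by rewrite p_part; exact: (H (exist (fun p => prime p) p pp)).
Qed.

(** A rational number that is integral at all primes is an integer, which
    makes the intersection of the rational numbers with R times the profinite
    integers equal to the integers. *)
Lemma rat_padic_integers (q : rat) :
  (forall p, padic_of_rat p q \in padic_ball p 0) -> q = (numq q)%:~R.
Proof.
move=> qp; have den1 : `|denq q|%N = 1%N.
  apply/eqP; rewrite eqn_leq absz_gt0 denq_neq0 andbT leqNgt; apply/negP => d1.
  have pd := pdiv_prime d1; have := padic_of_rat_integral (qp (exist (fun p => prime p) _ pd)).
  by rewrite pdiv_dvd.
rewrite -[LHS]divq_num_den (_ : denq q = 1) ?divr1 //.
by have := denq_gt0 q; lia.
Qed.

Section Solenoid.
Variables (R : realType) (ell : nat -> option nat).
Local Notation G := (adeles_ell R ell).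
Local Notation M := (adelic_nilmanifold R ell).

Definition solenoid_proj (a : G) : M := quotient_proj (@rat_ell_in_adeles R ell) a.

Definition adele_of (rho : R) (s : nat -> int) : G :=
  insubd (0 : G) ((rho, fun p => padic_of_seq p s) : adele_product R).

(** The image of [(rho, lim s)], where [s] converges in the profinite
    integers. By strong approximation such points are all the points of the
    group, whatever [ell] is: it is the quotient of R times the profinite
    integers by the integers. *)
Definition sol (rho : R) (s : nat -> int) : M := solenoid_proj (adele_of rho s).

Lemma adele_of_val rho s : profinite_cauchy s ->
  adeles_ell_val (adele_of rho s) = (rho, fun p => padic_of_seq p s).
Proof.
move=> sc; have B (p : prime_nat) : padic_of_seq p s \in padic_ball p 0.
  have := padic_of_seq_ball (p := p) (c := 0) (n := 0) (K := 0) sc.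
  by rewrite padic_of_int0 subr0; apply=> i _; rewrite expn0 dvd1n.
rewrite -[LHS]/(val _) insubdK //; apply/asboolP; split.
  by apply: sub_finite_set (finite_set0 _) => p /=; rewrite B.
by move=> p l _ /=; apply: padic_ball_le (B p); lia.
Qed.

Lemma adeles_ell_valB (x y : G) :
  adeles_ell_val (x - y) = adeles_ell_val x - adeles_ell_val y.
Proof. exact: (raddfB (val : G -> adele_product R)). Qed.

Lemma adeles_ell_valD (x y : G) :
  adeles_ell_val (x + y) = adeles_ell_val x + adeles_ell_val y.
Proof. exact: (raddfD (val : G -> adele_product R)). Qed.

Lemma padic_of_seq_near s N : profinite_cauchy s -> (0 < N)%N ->
  exists K, forall i, (K <= i)%N -> forall (p : prime_nat) n, ((val p ^ n)%N %| N)%N ->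
  padic_of_seq p s - padic_of_rat p (s i)%:~R \in padic_ball p n%:Z.
Proof.
move=> sc N0; have [K KP] := sc N N0; exists K => i Ki p n pN.
apply: (padic_of_seq_ball (K := K)) => // j Kj; apply: (dvdn_trans pN).
have D t : (K <= t)%N -> (N%:Z %| s t - s K)%Z by move=> Kt; rewrite dvdzE; exact: KP.
have : (N%:Z %| (s j - s K) - (s i - s K))%Z by apply: rpredB; exact: D.
by rewrite dvdzE (_ : s j - s K - (s i - s K) = s j - s i) //; ring.
Qed.

(** Two adeles with integral components differ by a diagonal rational number
    only if that number is an integer [q]; the diagonal embedding has opposite
    signs at the two kinds of places, whence the sign of [q]. *)
Lemma sol_eqP rho s rho' s' : profinite_cauchy s -> profinite_cauchy s' ->
  sol rho s = sol rho' s' <->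
  exists2 q : int, rho - rho' = q%:~R &
    forall N : nat, (0 < N)%N -> exists K, forall i, (K <= i)%N -> (N %| `|(s i - s' i + q)%R|)%N.
Proof.
move=> sc sc'; rewrite /sol /solenoid_proj quotient_proj_eq.
have near N (N0 : (0 < N)%N) : exists K, forall i, (K <= i)%N -> forall (p : prime_nat) n, ((val p ^ n)%N %| N)%N ->
    padic_of_seq p s - padic_of_rat p (s i)%:~R \in padic_ball p n%:Z /\
    padic_of_seq p s' - padic_of_rat p (s' i)%:~R \in padic_ball p n%:Z.
  have [K KP] := padic_of_seq_near sc N0; have [K' KP'] := padic_of_seq_near sc' N0.
  by exists (maxn K K') => i; rewrite geq_max => /andP[? ?] p n pn; split; [apply: KP|apply: KP'].
have E (V : zmodType) (X Y u v w : V) : X - Y + w = (X - u) - (Y - v) + (u - v + w).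
  by rewrite addrA; congr (_ + _); rewrite opprB [v - Y]addrC [X - u + _]addrACA -addrA [- u + v]addrC (_ : v - u + (u - v) = 0) ?addr0 // addrA subrK subrr.
have E' (V : zmodType) (X Y u v w : V) : u - v + w = (X - Y + w) - ((X - u) - (Y - v)).
  by rewrite (E _ X Y u v w) [X in _ = X - _]addrC addrK.
have dec p i (q : int) : padic_of_rat p (s i - s' i + q)%:~R =
    padic_of_rat p (s i)%:~R - padic_of_rat p (s' i)%:~R + padic_of_rat p q%:~R.
  by rewrite intrD intrB raddfD raddfB.
split=> [/asboolP[q lq]|[q rq H]].
  rewrite adeles_ell_valB !adele_of_val // => e.
  have e1 : rho - rho' = ratr q := congr1 fst e.
  have {e} e2 (p : prime_nat) : padic_of_seq p s - padic_of_seq p s' = padic_of_rat p (- q).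
    exact: (congr1 (fun f : padic_product => f p) (congr1 snd e)).
  have [|K0 near1] := near 1%N; first by [].
  have qE : q = (numq q)%:~R.
    apply: rat_padic_integers => p; have [h h'] := near1 K0 (leqnn _) p 0%N (dvd1n _).
    have -> : padic_of_rat p q = - (padic_of_seq p s - padic_of_seq p s').
      by rewrite e2 raddfN opprK.
    rewrite rpredN.
    rewrite -[X in X \in _]addr0 (E _ _ _ (padic_of_rat p (s K0)%:~R) (padic_of_rat p (s' K0)%:~R)) addr0.
    apply: rpredD; first exact: rpredB.
    by apply: rpredB; apply: (padic_of_int_ball (n := 0)); rewrite expn0 dvd1n.
  exists (numq q); first by rewrite e1 [in LHS]qE ratr_int.
  move=> N N0; have [K KP] := near N N0; exists K => i Ki.
  apply: int_dvd_by_primes => // p; apply: padic_of_int_ball_dvd.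
  have [h h'] := KP i Ki p _ (pfactor_dvdnn _ _).
  rewrite dec -qE (E' _ (padic_of_seq p s) (padic_of_seq p s')) e2 raddfN addNr sub0r rpredN.
  by rewrite rpredB.
apply/asboolP; exists q%:~R; first by exists [::]; split=> //; rewrite big_nil mul1r intr_int.
rewrite adeles_ell_valB !adele_of_val //; congr (_, _); first by rewrite ratr_int.
apply: functional_extensionality_dep => p.
have -> : padic_of_rat p (- q%:~R) = - padic_of_rat p q%:~R by exact: raddfN.
rewrite -[LHS]/(padic_of_seq p s - padic_of_seq p s').
apply/eqP; rewrite -subr_eq0 opprK; apply/eqP.
apply: padic_separated => n.
have pn0 : (0 < val p ^ n)%N by rewrite expn_gt0 prime_gt0 //; exact: valP p.
have [K KP] := near _ pn0; have [K' KP'] := H _ pn0.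
have [h h'] := KP _ (leq_maxl K K') p n (dvdnn _).
rewrite (E _ _ _ (padic_of_rat p (s (maxn K K'))%:~R) (padic_of_rat p (s' (maxn K K'))%:~R)).
apply: rpredD; [exact: rpredB|rewrite -dec]; apply: padic_of_int_ball; apply: KP'; exact: leq_maxr.
Qed.

Lemma profinite_cauchy_cst c : profinite_cauchy (fun=> c).
Proof. by move=> N _; exists 0%N => i _; rewrite subrr dvdn0. Qed.

Lemma padic_of_seq_cst p (c : int) : padic_of_seq p (fun=> c) = padic_of_rat p c%:~R.
Proof.
congr (\pi_(_)%qT _); apply: val_inj; rewrite padic_of_seq_val //.
exact: profinite_cauchy_cst.
Qed.

Lemma solenoid_projD (x y : G) : solenoid_proj x + solenoid_proj y = solenoid_proj (x + y).
Proof.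
by rewrite -{2}[y]opprK /solenoid_proj quotient_projB -[- y]sub0r quotient_projB
    [quotient_proj _ 0](_ : _ = 0) ?sub0r ?opprK // -[0 in LHS](subrr 0) quotient_projB subrr.
Qed.

Lemma sol_translate rho s theta : profinite_cauchy s ->
  sol rho s + sol theta (fun=> 0) = sol (rho + theta) s.
Proof.
move=> sc; have c0 := profinite_cauchy_cst 0.
rewrite /sol solenoid_projD; congr solenoid_proj; apply: val_inj; rewrite -![val _]/(adeles_ell_val _) adeles_ell_valD !adele_of_val //.
congr (_, _); apply: functional_extensionality_dep => p.
rewrite -[LHS]/(padic_of_seq p s + padic_of_seq p (fun=> 0)).
by rewrite padic_of_seq_cst padic_of_int0 addr0.
Qed.

End Solenoid.

(** * Topology of the solenoid *)

Lemma finite_support_modulus (n : prime_nat -> nat) : finite_set [set p | n p != 0%N] ->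
  exists2 N : nat, (0 < N)%N & forall p, ((val p ^ n p)%N %| N)%N.
Proof.
move=> /finite_seqP[s sP]; exists (\prod_(p <- s) val p ^ n p)%N.
  elim: s {sP} => [|p s IH]; first by rewrite big_nil.
  by rewrite big_cons muln_gt0 expn_gt0 IH prime_gt0 // (valP p).
move=> p; have [->|np] := eqVneq (n p) 0%N; first by rewrite expn0 dvd1n.
have ps : p \in s by have : [set p | n p != 0%N] p by []; rewrite sP.
by rewrite (perm_big _ (perm_to_rem ps)) /= big_cons dvdn_mulr.
Qed.

Section SolenoidTopology.
Variables (R : realType) (ell : nat -> option nat).
Local Notation G := (adeles_ell R ell).
Local Notation M := (adelic_nilmanifold R ell).
Local Notation proj := (@solenoid_proj R ell).

Lemma solenoid_projP (u : M) : exists a, proj a = u.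
Proof. exact: quotient_proj_surj. Qed.

Lemma nbhs_solenoid (a : G) (U : set M) : nbhs (proj a) U ->
  exists (e : R) (n : prime_nat -> nat), [/\ 0 < e, finite_set [set p | n p != 0%N] &
    forall b : G, adele_box e n (adeles_ell_val b - adeles_ell_val a) -> U (proj b)].
Proof.
move=> nU; have : nbhs a (proj @^-1` U) by exact: (pi_continuous nU).
by move=> [e [n [e0 fn H]]]; exists e, n; split=> // b; exact: H.
Qed.

Lemma nbhs_sol rho s (U : set M) : profinite_cauchy s -> nbhs (sol ell rho s : M) U ->
  exists (e : R) (N : nat), [/\ 0 < e, (0 < N)%N & forall rho' s', profinite_cauchy s' ->
    `|rho' - rho| < e -> (exists K, forall i, (K <= i)%N -> (N %| `|(s' i - s i)%R|)%N) ->
    U (sol ell rho' s')].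
Proof.
move=> sc /nbhs_solenoid[e [n [e0 fn H]]].
have [N N0 NP] := finite_support_modulus fn; exists e, N; split=> // rho' s' sc' hr [K KP].
apply: H; rewrite !adele_of_val //; split=> // p.
have [K1 K1P] := padic_of_seq_near sc N0; have [K2 K2P] := padic_of_seq_near sc' N0.
pose i := (maxn K (maxn K1 K2)).
have h1 := K1P i _ p _ (NP p); have h2 := K2P i _ p _ (NP p).
have {}h1 := h1 (leq_trans (leq_maxl _ _) (leq_maxr _ _)).
have {}h2 := h2 (leq_trans (leq_maxr _ _) (leq_maxr _ _)).
have := rpredB (rpredD h2 (padic_of_int_ball (z := s' i - s i) (dvdn_trans (NP p) (KP i (leq_maxl _ _))))) h1.
suff -> : padic_of_seq p s' - padic_of_rat p (s' i)%:~R + padic_of_rat p (s' i - s i)%:~R -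
  (padic_of_seq p s - padic_of_rat p (s i)%:~R) = padic_of_seq p s' - padic_of_seq p s by [].
have -> : padic_of_rat p (s' i - s i)%:~R = padic_of_rat p (s' i)%:~R - padic_of_rat p (s i)%:~R.
  by rewrite intrB; exact: raddfB.
by rewrite addrA subrK opprB addrA subrK.
Qed.

(** By induction on the primes: the correction at one prime is a fraction with
    a power of this prime as denominator, and a numerator that is divisible by the
    moduli of the other primes, by Bezout. *)
Lemma strong_approximation (a : G) (n : prime_nat -> nat) (L : seq prime_nat) : uniq L ->
  exists q : rat, [/\ rat_ell ell q,
    forall p, p \in L -> (adeles_ell_val a).2 p - padic_of_rat p q \in padic_ball p (n p)%:Z &
    forall p, p \notin L -> padic_of_rat p q \in padic_ball p 0].
Proof.
elim: L => [_|p0 L IH /= /andP[p0L /IH[q [lq qL qnL]]]].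
  exists 0; split=> // [|p _]; first exact: (rat_ell_zmod_closed ell).1.
  by rewrite raddf0 rpred0.
have /asboolP[_ al] := valP a.
pose x := (adeles_ell_val a).2 p0.
have q0 : padic_of_rat p0 q \in padic_ball p0 0 by exact: qnL.
have [e [xe el]] : exists e : nat, x - padic_of_rat p0 q \in padic_ball p0 (- e%:Z) /\
    forall l, ell (val p0) = Some l -> (e <= l)%N.
  have qe e : padic_of_rat p0 q \in padic_ball p0 (- e%:Z) by apply: padic_ball_le q0; lia.
  case E : (ell (val p0)) => [l|].
    by exists l; split=> [|l' [->//]]; apply: rpredB; [exact: (al p0 l E)|exact: qe].
  by have [e xe] := padic_bounded x; exists e; split=> //; apply: rpredB => //; exact: qe.
have [r rx] := padic_approx (x - padic_of_rat p0 q) (n p0)%:Z.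
have pr := valP p0; pose pn := val p0; pose P := (\prod_(p <- L) val p ^ n p)%N.
have pn0 : (0 < pn)%N by exact: prime_gt0.
have cP : coprime P pn.
  rewrite /P; elim: (L) p0L => [|p L' IH']; first by rewrite big_nil coprime1n.
  rewrite inE negb_or => /andP[pp0 p0L']; rewrite big_cons coprimeMl IH' // andbT.
  rewrite coprimeXl // prime_coprime ?(valP p) // dvdn_prime2 ?(valP p) //.
  by rewrite eq_sym; apply: contra pp0.
(* [r] has the form [X / (Y p0^e)] with [Y] prime to [p0] *)
pose r' := r * (pn ^ e)%N%:Q; pose X := numq r'; pose Y := `|denq r'|%N.
have Y0 : (0 < Y)%N by rewrite absz_gt0 denq_neq0.
have pe0 : (pn ^ e)%N%:Q != 0 by rewrite intr_eq0 -lt0n expn_gt0 pn0.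
have cY : coprime Y pn.
  rewrite coprime_sym prime_coprime //; apply: padic_of_rat_integral.
  rewrite padic_of_rat_ball oppr0; have [r0|r0] := eqVneq r 0.
    by rewrite /r' r0 mul0r /padic_norm eqxx.
  have re : padic_of_rat p0 r \in padic_ball p0 (- e%:Z).
    rewrite -[padic_of_rat p0 r](subKr (x - padic_of_rat p0 q)); apply: rpredB => //.
    by apply: padic_ball_le rx; lia.
  move: re; rewrite padic_of_rat_ball padic_norm_le // /padic_val => re.
  have -> : r' = (numq r * (pn ^ e)%N%:Z)%:Q / (denq r)%:Q.
    by rewrite intrM -mulrA [_ * (_)^-1]mulrC mulrA divq_num_den.
  have n0 : numq r * (pn ^ e)%N%:Z != 0 by rewrite mulf_neq0 ?numq_eq0 // -lt0n expn_gt0 pn0.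
  have d0 : denq r != 0 by rewrite denq_eq0.
  rewrite -oppr0 padic_norm_le ?mulf_neq0 ?invr_eq0 ?intr_eq0 // padic_val_div //.
  rewrite abszM absz_nat lognM ?absz_gt0 ?numq_eq0 // ?expn_gt0 ?pn0 // pfactorK //.
  by move: re; move: (logn _ _) (logn _ _) => u v; lia.
have rE : r = X%:Q / (Y * pn ^ e)%N%:Q.
  rewrite PoszM intrM invfM mulrA.
  have -> : X%:Q / Y%:Q = r' by rewrite -[RHS]divq_num_den /Y gez0_abs // denq_ge0.
  by rewrite /r' mulfK.
have [w wP] : exists w : int, ((pn ^ (e + n p0))%N %| absz (X - (Y * P)%N%:Z * w)%R)%N.
  have [u [v uv]] := Bezoutz (Y * P)%N%:Z (pn ^ (e + n p0))%N%:Z.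
  have g1 : gcdz (Y * P)%N%:Z (pn ^ (e + n p0))%N%:Z = 1.
    by rewrite /gcdz /=; apply/eqP; rewrite -[_ == _]/(coprime _ _) coprimeXr // coprimeMl cY.
  exists (u * X); have -> : X - (Y * P)%N%:Z * (u * X) = (X * v) * (pn ^ (e + n p0))%N%:Z.
    rewrite g1 in uv; transitivity (X * (u * (Y * P)%N%:Z + v * (pn ^ (e + n p0))%N%:Z) - (Y * P)%N%:Z * (u * X)).
      by rewrite uv mulr1.
    by ring.
  by rewrite abszM dvdn_mull.
pose dl : rat := (P%:Z * w)%:Q / (pn ^ e)%N%:Q.
have dlB p m : p != p0 -> ((val p ^ m)%N %| P)%N -> padic_of_rat p dl \in padic_ball p m%:Z.
  move=> pp0 pm; have cp : coprime (pn ^ e) (val p).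
    rewrite coprimeXl // prime_coprime // dvdn_prime2 ?(valP p) // eq_sym.
    by apply: contra pp0.
  have := @padic_of_frac_ball p (P%:Z * w) (pn ^ e)%N 0 m cp.
  by rewrite expn0 muln1 add0n; apply; rewrite abszM dvdn_mulr.
have ldl : rat_ell ell (- dl).
  exists (nseq e pn); split.
  - by apply/allP => t /nseqP[-> _].
  - move=> p l _ pl; rewrite count_nseq /=; have [ep|] := eqVneq pn p; last by rewrite mul0n.
    by rewrite mul1n; apply: el; exact: etrans (congr1 ell ep) pl.
  - rewrite big_nseq (_ : iter e (muln pn) 1%N = (pn ^ e)%N); last by elim: (e) => //= k ->; rewrite expnS.
    by rewrite mulrN rpredN /dl mulrCA -[X in _ * (X / _)]/((pn ^ e)%N%:Q) divff // mulr1 intr_int.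
exists (q + dl).
have D p : padic_of_rat p (q + dl) = padic_of_rat p q + padic_of_rat p dl by exact: raddfD.
split.
- by rewrite -[dl]opprK; exact: (rat_ell_zmod_closed ell).2.
- move=> p; rewrite inE => /predU1P[->|pL]; rewrite D opprD addrA.
    rewrite -/x -[_ - padic_of_rat p0 dl](subrKA (padic_of_rat p0 r)); apply: rpredD => //.
    have -> : padic_of_rat p0 r - padic_of_rat p0 dl = padic_of_rat p0 (r - dl) by apply/esym; exact: raddfB.
    have -> : r - dl = (X - (Y * P)%N%:Z * w)%:Q / (Y * pn ^ e)%N%:Q.
      have Yq : Y%:Q != 0 by rewrite intr_eq0 -lt0n.
      move: Yq pe0; rewrite rE /dl !PoszM intrB !intrM.
      by move: (Y%:Q) ((pn ^ e)%N%:Q) => yy zz yy0 zz0; field; rewrite yy0 zz0.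
    by apply: padic_of_frac_ball.
  apply: rpredB; first exact: qL.
  apply: dlB; first by apply: contraNneq p0L => <-.
  by rewrite /P (perm_big _ (perm_to_rem pL)) /= big_cons dvdn_mulr.
- move=> p; rewrite inE negb_or => /andP[pp0 pL]; rewrite D; apply: rpredD; first exact: qnL.
  by apply: (dlB p 0%N pp0); rewrite expn0 dvd1n.
Qed.

End SolenoidTopology.

Section SolenoidDensity.
Variables (R : realType) (ell : nat -> option nat).
Local Notation G := (adeles_ell R ell).
Local Notation M := (adelic_nilmanifold R ell).
Local Notation proj := (@solenoid_proj R ell).

(** Strong approximation moves any adele, by a rational number, close to an
    adele whose finite components are near 0. *)
Lemma sol_dense (u : M) (U : set M) : nbhs u U ->
  exists (e : R) (N : nat) (r : R), [/\ 0 < e, (0 < N)%N & forall rho (c : int),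
    `|rho - r| < e -> (N %| `|c|)%N -> U (sol ell rho (fun=> c))].
Proof.
have [a <-] := solenoid_projP u => /nbhs_solenoid[e [n [e0 fn H]]].
have /asboolP[fa _] := valP a.
have : finite_set ([set p | n p != 0%N] `|` [set p | (val a).2 p \notin padic_ball p 0]).
  by rewrite finite_setU.
move=> /finite_seqP[L LP].
have inL p : p \in undup L <-> n p != 0%N \/ (val a).2 p \notin padic_ball p 0.
  by rewrite mem_undup; have -> : (p \in L) = ([set` L] p) :> Prop by []; rewrite -LP.
have [q [lq qL qnL]] := strong_approximation a n (undup_uniq L).
have [N N0 NP] := finite_support_modulus fn.
exists e, N, ((val a).1 + ratr q); split=> // rho c hr Nc.
have lq' : rat_ell ell (- q).
  by rewrite -[- q]sub0r; apply: (rat_ell_zmod_closed ell).2 => //; exact: (rat_ell_zmod_closed ell).1.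
pose h : G := AdelesEll (rat_adele_in_adeles_ell R lq').
have cc := profinite_cauchy_cst c.
have -> : sol ell rho (fun=> c) = proj (adele_of ell rho (fun=> c) + h).
  apply/quotient_proj_eq; apply/asboolP; exists q => //.
  rewrite opprD addrA subrr sub0r.
  have -> : adeles_ell_val (- h) = - adeles_ell_val h by exact: (raddfN (val : G -> adele_product R)).
  rewrite /= -[LHS]sub0r -[0](subrr (rat_adele R q)) -rat_adeleB subrr -rat_adeleB.
  by rewrite sub0r opprK.
apply: H; rewrite adeles_ell_valD adele_of_val //; split.
  rewrite [X in `|X|](_ : _ = rho - ((val a).1 + ratr q)) //=.
  by rewrite raddfN /= opprD addrA addrAC.
move=> p.
have -> : (((rho, fun p1 => padic_of_seq p1 (fun=> c)) : adele_product R) + adeles_ell_val h - adeles_ell_val a).2 p =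
  padic_of_rat p c%:~R - ((val a).2 p - padic_of_rat p q).
  rewrite -[LHS]/(padic_of_seq p (fun=> c) + padic_of_rat p (- - q) - (val a).2 p) padic_of_seq_cst opprK.
  by rewrite opprB addrA.
apply: rpredB; first by apply: padic_of_int_ball; exact: dvdn_trans (NP p) Nc.
have [pL|pL] := boolP (p \in undup L); first exact: qL.
have [n0 ap] : n p = 0%N /\ (val a).2 p \in padic_ball p 0.
  by split; [apply/eqP|]; apply: contraNT pL => h'; apply/inL; [left|right].
by rewrite n0; apply: rpredB => //; exact: qnL.
Qed.

(** If two points cannot be separated, their difference lies in arbitrarily
    small boxes around rational adeles. Two of these rational numbers differ
    by an integer of absolute value less than 1, so they all coincide, and the
    difference is that rational adele. *)
Lemma solenoid_hausdorff : hausdorff_space M.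
Proof.
move=> u v cl; have [a au] := solenoid_projP u; have [b bv] := solenoid_projP v.
have near (e : R) (n : prime_nat -> nat) : 0 < e -> finite_set [set p | n p != 0%N] ->
    exists2 q, rat_ell ell q & adele_box e n (val a - val b - rat_adele R q).
  move=> e0 fn.
  have entE : entourage [set uv : M * M | exists x y : G,
      [/\ adele_box e n (val (x - y)), proj x = uv.1 & proj y = uv.2]].
    exists [set z : G | adele_box e n (val z)]; last by move=> x y xy; exists x, y.
    by exists e, n; split=> // z; rewrite subr0.
  have : [set uv : M * M | exists x y : G,
      [/\ adele_box e n (val (x - y)), proj x = uv.1 & proj y = uv.2]] (u, v).
    have : close u v by rewrite closeEnbhs.
    by rewrite entourage_close; apply.
  move=> [x [y [xy /= xu yv]]].
  have /quotient_proj_eq/asboolP[q lq qE] : proj x = proj a by rewrite xu au.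
  have /quotient_proj_eq/asboolP[q' lq' q'E] : proj y = proj b by rewrite yv bv.
  exists (q' - q); first by apply: (rat_ell_zmod_closed ell).2.
  suff -> : val a - val b - rat_adele R (q' - q) = val (x - y) by [].
  rewrite rat_adeleB -qE -q'E !adeles_ell_valB -[val (x - y)]/(adeles_ell_val (x - y)) adeles_ell_valB.
  rewrite -![val _]/(adeles_ell_val _).
  move: (adeles_ell_val a) (adeles_ell_val b) (adeles_ell_val x) (adeles_ell_val y) => A B X Y.
  have E : X - A - (Y - B) = (X - Y) - (A - B) by rewrite !opprB [B - Y]addrC addrACA [- A + B]addrC.
  by rewrite opprB E addrC subrK.
have f0 : finite_set [set p : prime_nat | 0%N != 0%N] by apply: sub_finite_set (finite_set0 _).
have e20 : (0 : R) < 1 / 2 by rewrite divr_gt0.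
have [q1 lq1 q1P] := near _ _ e20 f0.
have all (e : R) n : 0 < e -> e <= 1 / 2 -> finite_set [set p | n p != 0%N] ->
    adele_box e n (val a - val b - rat_adele R q1).
  move=> e0 e1 fn; have [q2 lq2 q2P] := near _ _ e0 fn.
  suff -> : q1 = q2 by [].
  have dE : rat_adele R (q1 - q2) = (val a - val b - rat_adele R q2) - (val a - val b - rat_adele R q1).
    by rewrite rat_adeleB; move: (val a - val b) => D; rewrite opprB [RHS]addrC addrA subrK.
  have [h1 h1'] := q1P; have [h2 h2'] := q2P.
  have qn : `|ratr (q1 - q2)| < 1 :> R.
    have -> : ratr (q1 - q2) = (val a - val b - rat_adele R q2).1 - (val a - val b - rat_adele R q1).1.
      exact: (congr1 fst dE).
    by rewrite (le_lt_trans (ler_normB _ _)) //; lra.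
  have qp p : padic_of_rat p (q1 - q2) \in padic_ball p 0.
    have pe : padic_of_rat p (- (q1 - q2)) = (val a - val b - rat_adele R q2).2 p - (val a - val b - rat_adele R q1).2 p.
      exact: (congr1 (fun f : adele_product R => f.2 p) dE).
    have : padic_of_rat p (- (q1 - q2)) \in padic_ball p 0.
      rewrite pe; apply: rpredB; last exact: h1'.
      by apply: padic_ball_le (h2' p); lia.
    by rewrite raddfN rpredN.
  have qE := rat_padic_integers qp.
  move: qn; rewrite qE ratr_int -intr_norm ltrz1 => qn.
  apply/eqP; rewrite -subr_eq0 qE (_ : numq (q1 - q2) = 0) //; lia.
rewrite -au -bv; apply/quotient_proj_eq; apply/asboolP; exists q1 => //.
rewrite adeles_ell_valB; apply/eqP; rewrite -subr_eq0; apply/eqP.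
rewrite -![adeles_ell_val _]/(val _); set D := (_ - _ - _) in all *.
have D1 : D.1 = 0.
  apply/eqP; rewrite -normr_le0; apply/ler_addgt0Pr => e e0; rewrite add0r.
  have m0 : 0 < Num.min e (1 / 2) by rewrite lt_min e0.
  have m1 : Num.min e (1 / 2) <= 1 / 2 by rewrite ge_min lexx orbT.
  have [h _] := all _ _ m0 m1 f0.
  by rewrite ltW // (lt_le_trans h) // ge_min lexx.
have D2 p : D.2 p = 0.
  apply: padic_separated => n.
  have fn : finite_set [set p' : prime_nat | (if p' == p then n else 0%N) != 0%N].
    by apply: sub_finite_set (finite_set1 p) => p' /=; have [-> //|_] := eqVneq p' p; rewrite eqxx.
  by have [_ /(_ p)] := all _ (fun p' => if p' == p then n else 0%N) e20 (lexx _) fn; rewrite eqxx.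
have D2' : D.2 = (fun p => 0 : padic p) by apply: functional_extensionality_dep.
rewrite [D]surjective_pairing D1 D2'; reflexivity.
Qed.

End SolenoidDensity.

(** * Odometers and rotations *)

Lemma hausdorff_prod (S T : topologicalType) : hausdorff_space S -> hausdorff_space T ->
  hausdorff_space (S * T)%type.
Proof.
move=> hS hT [p1 p2] [q1 q2] cl; congr (_, _).
  apply: hS => U V nU nV.
  have nU2 : nbhs (p1, p2) (U `*` setT) by exists (U, setT) => //; split=> //=; exact: filterT.
  have nV2 : nbhs (q1, q2) (V `*` setT) by exists (V, setT) => //; split=> //=; exact: filterT.
  by have [z [[/= zU _] [zV _]]] := cl _ _ nU2 nV2; exists z.1.
apply: hT => U V nU nV.
have nU2 : nbhs (p1, p2) (setT `*` U) by exists (setT, U) => //; split=> //=; exact: filterT.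
have nV2 : nbhs (q1, q2) (setT `*` V) by exists (setT, V) => //; split=> //=; exact: filterT.
by have [z [[/= _ zU] [_ zV]]] := cl _ _ nU2 nV2; exists z.2.
Qed.

Section OdometerTopology.
Variable o : nat -> nat.
Local Notation O := (odometer o).

Definition digit (z : O) (k : nat) : nat := set_val z k.

Lemma digitS (z : O) k : (digit z k.+1 %% odometer_modulus o k)%N = digit z k.
Proof. exact: (set_mem (valP z)) k. Qed.

Lemma odometer_modulus_dvd j k : (j <= k)%N ->
  (odometer_modulus o j %| odometer_modulus o k)%N.
Proof.
move=> jk; rewrite -(subnK jk); elim: (k - j)%N => [|n IH]; first by rewrite add0n.
rewrite addSn; apply: dvdn_trans IH _.
by rewrite [X in (_ %| X)%N]/odometer_modulus big_ord_recr /= dvdn_mulr.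
Qed.

Lemma digit_mod (z : O) j k : (j <= k)%N -> (digit z k %% odometer_modulus o j)%N = digit z j.
Proof.
move=> jk; rewrite -(subnK jk); elim: (k - j)%N => [|n IH].
  by rewrite add0n modn_small // ltn_ord.
rewrite addSn -IH -[X in (X %% _)%N = _]/(digit z (n + j).+1) -(digitS z (n + j)) modn_dvdm //.
by apply: odometer_modulus_dvd; rewrite leq_addl.
Qed.

Lemma odometer_ext (z z' : O) : (forall k, digit z k = digit z' k) -> z = z'.
Proof.
by move=> zz; apply: val_inj; apply: functional_extensionality_dep => k; apply: val_inj; exact: zz.
Qed.

Lemma digit_iter (z : O) n k :
  digit (iter n (@odometer_succ o) z) k = ((digit z k + n) %% odometer_modulus o k)%N.
Proof.
elim: n => [|n IH]; first by rewrite addn0 modn_small // ltn_ord.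
have -> : digit (iter n.+1 (@odometer_succ o) z) k =
    ((digit (iter n (@odometer_succ o) z) k).+1 %% odometer_modulus o k)%N by [].
by rewrite IH -addn1 modnDml addn1 addnS.
Qed.

Lemma nbhs_digit (z : O) k : nbhs z [set z' : O | digit z' k = digit z k].
Proof.
have c0 : nbhs (set_val z k : discrete_topology 'I_(odometer_modulus o k)) [set i | i = set_val z k].
  by apply: open_nbhs_nbhs; split=> //; exact: (@discrete_open (discrete_topology 'I_(odometer_modulus o k))).
have c1 : nbhs (set_val z : odometer_space o) [set f : odometer_space o | f k = set_val z k].
  exact: (@proj_continuous nat (fun k => discrete_topology 'I_(odometer_modulus o k)) k (set_val z) _ c0).
have c2 : nbhs z (set_val @^-1` [set f : odometer_space o | f k = set_val z k]).
  exact: (@initial_continuous _ _ (set_val : O -> odometer_space o) z _ c1).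
by apply: filterS c2 => z' /= e; rewrite /digit e.
Qed.

Lemma entourage_digit (E : set (O * O)) : entourage E ->
  exists k, forall z z', digit z k = digit z' k -> E (z, z').
Proof.
move=> [V [B [F _ FB] BV] VE].
have [k kP] : exists k, forall ie, ie \in (finmap.enum_fset F) -> forall z z' : O, digit z k = digit z' k ->
  (projT1 ie).2 (set_val z, set_val z').
  elim: (finmap.enum_fset F) => [|ie s [k kP]]; first by exists 0%N.
  case: ie => -[i W] entW; have /asboolP[W' entW' W'W] := entW.
  exists (maxn i k) => ie'; rewrite inE => /predU1P[->|ies] z z' zz; last first.
    apply: (kP _ ies); rewrite -(digit_mod z (leq_maxr i k)) -(digit_mod z' (leq_maxr i k)).
    by rewrite zz.
  have zi : set_val z i = set_val z' i.
    by apply: val_inj; rewrite -[LHS](digit_mod z (leq_maxl i k)) zz (digit_mod z' (leq_maxl i k)).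
  apply: W'W; rewrite /preimage /unstable.map_pair /= /proj zi.
  exact: (@entourage_refl (discrete_topology 'I_(odometer_modulus o i)) W' (set_val z' i) entW').
exists k => z z' zz; apply: VE; apply: BV; rewrite -FB => ie /= ieF.
exact: kP.
Qed.

Lemma nbhs_digitP (z : O) U : nbhs z U -> exists k, forall z', digit z' k = digit z k -> U z'.
Proof.
rewrite -nbhs_entourageE => -[E /entourage_digit[k kP] EU].
by exists k => z' e; apply: EU; apply/xsectionP; apply: kP.
Qed.

Lemma odometer_hausdorff : hausdorff_space O.
Proof.
move=> p q cl; apply: odometer_ext => k.
by have [z [/= <- <-]] := cl _ _ (nbhs_digit p k) (nbhs_digit q k).
Qed.

End OdometerTopology.

Section Rotation.
Variables (o : nat -> nat) (R : realType) (ell : nat -> option nat).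
Local Notation M := (adelic_nilmanifold R ell).
Variable alpha : M.
Local Notation rot := (@odometer_rotation o M alpha).

Lemma iter_rotation n z : iter n rot z = (iter n (@odometer_succ o) z.1, z.2 + alpha *+ n).
Proof.
elim: n => [|n IH]; first by rewrite addr0; case: z.
by rewrite iterS IH /odometer_rotation /= mulrSr addrA.
Qed.

(** Both coordinates move by translations, under which closeness of digits and
    basic entourages of the group are invariant. *)
Lemma rotation_equicontinuous : compact [set: odometer o * M] -> equicontinuous_system rot.
Proof.
have eqc (x : odometer o * M) (E : set ((odometer o * M) * (odometer o * M))) : entourage E ->
    \forall y \near x, forall n : nat, E (iter n rot x, iter n rot y).
  move=> [[E1 E2] /= [/entourage_digit[k kP] [U U0 UE2]] EE].
  have [a ax] := solenoid_projP x.2.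
  pose E2' := [set uv : M * M | exists b c, [/\ U (b - c), solenoid_proj b = uv.1 & solenoid_proj c = uv.2]].
  have entE2' : entourage E2' by exists U => // b c bc; exists b, c.
  exists ([set z | digit z k = digit x.1 k], xsection E2' x.2).
    by split=> /=; [exact: nbhs_digit|exact: nbhs_entourage].
  move=> [z u] /= [zk /xsectionP[b [c [Ubc /= bx cu]]]] n.
  have e1 : E1 (iter n (@odometer_succ o) x.1, iter n (@odometer_succ o) z).
    by apply: kP; rewrite !digit_iter zk.
  have e2 : E2 (x.2 + alpha *+ n, u + alpha *+ n).
    have [g gE] := solenoid_projP (alpha *+ n).
    have D (y y' : adeles_ell R ell) : solenoid_proj y + solenoid_proj y' = solenoid_proj (y + y').
      exact: solenoid_projD.
    rewrite -bx -cu -gE !D; apply: UE2; rewrite opprD addrACA subrr addr0.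
    exact: Ubc.
  rewrite !iter_rotation /=.
  have [[[p1 p2] [p3 p4]] /= Ep] := EE ((_, _), (_, _)) (conj e1 e2).
  by move=> /eqP; rewrite !xpair_eqE => /andP[/andP[/eqP <- /eqP <-] /andP[/eqP <- /eqP <-]].
move=> cOM; split=> //.
- by apply: hausdorff_prod; [exact: odometer_hausdorff|exact: solenoid_hausdorff].
- move=> x U nU.
  have [E entE EU] : exists2 E, entourage E & xsection E (rot x) `<=` U.
    by move: nU; rewrite -nbhs_entourageE.
  suff : nbhs x (rot @^-1` U) by [].
  apply: filterS (eqc x E entE) => y /(_ 1%N) h; apply: EU.
  by apply/xsectionP.
Qed.

End Rotation.

(** * The rotation angle *)

Section RotationAngle.
Variables (R : realType) (a d : nat -> nat).
Hypothesis a_gt1 : forall k, (1 < a k)%N.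
Hypothesis d_gt0 : forall k, (0 < d k)%N.
Hypothesis d_le_a : forall k, (d k <= a k)%N.
Hypothesis da_small : forall k, (3 * (d k * d k.+1) <= a k * a k.+1)%N.
Local Notation hl := (hl a d).
Local Notation hp := (hp a d).

Definition ml k := (vec a d 0 1 k).1.
Definition mp k := (vec a d 0 1 k).2.
(** The index of the lattice spanned by the vectors (length, number of letters
    1) of [u_k] and [v_k]. *)
Definition covolume k := (\prod_(j < k) d j)%N.

Lemma mlS k : ml k.+1 = ((a k).+1 * ml k + mp k)%N. Proof. by []. Qed.
Lemma mpS k : mp k.+1 = (d k * ml k)%N. Proof. by []. Qed.

Lemma covolumeS k : covolume k.+1 = (covolume k * d k)%N.
Proof. by rewrite /covolume big_ord_recr. Qed.

Lemma covolume_gt0 k : (0 < covolume k)%N.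
Proof. by apply: prodn_gt0 => i; exact: d_gt0. Qed.

Lemma det_heights k : (hl k)%:Z * (mp k)%:Z - (ml k)%:Z * (hp k)%:Z = (-1) ^+ k * (covolume k)%:Z.
Proof.
elim: k => [|k IH]; first by rewrite /covolume big_ord0.
rewrite hlS hpS mlS mpS covolumeS exprS !PoszD !PoszM.
transitivity (- ((d k)%:Z * ((hl k)%:Z * (mp k)%:Z - (ml k)%:Z * (hp k)%:Z))); first by ring.
by rewrite IH; ring.
Qed.

Let h k : R := (hl k)%:R.
Let m k : R := (ml k)%:R.
Let W k : R := (covolume k)%:R.
Let s k : R := (-1) ^+ k.

Let h_gt0 k : 0 < h k. Proof. by rewrite ltr0n hl_gt0. Qed.
Let W_gt0 k : 0 < W k. Proof. by rewrite ltr0n covolume_gt0. Qed.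

Let det k : h k * m k.+1 - m k * h k.+1 = s k * W k.
Proof.
have := congr1 (fun z : int => z%:~R : R) (det_heights k).
rewrite intrB !intrM rmorphXn rmorphN1 /= => <-.
have -> : m k.+1 = (a k).+1%:R * m k + (mp k)%:R by rewrite /m mlS natrD natrM.
have -> : h k.+1 = (a k).+1%:R * h k + (hp k)%:R by rewrite /h hlS natrD natrM.
by rewrite /h /m; ring.
Qed.

Let slope k : R := m k / h k.

Let slopeB k : slope k.+1 - slope k = s k * (W k / (h k * h k.+1)).
Proof.
rewrite /slope mulrA -det; have := h_gt0 k; have := h_gt0 k.+1 => h1 h0.
by field; rewrite !gt_eqF.
Qed.

Let slopeB2 k : slope k.+2 - slope k = s k * ((a k.+1).+1%:R * W k / (h k * h k.+2)).
Proof.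
have h0 := h_gt0 k; have h2 := h_gt0 k.+2.
have e : h k * m k.+2 - m k * h k.+2 = s k * ((a k.+1).+1%:R * W k).
  rewrite mulrCA -det.
  have -> : m k.+2 = (a k.+1).+1%:R * m k.+1 + (d k)%:R * m k.
    by rewrite /m mlS mpS natrD !natrM.
  have -> : h k.+2 = (a k.+1).+1%:R * h k.+1 + (d k)%:R * h k.
    by rewrite /h hlS hpS natrD !natrM.
  ring.
rewrite mulrA -e /slope; by field; rewrite !gt_eqF.
Qed.

Let s_even k : s (2 * k) = 1. Proof. by rewrite /s exprM sqrrN !expr1n. Qed.
Let s_odd k : s (2 * k).+1 = -1. Proof. by rewrite /s exprS exprM sqrrN !expr1n mulr1. Qed.

Let gap k : 0 < (a k.+1).+1%:R * W k / (h k * h k.+2).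
Proof. by rewrite divr_gt0 ?mulr_gt0 // ltr0n. Qed.

Let even_incr k : slope (2 * k) < slope (2 * k.+1).
Proof. by rewrite -subr_gt0 mulnS addnC addn2 slopeB2 s_even mul1r. Qed.

Let odd_decr k : slope (2 * k.+1).+1 < slope (2 * k).+1.
Proof. by rewrite -subr_lt0 mulnS addnC addn2 slopeB2 s_odd mulN1r oppr_lt0. Qed.

Let even_mono i j : (i <= j)%N -> slope (2 * i) <= slope (2 * j).
Proof.
elim: j => [|j IH]; first by rewrite leqn0 => /eqP ->.
rewrite leq_eqVlt => /predU1P[-> //|]; rewrite ltnS => /IH le.
exact: le_trans le (ltW (even_incr j)).
Qed.

Let odd_mono i j : (i <= j)%N -> slope (2 * j).+1 <= slope (2 * i).+1.
Proof.
elim: j => [|j IH]; first by rewrite leqn0 => /eqP ->.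
rewrite leq_eqVlt => /predU1P[-> //|]; rewrite ltnS => /IH le.
exact: le_trans (ltW (odd_decr j)) le.
Qed.

Let even_lt_odd i j : slope (2 * i) < slope (2 * j).+1.
Proof.
apply: le_lt_trans (even_mono (leq_maxl i j)) _.
apply: lt_le_trans (odd_mono (leq_maxr i j)).
rewrite -subr_gt0 slopeB s_even mul1r divr_gt0 ?mulr_gt0 //.
Qed.

(** The density of the letter 1: the limit of the slopes [ml k / hl k], which
    alternate around it as convergents of a continued fraction do. *)
Definition theta : R := sup [set slope (2 * k) | k in [set: nat]].

Let theta_even k : slope (2 * k) < theta.
Proof.
apply: lt_le_trans (even_incr k) _; apply: ub_le_sup; last by exists k.+1.
by exists (slope 1) => _ [j _ <-]; apply: ltW; exact: (even_lt_odd j 0).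
Qed.

Let theta_odd k : theta < slope (2 * k).+1.
Proof.
apply: le_lt_trans _ (odd_decr k); apply: ge_sup; first by exists (slope (2 * 0)); exists 0%N.
by move=> _ [j _ <-]; apply: ltW; exact: even_lt_odd.
Qed.

(** The error of the convergent of level [k], in the form in which it occurs
    when a block [u_k] is traversed. *)
Definition eps k : R := h k * theta - m k.

Lemma eps_bound k : 0 < (-1) ^+ k * eps k < (covolume k)%:R / (hl k.+1)%:R.
Proof.
rewrite -/(s k) -/(W k) -/(h k.+1).
have h0 := h_gt0 k; have h1 := h_gt0 k.+1.
have -> : eps k = h k * (theta - slope k) by rewrite /eps /slope; field; rewrite gt_eqF.
have -> : W k / h k.+1 = h k * (s k * (slope k.+1 - slope k)).
  have ss : s k * s k = 1 by rewrite -expr2 sqrr_sign.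
  by rewrite slopeB [s k * (s k * _)]mulrA ss mul1r; field; rewrite !gt_eqF.
rewrite mulrCA pmulr_rgt0 // ltr_pM2l //.
have [j [kE|kE]] : exists j, k = (2 * j)%N \/ k = (2 * j).+1.
  by exists k./2; case: (odd k) (odd_double_half k) => /= e; [right|left]; lia.
  rewrite kE s_even !mul1r subr_gt0 ltrD2r theta_even /=.
  exact: theta_odd.
rewrite kE s_odd !mulN1r !opprB subr_gt0 theta_odd /= ltrD2l ltrN2.
have := theta_even j.+1; by rewrite mulnS addnC addn2.
Qed.

Lemma eps_neq0 k : eps k != 0.
Proof.
have /andP[+ _] := eps_bound k; apply: contraTneq => ->.
by rewrite mulr0 ltxx.
Qed.

Lemma eps_le k : `|eps k| <= (covolume k)%:R / (hl k.+1)%:R.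
Proof.
have /andP[e0 e1] := eps_bound k; move: (ltW e1); rewrite -(ger0_norm (ltW e0)).
by rewrite normrM normrX normrN1 expr1n mul1r.
Qed.

(** [a k * |eps k|] is at most this number, which decreases at least by a
    factor 3 every two levels. *)
Definition ratio k : R := (covolume k)%:R / (hl k)%:R.

Lemma ratio_gt0 k : 0 < ratio k.
Proof. by rewrite divr_gt0 ?W_gt0 ?h_gt0. Qed.

Let a_h k : (a k)%:R * h k <= h k.+1.
Proof. by rewrite /h -natrM ler_nat hlS; have := hl_gt0 a d k; nia. Qed.

Lemma ratioS k : (a k)%:R * ratio k.+1 <= (d k)%:R * ratio k.
Proof.
rewrite /ratio covolumeS natrM -/(W k) -/(h k) -/(h k.+1).
have h0 := h_gt0 k; have h1 := h_gt0 k.+1.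
have -> : (a k)%:R * (W k * (d k)%:R / h k.+1) = W k * (d k)%:R * ((a k)%:R / h k.+1).
  by field; rewrite gt_eqF.
have -> : (d k)%:R * (W k / h k) = W k * (d k)%:R * (h k)^-1 by field; rewrite gt_eqF.
have wd : 0 <= W k * (d k)%:R by rewrite mulr_ge0 // ltW.
by rewrite ler_wpM2l // ler_pdivrMr // [leRHS]mulrC ler_pdivlMr // a_h.
Qed.

Lemma ratio_le k : ratio k.+1 <= ratio k.
Proof.
have := ratioS k; have a0 : 0 < (a k)%:R :> R by rewrite ltr0n (ltn_trans _ (a_gt1 k)).
have da : (d k)%:R <= (a k)%:R :> R by rewrite ler_nat.
have r0 := ratio_gt0 k => le; rewrite -(ler_pM2l a0) (le_trans le) // ler_pM2r //.
Qed.

Lemma ratio3 k : 3 * ratio k.+2 <= ratio k.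
Proof.
have a0 j : 0 < (a j)%:R :> R by rewrite ltr0n (ltn_trans _ (a_gt1 j)).
have r1 := ratioS k; have r2 := ratioS k.+1.
have sm : 3 * ((d k)%:R * (d k.+1)%:R) <= (a k)%:R * (a k.+1)%:R :> R.
  by rewrite -!natrM ler_nat.
have := ratio_gt0 k; have d0 : 0 < (d k)%:R :> R by rewrite ltr0n.
have d1 : 0 < (d k.+1)%:R :> R by rewrite ltr0n.
have aa : 0 < (a k)%:R * (a k.+1)%:R :> R by rewrite mulr_gt0.
move=> rk; rewrite -(ler_pM2l aa).
have e1 : (a k)%:R * ((a k.+1)%:R * ratio k.+2) <= (d k.+1)%:R * ((d k)%:R * ratio k).
  apply: (@le_trans _ _ ((a k)%:R * ((d k.+1)%:R * ratio k.+1))); first by rewrite ler_pM2l.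
  by rewrite mulrCA ler_pM2l.
have e2 : 3 * ((d k)%:R * (d k.+1)%:R) * ratio k <= (a k)%:R * (a k.+1)%:R * ratio k.
  by rewrite ler_pM2r.
by apply: le_trans e2; lra.
Qed.

Lemma eps_ratio k : `|eps k| * (a k)%:R <= ratio k.
Proof.
have h0 := h_gt0 k; have h1 := h_gt0 k.+1.
apply: (@le_trans _ _ (W k / h k.+1 * (a k)%:R)); first by rewrite ler_wpM2r // eps_le.
by rewrite /ratio -mulrA ler_pM2l // [leLHS]mulrC ler_pdivrMr // [leRHS]mulrC ler_pdivlMr // a_h.
Qed.

(** A bound for the sum over [j >= k] of [(a j + d j) * |eps j|], which is the
    total change of the real coordinate of a point above level [k]. *)
Definition tail k : R := 3 * (ratio k + ratio k.+1).

Lemma tail_gt0 k : 0 < tail k.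
Proof. by rewrite mulr_gt0 // addr_gt0 // ratio_gt0. Qed.

Lemma tail_step k : (a k + d k)%:R * `|eps k| + tail k.+1 <= tail k.
Proof.
have e := eps_ratio k; have r3 := ratio3 k.
have dd : (d k)%:R * `|eps k| <= (a k)%:R * `|eps k|.
  by rewrite ler_wpM2r // ler_nat.
by rewrite natrD /tail; lra.
Qed.

Lemma tail_le_ratio k : tail k <= 6 * ratio k.
Proof. by have := ratio_le k; rewrite /tail; lra. Qed.

Lemma eps_le_tail k : `|eps k| <= tail k.
Proof.
have := tail_step k; have := tail_gt0 k.+1.
have : `|eps k| <= (a k + d k)%:R * `|eps k|.
  by rewrite ler_peMl // ler1n; have := a_gt1 k; lia.
by lra.
Qed.

Lemma tail_mono i j : (i <= j)%N -> tail j <= tail i.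
Proof.
elim: j => [|j IH]; first by rewrite leqn0 => /eqP ->.
rewrite leq_eqVlt => /predU1P[-> //|]; rewrite ltnS => /IH le.
apply: le_trans le; have := tail_step j.
have : 0 <= (a j + d j)%:R * `|eps j| by rewrite mulr_ge0.
lra.
Qed.

Lemma tail_small (e : R) : 0 < e -> exists K, forall k, (K <= k)%N -> tail k < e.
Proof.
move=> e0; have r2 j : ratio (2 * j) * j.+1%:R <= 1.
  elim: j => [|j IH]; first by rewrite /ratio /covolume big_ord0 mulr1 divr1.
  have := ratio3 (2 * j); rewrite mulnS addnC addn2 => r3; have := ratio_gt0 (2 * j).+2.
  move: IH; rewrite -(natr1 j.+1) -(natr1 j); have : 0 <= j%:R :> R by [].
  by move: (ratio _) (ratio _) (j%:R) r3 => u v w; nra.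
have [j jP] : exists j : nat, 6 / e < j%:R by exists (Num.trunc (6 / e)).+1; exact: truncnS_gt.
exists (2 * j)%N => k jk; apply: le_lt_trans (tail_mono jk) _.
apply: le_lt_trans (tail_le_ratio _) _.
have j0 : 0 < j%:R :> R by apply: lt_trans jP; rewrite divr_gt0.
move: jP; rewrite ltr_pdivrMr // => jP.
have := r2 j; rewrite -natr1; have := ratio_gt0 (2 * j).
by move: (ratio _) => u; nra.
Qed.

End RotationAngle.

(** * Position of the origin in the blocks *)

Section Address.
Variables (a d : nat -> nat).
Hypothesis a_gt1 : forall k, (1 < a k)%N.
Hypothesis d_gt0 : forall k, (0 < d k)%N.
Local Notation blk := (blk a d).
Local Notation hl := (hl a d).
Local Notation hp := (hp a d).
Local Notation len := (len a d).
Local Notation nu := (nu a d).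
Local Notation covered := (covered a d).
Local Notation mlen := (mlen a d).
Local Notation ml := (ml a d).

(** The distance from the origin to the left end of the block of level [k]
    that contains it; [cnt] is the number of letters 1 on the way. *)
Definition off (x : int -> bool) (k : nat) : nat :=
  xget 0%N [set n | exists2 t, blk x k (- n%:Z) t & (n < len k t)%N].

Definition ones (x : int -> bool) (n : int) : int := (x n)%:Z.

Definition cnt (x : int -> bool) (k : nat) : int :=
  psum (ones x) (- (off x k)%:Z) (off x k).

Lemma off_unique x k n t : blk x k (- n%:Z) t -> (n < len k t)%N -> off x k = n.
Proof.
move=> bn nl; have [t' b' nl'] : [set n | exists2 t, blk x k (- n%:Z) t & (n < len k t)%N] (off x k).
  by apply: (xgetI 0%N (x := n)); exists t.
have [le|lt] := leqP (off x k) n.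
  by have [|e _] := blk_disj d_gt0 bn b'; [lia|lia].
by have [|e _] := blk_disj d_gt0 b' bn; [lia|lia].
Qed.

Lemma offP x k : covered x -> exists2 t, blk x k (- (off x k)%:Z) t & (off x k < len k t)%N.
Proof.
move=> cx; have [i [t [bi ip]]] := cx k 0.
have iE : i = - `|i|%N%:Z by lia.
rewrite iE in bi; have il : (`|i| < len k t)%N by lia.
by exists t; rewrite (off_unique bi il).
Qed.

Lemma off_step x k : covered x -> exists j : nat,
  [/\ (j <= a k + d k)%N, off x k.+1 = (off x k + j * hl k)%N &
      cnt x k.+1 = cnt x k + (j * ml k)%:Z].
Proof.
move=> cx; have [t bt lt] := offP k.+1 cx.
have [|c cn /andP[c0 c1]] := sub_cover bt (p := 0); first by lia.
have bc := blk_sub bt cn; have ch : (c * hl k <= off x k.+1)%N by lia.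
have e : - (off x k.+1)%:Z + (c * hl k)%:Z = - (off x k.+1 - c * hl k)%N%:Z by lia.
have eo : off x k = (off x k.+1 - c * hl k)%N.
  rewrite e in bc; apply: off_unique bc _; lia.
exists c; split; last first.
- rewrite {1}/cnt -{2}(subnKC ch) psumD e -eo -/(cnt x k) addrC; congr (_ + _).
  rewrite psum_mul (eq_bigr (fun=> (ml k)%:Z)) => [|i _].
    by rewrite sumr_const card_ord -mulr_natl PoszM natz.
  have ic : (i < nu k t)%N := leq_trans (ltn_ord i) cn.
  have := ones_blk (blk_sub bt (ltnW ic)).
  by rewrite (ltn_eqF ic) lenE /mlen !mul0n !addn0.
- by rewrite eo subnK.
- by move: cn; rewrite nuE; case: (t); lia.
Qed.

(** Under the shift the origin moves by one letter, and at the end of a block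
    of level [k] the whole block is dropped. *)
Lemma shift_step x k : covered x -> exists (b t : bool),
  (off (fun n => x (n + 1)) k)%:Z = (off x k)%:Z + 1 - (b * len k t)%N%:Z /\ cnt (fun n => x (n + 1)) k = cnt x k + (x 0)%:Z - (b * mlen k t)%N%:Z.
Proof.
move=> cx; have [t bt lt] := offP k cx.
have onesS i n : psum (ones (fun n => x (n + 1))) i n = psum (ones x) (i + 1) n.
  by apply: eq_bigr => j _; rewrite /ones addrAC.
have cS : cnt x k + (x 0)%:Z = psum (ones x) (- (off x k)%:Z) (off x k).+1.
  by rewrite -addn1 psumD psum1 addNr.
have [lt'|le] := ltnP (off x k).+1 (len k t).
  have e : off (fun n => x (n + 1)) k = (off x k).+1.
    apply: (off_unique (t := t)) => //; rewrite blk_shift.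
    by have -> : - (off x k).+1%:Z + 1 = - (off x k)%:Z by lia.
  exists false, t; rewrite cS /cnt e onesS mul0n subr0; split; first by lia.
  by rewrite subr0; congr (psum _ _ _); lia.
have el : len k t = (off x k).+1 by apply/eqP; rewrite eqn_leq lt le.
have [t' b'] := next_block d_gt0 cx bt.
have e : off (fun n => x (n + 1)) k = 0%N.
  apply: (off_unique (t := t')); last exact: len_gt0.
  by rewrite blk_shift; move: b'; rewrite el; congr blk; lia.
exists true, t; rewrite cS /cnt e mul1n -el (ones_blk bt); split; first by rewrite el; lia.
by rewrite mul1n subrr /psum big_ord0.
Qed.

Lemma off_local x y k : covered x -> covered y ->
  (forall n, `|n| <= (len k true + radius a d k)%N%:Z -> x n = y n) ->
  off x k = off y k /\ cnt x k = cnt y k.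
Proof.
move=> cx cy xy; have [t bt lt] := offP k cx; have lT := len_le_true a d k t.
have e : off y k = off x k.
  apply: (off_unique (t := t)) => //; rewrite -(blk_local (x := x)) // => n nb.
  by apply: xy; lia.
split=> //; rewrite /cnt e; apply: eq_bigr => j _; rewrite /ones xy //.
by have := ltn_ord j; lia.
Qed.

Lemma off_base k : off (base_point a d) k = 0%N /\ cnt (base_point a d) k = 0.
Proof.
have e : off (base_point a d) k = 0%N.
  by apply: (off_unique (t := false)); [exact: base_blk|exact: len_gt0].
by split=> //; rewrite /cnt e /psum big_ord0.
Qed.

Section Residues.
Variables om nm : nat -> nat.
Hypothesis om_hl : forall k, (om k %| hl k)%N.
Hypothesis nm_ml : forall k, (nm k %| ml k)%N.
Hypothesis om_mono : forall j k, (j <= k)%N -> (om j %| om k)%N.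
Hypothesis nm_mono : forall j k, (j <= k)%N -> (nm j %| nm k)%N.

(** Offsets of higher level differ by multiples of lengths divisible by [n]. *)
Lemma off_cong x i j n : covered x -> (n %| om i)%N -> (n %| om j)%N ->
  (off x i = off x j %[mod n])%N.
Proof.
move=> cx; wlog ij : i j / (i <= j)%N.
  by move=> W ni nj; case/orP: (leq_total i j) => /W H; [exact: H|apply/esym; exact: H].
move=> ni _; rewrite -(subnK ij); elim: (j - i)%N => [|m IH] //.
have [c [_ e _]] := off_step (m + i) cx.
rewrite addSn e IH -modnDmr (_ : (_ * _ %% n)%N = 0%N) ?addn0 //; apply/eqP.
by rewrite -/(dvdn _ _) dvdn_mull // (dvdn_trans ni) // (dvdn_trans _ (om_hl _)) // om_mono // leq_addl.
Qed.

Lemma cnt_cong x i j n : covered x -> (n %| nm i)%N -> (n %| nm j)%N ->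
  (n %| `|(cnt x i - cnt x j)%R|)%N.
Proof.
move=> cx; wlog ij : i j / (i <= j)%N.
  by move=> W ni nj; case/orP: (leq_total i j) => /W H; [exact: H|rewrite -abszN opprB; exact: H].
move=> ni _; rewrite -(subnK ij); elim: (j - i)%N => [|m IH]; first by rewrite subrr dvdn0.
have [c [_ _ e]] := off_step (m + i) cx.
have d1 : (n%:Z %| (c * ml (m + i))%N%:Z)%Z.
  by rewrite dvdzE /= dvdn_mull // (dvdn_trans ni) // (dvdn_trans _ (nm_ml _)) // nm_mono // leq_addl.
by rewrite addSn e opprD addrA -[(n %| _)%N]/(n%:Z %| _)%Z rpredB.
Qed.

Hypothesis nm_cofinal : forall N, (0 < N)%N -> exists K, (N %| nm K)%N.

Lemma cnt_cauchy x : covered x -> profinite_cauchy (cnt x).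
Proof.
move=> cx N N0; have [K NK] := nm_cofinal N0; exists K => i Ki.
by apply: cnt_cong => //; apply: (dvdn_trans NK); exact: nm_mono.
Qed.

End Residues.

Section RealPart.
Variable R : realType.
Hypothesis d_le_a : forall k, (d k <= a k)%N.
Hypothesis da_small : forall k, (3 * (d k * d k.+1) <= a k * a k.+1)%N.
Local Notation theta := (theta R a d).
Local Notation eps := (eps R a d).
Local Notation tail := (tail R a d).

(** The distance [off x k] measured in units of [theta], up to an integer; it
    converges, as each step adds a multiple of [eps k]. *)
Definition rho_level (x : int -> bool) k : R := (off x k)%:R * theta - (cnt x k)%:~R.
(** The limit of [rho_level x k], as a supremum of lower bounds. *)
Definition rho x : R := sup [set rho_level x k - tail k | k in [set: nat]].

Lemma rho_step x k : covered x ->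
  `|rho_level x k.+1 - rho_level x k| <= tail k - tail k.+1.
Proof.
move=> cx; have [j [ja eo ec]] := off_step k cx.
have -> : rho_level x k.+1 - rho_level x k = j%:R * eps k.
  by rewrite /rho_level eo ec /eps intrD PoszM natrD natrM intrM -!pmulrn; ring.
rewrite normrM ger0_norm //; have := tail_step R a_gt1 d_gt0 d_le_a da_small k.
have : j%:R * `|eps k| <= (a k + d k)%:R * `|eps k| by rewrite ler_wpM2r // ler_nat.
by lra.
Qed.

Lemma rho_near x k : covered x -> `|rho x - rho_level x k| <= tail k.
Proof.
move=> cx; have mono i j : (i <= j)%N -> `|rho_level x j - rho_level x i| <= tail i - tail j.
  move=> ij; rewrite -(subnK ij); elim: (j - i)%N => [|m IH]; first by rewrite !subrr normr0.
  rewrite addSn; have st := rho_step (m + i) cx.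
  by move: IH st; rewrite !ler_norml => /andP[? ?] /andP[? ?]; apply/andP; split; lra.
have t0 j := tail_gt0 R a d_gt0 j.
have ub j : rho_level x j - tail j <= rho_level x k + tail k.
  have := t0 j; have := t0 k; case/orP: (leq_total j k) => /mono; rewrite ler_norml => /andP[? ?] ? ?; lra.
rewrite ler_norml; apply/andP; split.
  rewrite lerBrDr addrC; apply: ub_le_sup; last by exists k.
  by exists (rho_level x k + tail k) => _ [j _ <-]; exact: ub.
rewrite lerBlDl; apply: ge_sup; first by exists (rho_level x 0 - tail 0); exists 0%N.
by move=> _ [j _ <-]; exact: ub.
Qed.

Lemma len_eps k t : `|(len k.+1 t)%:R * theta - (mlen k.+1 t)%:R| <= 2 * tail k.
Proof.
have -> : (len k.+1 t)%:R * theta - (mlen k.+1 t)%:R = eps k.+1 + t%:R * ((d k)%:R * eps k).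
  rewrite /eps /len /mlen hpS -/(ml k.+1) -/(mp a d k.+1) mpS !natrD !natrM; ring.
apply: le_trans (ler_normD _ _) _.
have st := tail_step R a_gt1 d_gt0 d_le_a da_small k.
have e1 := eps_le_tail R a_gt1 d_gt0 d_le_a da_small k.+1.
have n0 := normr_ge0 (eps k).
have ae : 0 <= (a k)%:R * `|eps k| by rewrite mulr_ge0.
have de : 0 <= (d k)%:R * `|eps k| by rewrite mulr_ge0.
have t1 := tail_gt0 R a d_gt0 k.+1.
move: st; rewrite natrD mulrDl => st.
have d0 : `|(d k)%:R * eps k| = (d k)%:R * `|eps k| by rewrite normrM ger0_norm.
by case: t => /=; rewrite ?mul1r ?mul0r ?normr0 ?d0; lra.
Qed.

(** The term [x 0] is an integer, so it disappears in the solenoid when [cnt]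
    is shifted by the same amount. *)
Lemma rho_shift x : covered x ->
  rho (fun n => x (n + 1)) = rho x + theta - (x 0)%:R.
Proof.
move=> cx; have cs := covered_shift 1 cx.
apply/eqP; rewrite -subr_eq0 -normr_le0; apply/ler_addgt0Pl => e e0; rewrite addr0.
have [K KP] := tail_small a_gt1 d_gt0 d_le_a da_small (divr_gt0 e0 (ltr0n R 4)).
have tK := KP K (leqnn K); have tm := tail_mono R a_gt1 d_gt0 d_le_a da_small (leqnSn K).
have n1 := rho_near K.+1 cs; have n2 := rho_near K.+1 cx.
have [b [t [eo ec]]] := shift_step K.+1 cx; have le := len_eps K t.
have E : rho_level (fun n => x (n + 1)) K.+1 - (rho_level x K.+1 + theta - (x 0)%:R) =
   - (b%:R * ((len K.+1 t)%:R * theta - (mlen K.+1 t)%:R)).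
  have eo' := congr1 (fun z : int => z%:~R : R) eo; have ec' := congr1 (fun z : int => z%:~R : R) ec.
  move: eo' ec'; rewrite !(intrB, intrD) /= -!pmulrn !natrM /rho_level => -> ->.
  ring.
have le' : `|b%:R * ((len K.+1 t)%:R * theta - (mlen K.+1 t)%:R)| <= 2 * tail K.
  by case: (b); rewrite ?mul1r ?mul0r ?normr0 //; have := normr_ge0 ((len K.+1 t)%:R * theta - (mlen K.+1 t)%:R); lra.
rewrite -normrN -E in le'; move: n1 n2 le'; rewrite !ler_norml => /andP[? ?] /andP[? ?] /andP[? ?].
by apply/andP; split; lra.
Qed.

Lemma rho_base : rho (base_point a d) = 0.
Proof.
apply/eqP; rewrite -normr_le0; apply/ler_addgt0Pl => e e0; rewrite addr0.
have [K KP] := tail_small a_gt1 d_gt0 d_le_a da_small e0.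
have := rho_near K (base_covered d a_gt1); have := KP K (leqnn K).
have [eo ec] := off_base K; rewrite /rho_level eo ec mul0r subr0 subr0.
by lra.
Qed.

End RealPart.
End Address.

(** * The factor map *)

Section FactorMap.
Variables (R : realType) (ell : nat -> option nat) (o : nat -> nat).
Variables (a d om nm lev : nat -> nat).
Hypothesis o_gt0 : forall k, (0 < o k)%N.
Hypothesis a_gt1 : forall k, (1 < a k)%N.
Hypothesis d_gt0 : forall k, (0 < d k)%N.
Hypothesis d_le_a : forall k, (d k <= a k)%N.
Hypothesis da_small : forall k, (3 * (d k * d k.+1) <= a k * a k.+1)%N.
Local Notation blk := (blk a d).
Local Notation hl := (hl a d).
Local Notation hp := (hp a d).
Local Notation len := (len a d).
Local Notation nu := (nu a d).
Local Notation covered := (covered a d).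
Local Notation mlen := (mlen a d).
Local Notation ml := (ml a d).
Local Notation mp := (mp a d).
Local Notation boundary := (boundary a d).
Hypothesis om_hl : forall k, (om k %| hl k)%N.
Hypothesis om_hp : forall k, (om k %| hp k)%N.
Hypothesis nm_ml : forall k, (nm k %| ml k)%N.
Hypothesis nm_mp : forall k, (nm k %| mp k)%N.
Hypothesis om_nm : forall k, (om k * nm k)%N = covolume d k.
Hypothesis om_mono : forall j k, (j <= k)%N -> (om j %| om k)%N.
Hypothesis nm_mono : forall j k, (j <= k)%N -> (nm j %| nm k)%N.
Hypothesis nm_cofinal : forall N, (0 < N)%N -> exists K, (N %| nm K)%N.
Hypothesis lev_om : forall j, (odometer_modulus o j %| om (lev j))%N.
Hypothesis om_exact : forall k, exists j, (om k %| odometer_modulus o j)%N.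
Hypothesis sturmian : forall N, exists k, [/\ (N <= k)%N, d k = 1%N & (30 <= a k)%N].

Local Notation M := (adelic_nilmanifold R ell).
Local Notation O := (odometer o).
Local Notation modulus := (odometer_modulus o).
Local Notation theta := (theta R a d).
Local Notation eps := (eps R a d).
Local Notation tail := (tail R a d).
Local Notation ratio := (ratio R a d).
Local Notation off := (off a d).
Local Notation cnt := (cnt a d).
Local Notation rho := (rho a d R).
Local Notation rho_level := (rho_level a d R).
Local Notation X := (block_subshift a d).

Definition alpha : M := sol ell theta (fun=> 0).
Local Notation rot := (@odometer_rotation o M alpha).

Let modulus_gt0 k : (0 < modulus k)%N.
Proof. by apply: prodn_gt0 => i; exact: o_gt0. Qed.

Let tail0 k : 0 < tail k. Proof. exact: tail_gt0. Qed.

Let clamp (x : full_shift bool) : full_shift bool :=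
  if `[< covered x >] then x else base_point a d.

Let clamp_covered x : covered (clamp x).
Proof. by rewrite /clamp; case: asboolP => // _; exact: base_covered. Qed.

Let clampE x : covered x -> clamp x = x.
Proof. by rewrite /clamp => cx; case: asboolP. Qed.

Let residue x k : 'I_(modulus k) := Ordinal (ltn_pmod (off x (lev k)) (modulus_gt0 k)).

Let residue_odometer x : covered x -> (residue x) \in odometer o.
Proof.
move=> cx; apply/mem_set => k /=.
have dk := odometer_modulus_dvd o (leqnSn k).
by rewrite modn_dvdm //; apply: (off_cong d_gt0 om_hl om_mono); rewrite ?lev_om // (dvdn_trans dk).
Qed.

Definition odo x : O := SigSub (residue_odometer (clamp_covered x)).

Lemma odo_digit x k K : covered x -> (modulus k %| om K)%N ->
  digit (odo x) k = (off x K %% modulus k)%N.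
Proof.
move=> cx kK; rewrite /digit /= clampE //.
exact: (off_cong d_gt0 om_hl om_mono).
Qed.

Definition address (x : full_shift bool) : O * M := (odo x, sol ell (rho x) (cnt x)).

Let cauchy x : covered x -> profinite_cauchy (cnt x).
Proof. exact: (cnt_cauchy d_gt0 nm_ml nm_mono nm_cofinal). Qed.

Lemma address_shift x : covered x -> address (left_shift x) = rot (address x).
Proof.
move=> cx; have cs : covered (left_shift x) := covered_shift 1 cx.
congr (_, _).
  apply: odometer_ext => k; have kK := lev_om k.
  rewrite (odo_digit cs kK) -[odometer_succ _]/(iter 1 (@odometer_succ o) _) digit_iter.
  rewrite (odo_digit cx kK) modnDml.
  have [b [t [eo _]]] := shift_step d_gt0 (lev k) cx.
  have dl : (modulus k %| b * len (lev k) t)%N.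
    by rewrite dvdn_mull // (dvdn_trans kK) // lenE dvdn_addr ?om_hl // dvdn_mull.
  have e : (off x (lev k) + 1 = off (left_shift x) (lev k) + b * len (lev k) t)%N.
    by move: eo; rewrite /left_shift; move: (b * _)%N => w; lia.
  by rewrite e -modnDmr (eqP dl) addn0.
rewrite /= /alpha sol_translate; last exact: cauchy.
apply/(sol_eqP _ _ _ (cauchy cs) (cauchy cx)); exists (- (x 0)%:Z).
  by rewrite (rho_shift a_gt1 d_gt0 R d_le_a da_small cx) intrN -pmulrn; ring.
move=> N N0; have [K NK] := nm_cofinal N0; exists K => i Ki.
have [b [t [_ ec]]] := shift_step d_gt0 i cx.
have -> : cnt (left_shift x) i - cnt x i + - (x 0)%:Z = - (b * mlen i t)%N%:Z.
  by rewrite /left_shift ec; move: (b * _)%N => w; ring.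
have ni : (N %| nm i)%N by rewrite (dvdn_trans NK) // nm_mono.
by rewrite abszN /= dvdn_mull // (dvdn_trans ni) // /mlen dvdn_addr ?nm_ml // dvdn_mull // nm_mp.
Qed.

Lemma rho_close x y k : covered x -> covered y -> off x k = off y k -> cnt x k = cnt y k ->
  `|rho y - rho x| <= 2 * tail k.
Proof.
move=> cx cy eo ec; have n1 := rho_near a_gt1 d_gt0 R d_le_a da_small k cx.
have := rho_near a_gt1 d_gt0 R d_le_a da_small k cy; rewrite /rho_level -eo -ec => n2.
by move: n1 n2; rewrite /rho_level !ler_norml => /andP[? ?] /andP[? ?]; apply/andP; split; lra.
Qed.

Lemma address_continuous : {within X, continuous address}.
Proof.
apply/subspace_continuousP => x cx U [[U1 U2] /= [/nbhs_digitP[j jP] nU2] UU].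
have [e [N [e0 N0 NP]]] := nbhs_sol (cauchy cx) nU2.
have [K1 NK1] := nm_cofinal N0.
have [K2 tK] := tail_small a_gt1 d_gt0 d_le_a da_small (divr_gt0 e0 (ltr0n R 2)).
pose K := maxn (lev j) (maxn K1 K2).
have jK : (modulus j %| om K)%N by rewrite (dvdn_trans (lev_om j)) // om_mono // leq_maxl.
have NK : (N %| nm K)%N.
  by rewrite (dvdn_trans NK1) // nm_mono // (leq_trans (leq_maxl _ K2)) // leq_maxr.
have /tK tKe : (K2 <= K)%N by rewrite (leq_trans (leq_maxr K1 _)) // leq_maxr.
apply: filterS (nbhs_agree x (len K true + radius a d K)) => y xy cy.
have [eo ec] := off_local d_gt0 cx cy xy.
apply: UU; split => /=.
  by apply: jP; rewrite (odo_digit cx jK) (odo_digit cy jK) eo.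
apply: NP; first exact: cauchy.
  by apply: le_lt_trans (rho_close cx cy eo ec) _; lra.
exists K => i Ki.
have ni : (N %| nm i)%N by rewrite (dvdn_trans NK) // nm_mono.
have c1 := cnt_cong d_gt0 nm_ml nm_mono cx ni NK.
have c2 := cnt_cong d_gt0 nm_ml nm_mono cy ni NK.
have -> : cnt y i - cnt x i = (cnt y i - cnt y K) - (cnt x i - cnt x K) by rewrite ec; ring.
by rewrite -[(_ %| _)%N]/(N%:Z %| _)%Z rpredB.
Qed.

Lemma sol_multiple (t : R) n : sol ell t (fun=> 0) *+ n = sol ell (t *+ n) (fun=> 0).
Proof.
have c0 := profinite_cauchy_cst 0.
elim: n => [|n IH].
  rewrite !mulr0n; have := sol_translate ell 0 0 c0 (R := R); rewrite addr0.
  by move=> /(congr1 (fun z => z - sol ell 0 (fun=> 0))); rewrite addrK subrr.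
by rewrite mulrSr IH sol_translate // mulrSr.
Qed.

(** The diagonal integers identify a translation of the real coordinate by an
    integer with the translation of the finite components by the same integer. *)
Lemma sol_unwind (t : R) (m : int) : sol ell t (fun=> 0) = sol ell (t - m%:~R) (fun=> m).
Proof.
apply/sol_eqP; [exact: profinite_cauchy_cst|exact: profinite_cauchy_cst|].
exists m; first by rewrite opprB addrC subrK.
by move=> N _; exists 0%N => i _; rewrite sub0r addNr.
Qed.

Lemma address_base : digit (address (base_point a d)).1 =1 (fun=> 0%N) /\
  (address (base_point a d)).2 = sol ell 0 (fun=> 0).
Proof.
split=> [k|].
  by rewrite (odo_digit (base_covered d a_gt1) (lev_om k)) (off_base _ _ _).1 ?mod0n.
rewrite /= (rho_base a_gt1 d_gt0 R d_le_a da_small); congr sol; apply: funext => k.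
by rewrite (off_base _ _ _).2.
Qed.

Lemma address_orbit n : (address (shiftz n%:Z (base_point a d))) = iter n rot (address (base_point a d)).
Proof.
elim: n => [|n IH]; first by rewrite shiftz0.
rewrite iterS -IH -address_shift; last exact: covered_shift (base_covered d a_gt1).
congr address; apply: funext => i; rewrite /left_shift /shiftz; congr base_point; lia.
Qed.

(** A multiple of [hl K], for [K] of the parity making [eps K] of the right sign,
    moves the real coordinate in small steps and leaves the others almost fixed. *)
Lemma orbit_dense (z : O * M) (U : set (O * M)) : nbhs z U ->
  exists n, U (address (shiftz n%:Z (base_point a d))).
Proof.
move=> [[U1 U2] /= [/nbhs_digitP[j jP] /sol_dense[e [N [r [e0 N0 NP]]]]] UU].
have [K1 NK1] := nm_cofinal N0.
have [K2 tK] := tail_small a_gt1 d_gt0 d_le_a da_small e0.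
(* the summand [g < 0] of [K] gives [eps K] the sign of [g] *)
pose n0 := digit z.1 j; pose g := r - n0%:R * theta.
pose K := (2 * maxn (lev j) (maxn K1 K2) + (g < 0)%R)%N.
have KK : (maxn (lev j) (maxn K1 K2) <= K)%N by rewrite /K; lia.
have jK : (modulus j %| om K)%N.
  by rewrite (dvdn_trans (lev_om j)) // om_mono // (leq_trans _ KK) // leq_maxl.
have NK : (N %| nm K)%N.
  by rewrite (dvdn_trans NK1) // nm_mono // (leq_trans _ KK) // (leq_trans (leq_maxl _ K2)) // leq_maxr.
have tKe : tail K < e.
  by apply: tK; rewrite (leq_trans _ KK) // (leq_trans (leq_maxr K1 _)) // leq_maxr.
have sK : (-1) ^+ K = (if g < 0 then -1 else 1) :> R.
  by rewrite /K exprD exprM sqrrN !expr1n mul1r; case: (g < 0).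
have /andP[ek _] := eps_bound R a d_gt0 K; rewrite sK in ek.
have ke := le_lt_trans (eps_le_tail R a_gt1 d_gt0 d_le_a da_small K) tKe.
have gE : 0 <= g / eps K.
  move: ek; case: (ltP g 0) => g0 ek0.
    have em : eps K <= 0 by lra.
    by apply: mulr_le0; rewrite ?invr_le0 // ltW.
  by apply: divr_ge0; lra.
have [c cg] : exists c : nat, c%:R <= g / eps K < c%:R + 1.
  by exists (Num.trunc (g / eps K)); rewrite natr1; exact: truncn_itv.
exists (n0 + c * hl K)%N; apply: UU; split => /=.
  apply: jP; rewrite -[odo _]/(address _).1 address_orbit iter_rotation digit_iter (address_base.1 j).
  have dc : (modulus j %| c * hl K)%N by rewrite dvdn_mull // (dvdn_trans jK).
  by rewrite add0n -modnDmr (eqP dc) addn0 modn_small // ltn_ord.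
have e2 n : (address (shiftz n%:Z (base_point a d))).2 = (address (base_point a d)).2 + alpha *+ n.
  by rewrite address_orbit iter_rotation.
rewrite -[sol _ _ _]/(address _).2 e2 address_base.2 sol_multiple.
rewrite sol_translate; last exact: profinite_cauchy_cst.
rewrite add0r (sol_unwind _ (c * ml K)%N%:Z); apply: NP; last first.
  by rewrite /= dvdn_mull // (dvdn_trans NK).
have -> : theta *+ (n0 + c * hl K) - (c * ml K)%N%:Z%:~R - r = - ((g / eps K - c%:R) * eps K).
  have e1 : g / eps K * eps K = g by rewrite divfK // eps_neq0.
  rewrite mulrBl e1 /g /eps -[theta *+ _]mulr_natr natrD natrM -pmulrn natrM; ring.
rewrite normrN normrM; apply: le_lt_trans ke; rewrite ler_piMl //.
by rewrite ger0_norm; lra.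
Qed.

Let X_compact : compact X.
Proof.
by apply: subclosed_compact (@full_shift_compact bool) _ => //; exact: (block_subshift_subshift a d).1.
Qed.

(** The image is compact, hence closed, and contains the dense orbit of the
    base point. *)
Lemma address_onto : address @` X = [set: O * M].
Proof.
have cl : closed (address @` X).
  apply: compact_closed; last exact: continuous_compact address_continuous X_compact.
  by apply: hausdorff_prod; [exact: odometer_hausdorff|exact: solenoid_hausdorff].
rewrite eqEsubset; split=> // z _; apply: cl => U /orbit_dense[n Un].
exists (address (shiftz n%:Z (base_point a d))); split=> //.
by exists (shiftz n%:Z (base_point a d)) => //; exact: covered_shift (base_covered d a_gt1).
Qed.

Lemma address_factor : factor_map X (@left_shift bool) rot address.
Proof. by split; [exact: address_continuous|exact: address_onto|exact: address_shift]. Qed.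

Lemma rot_equicontinuous : equicontinuous_system rot.
Proof.
apply: rotation_equicontinuous; rewrite -address_onto.
exact: continuous_compact address_continuous X_compact.
Qed.


(** The difference of the offsets is a multiple of [om k] and that of the
    counts, corrected by the integer [q] of [sol_eqP], a multiple of [nm k];
    since [om k * nm k] is the covolume, the pair lies in the lattice of the
    two blocks. Its coordinate [c'] is a determinant divided by the covolume:
    the vector is at distance at most [2 * tail k] from the line of slope
    [theta] and has bounded length. *)
Lemma lattice_coordinates k x y : covered x -> covered y -> address x = address y ->
  exists (c c' : int), [/\ (off x k)%:Z - (off y k)%:Z = c * (hl k)%:Z + c' * (hp k)%:Z &
    `|c'| <= 13].
Proof.
move=> cx cy axy; have eo : odo x = odo y := congr1 fst axy.
have es : sol ell (rho x) (cnt x) = sol ell (rho y) (cnt y) := congr1 snd axy.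
have [q qE qN] := (sol_eqP _ _ _ (cauchy cx) (cauchy cy)).1 es; clear es axy.
have covE : (covolume d k)%:Z = (om k)%:Z * (nm k)%:Z by rewrite -om_nm.
have cov0 := covolume_gt0 d_gt0 k.
have [om0 nm0] : (0 < om k)%N /\ (0 < nm k)%N by apply/andP; rewrite -muln_gt0 om_nm.
have dO : ((om k)%:Z %| ((off x k)%:Z - (off y k)%:Z)%R)%Z.
  have [j kj] := om_exact k; have jl := lev_om j.
  have := congr1 (fun z => digit z j) eo; rewrite (odo_digit cx jl) (odo_digit cy jl) => ej.
  have jo : (om k %| om (lev j))%N by rewrite (dvdn_trans kj).
  have cX := off_cong d_gt0 om_hl om_mono cx (dvdnn (om k)) jo.
  have cY := off_cong d_gt0 om_hl om_mono cy (dvdnn (om k)) jo.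
  have : off x k = off y k %[mod om k].
    by rewrite cX cY -(modn_dvdm _ kj) ej modn_dvdm.
  by rewrite -eqz_mod_dvd !modz_nat => ->.
clear eo.
pose m := cnt x k - cnt y k + q.
have dN : ((nm k)%:Z %| m)%Z.
  have [K0 K0P] := qN (nm k) nm0; pose i := maxn k K0.
  have nk : (nm k %| nm i)%N by rewrite nm_mono // leq_maxl.
  have c1 : ((nm k)%:Z %| (cnt x i - cnt x k)%R)%Z := cnt_cong d_gt0 nm_ml nm_mono cx nk (dvdnn _).
  have c2 : ((nm k)%:Z %| (cnt y i - cnt y k)%R)%Z := cnt_cong d_gt0 nm_ml nm_mono cy nk (dvdnn _).
  have c3 : ((nm k)%:Z %| (cnt x i - cnt y i + q)%R)%Z := K0P i (leq_maxr _ _).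
  have -> : m = (cnt x i - cnt y i + q) - (cnt x i - cnt x k) + (cnt y i - cnt y k) by rewrite /m; ring.
  by apply: rpredD c2; apply: rpredB c3 c1.
pose D := (off x k)%:Z - (off y k)%:Z.
have [D1 DE] := dvdzP dO; have [m1 mE] := dvdzP dN.
have /dvdnP[h1 hE] := om_hl k; have /dvdnP[h2 h'E] := om_hp k.
have /dvdnP[l1 lE] := nm_ml k; have /dvdnP[l2 l'E] := nm_mp k.
(* Cramer's rule, in the coordinates of the lattice [om k Z x nm k Z] *)
pose s : int := (-1) ^+ k; have ss : s * s = 1 by rewrite /s -expr2 sqrr_sign.
have det1 : h1%:Z * l2%:Z - l1%:Z * h2%:Z = s.
  have := det_heights a d k; rewrite hE lE h'E l'E covE !PoszM -/s.
  have uv : (om k)%:Z * (nm k)%:Z != 0 by rewrite mulf_neq0 // -lt0n.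
  by move=> e; apply: (mulfI uv); rewrite [RHS]mulrC -e; ring.
pose c' := s * (h1%:Z * m1 - l1%:Z * D1).
exists (s * (D1 * l2%:Z - m1 * h2%:Z)), c'; split.
  transitivity (s * (h1%:Z * l2%:Z - l1%:Z * h2%:Z) * (D1 * (om k)%:Z)).
    by rewrite det1 ss mul1r.
  by rewrite hE h'E !PoszM /c'; ring.
have cW : c' * (covolume d k)%:Z = s * ((hl k)%:Z * m - (ml k)%:Z * D).
  by rewrite covE /c' mE /D DE hE lE !PoszM; ring.
pose h : R := (hl k)%:R; pose W : R := (covolume d k)%:R.
have h0 : 0 < h by rewrite ltr0n hl_gt0.
have W0 : 0 < W by rewrite ltr0n.
pose kap : R := D%:~R * theta - m%:~R.
have kapB : `|kap| <= 12 * (W / h).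
  have n1 := rho_near a_gt1 d_gt0 R d_le_a da_small k cx.
  have n2 := rho_near a_gt1 d_gt0 R d_le_a da_small k cy.
  have tr := tail_le_ratio R a_gt1 d_gt0 d_le_a k.
  have kE : kap = (rho x - rho_level y k) - (rho x - rho_level x k) - q%:~R.
    by rewrite /kap /D /m /rho_level !(intrB, intrD) -!pmulrn; ring.
  have {}kE : kap = (rho y - rho_level y k) - (rho x - rho_level x k) by rewrite kE -qE; ring.
  rewrite kE; move: n1 n2 tr; rewrite /ratio -/W -/h !ler_norml => /andP[? ?] /andP[? ?] ?.
  by apply/andP; split; lra.
have DB : `|D%:~R : R| <= (hl k.+1)%:R.
  have [t _ tx] := offP d_gt0 k cx; have [t' _ ty] := offP d_gt0 k cy.
  rewrite -intr_norm -[X in _ <= X]mulrz_nat ler_int.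
  have := len_le_true a d k t; have := len_le_true a d k t'; rewrite !lenE mul1n hlS /D.
  by have := hl_gt0 a d k; move: tx ty; rewrite !lenE; lia.
have eB := eps_le R a d_gt0 k; have H1 : 0 < (hl k.+1)%:R :> R by rewrite ltr0n hl_gt0.
have cR : `|c'%:~R : R| * W = `|eps k * D%:~R - h * kap|.
  have e : (c'%:~R : R) * W = (-1) ^+ k * (h * m%:~R - (ml k)%:R * D%:~R).
    have := congr1 (fun z : int => z%:~R : R) cW.
    by rewrite /s intrM intrM intrB !intrM rmorphXn rmorphN1.
  rewrite -[W in LHS](gtr0_norm W0) -normrM e normrM normrX normrN1 expr1n mul1r.
  by congr (`| _ |); rewrite /kap /eps -/h; ring.
have : `|c'%:~R : R| * W <= 13 * W.
  rewrite cR; apply: le_trans (ler_normB _ _) _; rewrite !normrM (gtr0_norm h0).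
  have b1 : `|eps k| * `|D%:~R : R| <= W.
    apply: le_trans (ler_pM _ _ eB DB) _ => //.
    by rewrite divfK // gt_eqF.
  have b2 : h * `|kap| <= 12 * W.
    by rewrite mulrC -ler_pdivlMr // -mulrA.
  by lra.
by rewrite ler_pM2r // -intr_norm -[13]/(13%:R) -[X in _ <= X]mulrz_nat ler_int.
Qed.

(** Two runs of at least 30 blocks [u_k] that are out of step by at most 14 of them
    overlap. *)
Lemma common_block k x y (p p' : nat) (e : int) : covered x -> covered y ->
  d k = 1%N -> (30 <= a k)%N -> boundary x k.+1 (- p%:Z) -> boundary y k.+1 (- p'%:Z) ->
  p%:Z - p'%:Z = e * (hl k)%:Z -> `|e| <= 14 ->
  exists n : nat, blk x k (- (n + hl k)%N%:Z) false /\ blk y k (- (n + hl k)%N%:Z) false.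
Proof.
move=> cx cy d1 a30 bx by_ pe e14.
have [c cE] : exists c : nat, c%:Z = 14 - e by exists (absz (14 - e)); lia.
have b1 := boundary_left d_gt0 cx bx (c := 14%N); have b2 := boundary_left d_gt0 cy by_ (c := c).
(* the block number 14 of the preceding [u_(k+1)] in [x] is the block number
   [14 - e] in [y] *)
exists (p + hl k.+1 - 15 * hl k)%N.
have H := hl_gt0 a d k; have hS : (31 * hl k <= hl k.+1)%N by rewrite hlS; nia.
have E1 : - (p + hl k.+1 - 15 * hl k + hl k)%N%:Z = - p%:Z - (hl k.+1)%:Z + (14 * hl k)%N%:Z.
  by move: hS; generalize (hl k.+1) => w; lia.
have E2 : - p%:Z - (hl k.+1)%:Z + (14 * hl k)%N%:Z = - p'%:Z - (hl k.+1)%:Z + (c * hl k)%N%:Z.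
  by rewrite !PoszM cE mulrBl -pe; generalize (hl k.+1) => w; lia.
split; first by rewrite E1; move: b1; rewrite (_ : (14 == a k)%N = false); [apply; lia|lia].
by rewrite E1 E2; move: b2; rewrite (_ : (c == a k)%N = false); [apply; lia|lia].
Qed.

(** As [d k = 1], the excess of [v_(k+1)] over [u_(k+1)] is the length of
    [u_k], so the offsets differ by [c] blocks [u_(k+1)] and a few blocks
    [u_k]. The bound on the offsets leaves only -1, 0 and 1 for [c], and going
    back one block of level [k.+1] reduces to [c = 0]. *)
Lemma address_fiber_block k x y : covered x -> covered y -> address x = address y ->
  d k = 1%N -> (30 <= a k)%N ->
  exists n : nat, blk x k (- (n + hl k)%N%:Z) false /\ blk y k (- (n + hl k)%N%:Z) false.
Proof.
move=> cx cy axy d1 a30; have [c [c' [DE c13]]] := lattice_coordinates k.+1 cx cy axy.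
clear axy.
wlog c0 : x y cx cy c c' DE c13 / 0 <= c.
  move=> W; have [c0|c0] := leP 0 c; first exact: (W x y cx cy c c').
  have [| | |n [b1 b2]] := W y x cy cx (- c) (- c'); last by exists n.
  - by rewrite -[LHS]opprB DE; ring.
  - by rewrite normrN.
  - by lia.
have [t bx lx] := offP d_gt0 k.+1 cx; have [t' b'y ly] := offP d_gt0 k.+1 cy.
have hpE : hp k.+1 = hl k by rewrite hpS d1 mul1n.
have H := hl_gt0 a d k; have hS : (31 * hl k <= hl k.+1)%N by rewrite hlS; nia.
have [c_0|c_1] : c = 0 \/ c = 1.
  have le1 := len_le_true a d k.+1 t; move: lx le1; rewrite (lenE _ _ _ true) mul1n hpE => lx le1.
  move: DE; rewrite hpE => DE.
  suff : ~ (2 <= c) by lia.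
  move=> c2; have : 2 * (hl k.+1)%:Z <= c * (hl k.+1)%:Z by rewrite ler_wpM2r.
  have : - 13 * (hl k)%:Z <= c' * (hl k)%:Z by rewrite ler_wpM2r //; lia.
  by move: DE; generalize (c * (hl k.+1)%:Z) (c' * (hl k)%:Z) => u v; lia.
- apply: (common_block (p := off x k.+1) (p' := off y k.+1) (e := c')) => //.
  + by exists t.
  + by exists t'.
  + by rewrite DE c_0 mul0r add0r hpE.
  + by lia.
have [|s bs] := prev_block d_gt0 cy (k := k.+1) (i := - (off y k.+1)%:Z); first by exists t'.
apply: (common_block (p := off x k.+1) (p' := (off y k.+1 + len k.+1 s)%N) (e := c' - s%:Z)) => //.
+ by exists t.
+ by exists s; rewrite PoszD opprD.
+ by rewrite PoszD opprD addrA DE c_1 lenE hpE; move: (hl k.+1) => w; case: (s); lia.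
+ by case: (s); lia.
Qed.

(** Points with the same address share arbitrarily long blocks in their past,
    and the criterion applies. *)
Lemma block_mef : has_maximal_equicontinuous_factor X (@left_shift bool) rot.
Proof.
apply: (maximal_equicontinuous_factor_criterion (block_subshift_subshift a d)
  rot_equicontinuous address_factor) => x y cx cy axy N.
have [k [Nk d1 a30]] := sturmian (2 * N)%N.
have [n [bx by_]] := address_fiber_block cx cy axy d1 a30; clear axy.
have hk := hl_gt d a_gt1 k.
exists (n + hl k - N)%N => i iN; rewrite /shiftz.
have [j [jl ->]] : exists j : nat, (j < len k false)%N /\
    i - (n + hl k - N)%N%:Z = - (n + hl k)%N%:Z + j%:Z.
  by exists `|(i + N%:Z)%R|%N; rewrite lenE mul0n addn0; split; lia.
exact: same_letters bx by_ j jl.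
Qed.

End FactorMap.

(** * Choice of the block lengths *)

(** Two Sturmian steps prepare a pair of coprime numbers for a step of ratio [D]: the
    first one makes the leading coordinate a unit modulo [D], the second one then
    reaches any residue. *)
Lemma prepare_residue (x y D Q B : nat) : (0 < D)%N -> coprime x y -> coprime Q D ->
  exists A : nat * nat, [/\ (B <= A.1)%N, (B <= A.2)%N &
    (D %| Q * (A.2 * (A.1 * x + y) + x) + (A.1 * x + y))%N].
Proof.
move=> D0 xy QD; pose pi : nat_pred := [pred p : nat | ~~ (p %| y)%N].
pose A1 := (D`_pi + B * D)%N; pose f := (A1 * x + y)%N.
have fD : coprime f D.
  rewrite /coprime; apply: contraT => g1.
  have g0 : (0 < gcdn f D)%N by rewrite gcdn_gt0 D0 orbT.
  have {}g1 : (1 < gcdn f D)%N by move: g1 g0; case: (gcdn f D) => [|[|]].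
  pose p := pdiv (gcdn f D); have pp : prime p by exact: pdiv_prime.
  have pf : (p %| f)%N := dvdn_trans (pdiv_dvd _) (dvdn_gcdl _ _).
  have pD : (p %| D)%N := dvdn_trans (pdiv_dvd _) (dvdn_gcdr _ _).
  have pA : (p %| A1)%N = (p %| D`_pi)%N by rewrite /A1 dvdn_addl // dvdn_mull.
  have [py|py] := boolP (p %| y)%N.
    have : (p %| A1 * x)%N by rewrite -(dvdn_addl _ py).
    rewrite Euclid_dvdM // pA => /orP[pP|px].
      by have := pnatP pi (part_gt0 pi D) (part_pnat pi D) p pp pP; rewrite inE py.
    have : (p %| gcdn x y)%N by rewrite dvdn_gcd px py.
    by rewrite (eqP xy) dvdn1 => /eqP p1; rewrite p1 in pp.
  have pP : (p %| D`_pi)%N.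
    have := partn_dvd pi D0 pD; rewrite part_pnat_id // pnatE //.
  by move: pf; rewrite /f dvdn_addr ?(negPf py) // dvdn_mulr // pA.
have /eqP u1 : coprime D (Q * f) by rewrite coprimeMr !(coprime_sym D) QD.
have [c _ cP] := Bezoutl (Q * f) D0; rewrite u1 in cP.
exists (A1, c * (Q * x + f) + B * D)%N; split => /=.
- by rewrite /A1 (leq_trans _ (leq_addl _ _)) // leq_pmulr.
- by rewrite (leq_trans _ (leq_addl _ _)) // leq_pmulr.
rewrite -/f.
have -> : (Q * ((c * (Q * x + f) + B * D) * f + x) + f =
  (Q * x + f) * (1 + c * (Q * f)) + D * (B * Q * f))%N by ring.
by apply: dvdn_add; [exact: dvdn_mull|exact: dvdn_mulr].
Qed.

Section Stages.
Variables o w : nat -> nat.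
Hypothesis o_gt0 : forall k, (0 < o k)%N.
Hypothesis w_gt : forall j, (j.+1 < w j)%N.

(** The stages alternate: even stages refine the lattice in the direction of
    lengths by the factors [o] of the odometer, odd stages refine it in the
    direction of counts by the squares of all integers. For [stage_q], one
    more than the number of [u] in the shorter block, squares allow a residue
    1 modulo the prime factors of [stage_d] without fixing its residue modulo
    [stage_d], which leaves the ratio of the two free. *)
Definition stage_d i := if odd i then (i./2.+1 ^ 2)%N else o i./2.
Definition stage_q i := if odd i then (i./2.+1 * w i./2).+1 else (o i./2 * (i + 30)).+1.

Lemma stage_d_gt0 i : (0 < stage_d i)%N.
Proof. by rewrite /stage_d; case: odd. Qed.

Lemma stage_coprime i : coprime (stage_q i) (stage_d i).
Proof.
rewrite /stage_q /stage_d; case: odd; first rewrite coprime_pexpr //.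
all: by rewrite -addn1 mulnC /coprime gcdnC gcdnMDl gcdn1.
Qed.

Lemma stage_q_gt i : (1 < (stage_q i).-1)%N && (stage_d i <= (stage_q i).-1)%N.
Proof.
rewrite /stage_q /stage_d; case: odd => /=.
  by have := w_gt i./2; generalize (w i./2) (i./2) => v j; nia.
by have := o_gt0 i./2; nia.
Qed.

(** The factors collected before stage [i] in the direction of counts;
    [even_part] is the analogue for lengths. *)
Definition odd_part i := (\prod_(j < i) if odd j then stage_d j else 1)%N.
Definition even_part i := (\prod_(j < i) if odd j then 1 else stage_d j)%N.

Lemma odd_partS i : odd_part i.+1 = (odd_part i * if odd i then stage_d i else 1)%N.
Proof. by rewrite /odd_part big_ord_recr. Qed.
Lemma even_partS i : even_part i.+1 = (even_part i * if odd i then 1 else stage_d i)%N.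
Proof. by rewrite /even_part big_ord_recr. Qed.

Let odd_part_gt0 i : (0 < odd_part i)%N.
Proof. by apply: prodn_gt0 => j; case: odd => //; exact: stage_d_gt0. Qed.
Let even_part_gt0 i : (0 < even_part i)%N.
Proof. by apply: prodn_gt0 => j; case: odd => //; exact: stage_d_gt0. Qed.

Lemma even_part_modulus j : even_part (j * 2) = odometer_modulus o j.
Proof.
elim: j => [|j IH]; first by rewrite /even_part /odometer_modulus !big_ord0.
have -> : (j.+1 * 2 = (j * 2).+2)%N by [].
rewrite !even_partS IH /= /stage_d muln2 odd_double /= muln1 half_double.
by rewrite /odometer_modulus big_ord_recr.
Qed.

(** Coordinates, at the beginning of a stage, of the two blocks in the direction
    that the stage refines. *)
Definition coordinates (i : nat) (s : (nat * nat) * (nat * nat)) : nat * nat :=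
  if odd i then (s.2.1 %/ odd_part i, s.2.2 %/ odd_part i)%N
  else (s.1.1 %/ even_part i, s.1.2 %/ even_part i)%N.

Definition level_step (A d : nat) (v : nat * nat) : nat * nat :=
  (A * v.1 + v.2, d * v.1)%N.

Definition stage_step (i : nat) (A : nat * nat) (v : nat * nat) : nat * nat :=
  level_step (stage_q i) (stage_d i) (level_step A.2 1 (level_step A.1 1 v)).

Lemma stage_step_dvd u i A v : (u %| v.1)%N -> (u %| v.2)%N ->
  (u %| (stage_step i A v).1)%N && (u %| (stage_step i A v).2)%N.
Proof.
have H B e z : (u %| z.1)%N && (u %| z.2)%N ->
    (u %| (level_step B e z).1)%N && (u %| (level_step B e z).2)%N.
  by move=> /andP[z1 z2]; rewrite /= dvdn_add ?dvdn_mull.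
by move=> v1 v2; apply: (H _ _ _ (H _ _ _ (H _ _ _ _))); rewrite v1.
Qed.

(** The second new vector is a multiple of [stage_d i], so only the first one
    imposes a condition, which is the one achieved by [prepare_residue]. *)
Lemma stage_step_refine u i A v : (0 < u)%N -> (u %| v.1)%N -> (u %| v.2)%N ->
  (stage_d i %| stage_q i * (A.2 * (A.1 * (v.1 %/ u) + v.2 %/ u) + v.1 %/ u) +
    (A.1 * (v.1 %/ u) + v.2 %/ u))%N ->
  (u * stage_d i %| (stage_step i A v).1)%N && (u * stage_d i %| (stage_step i A v).2)%N.
Proof.
move=> u0 /dvdnP[x xE] /dvdnP[y yE]; case: v xE yE => h h' /= -> ->; rewrite !mulnK // => D.
rewrite /stage_step /level_step /=; apply/andP; split.
  have -> : (stage_q i * (A.2 * (A.1 * (x * u) + y * u) + 1 * (x * u)) + 1 * (A.1 * (x * u) + y * u) =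
    u * (stage_q i * (A.2 * (A.1 * x + y) + x) + (A.1 * x + y)))%N by ring.
  by rewrite dvdn_pmul2l.
have -> : (stage_d i * (A.2 * (A.1 * (x * u) + y * u) + 1 * (x * u)) =
  u * stage_d i * (A.2 * (A.1 * x + y) + x))%N by ring.
exact: dvdn_mulr.
Qed.

(** The number of blocks at the two Sturmian levels of a stage depends on the
    residues of the lengths reached so far, so the stages are constructed one
    after the other. Coprimality of the coordinates follows from the
    determinant of the two vectors, which is the covolume up to sign. *)
Lemma exists_levels : exists (a d : nat -> nat),
  [/\ forall i, [/\ d (i * 3) = 1, d (i * 3).+1 = 1 & d (i * 3).+2 = stage_d i]%N,
      forall i, [/\ (i + 30 <= a (i * 3))%N, (i + 30 <= a (i * 3).+1)%N &
                    a (i * 3).+2 = (stage_q i).-1] &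
      forall i, [/\ (even_part i %| hl a d (i * 3))%N, (even_part i %| hp a d (i * 3))%N,
                    (odd_part i %| ml a d (i * 3))%N & (odd_part i %| mp a d (i * 3))%N] ].
Proof.
have /choice[F FP] : forall z : nat * (nat * nat), exists A : nat * nat, coprime z.2.1 z.2.2 ->
    [/\ (z.1 + 31 <= A.1)%N, (z.1 + 31 <= A.2)%N &
    (stage_d z.1 %| stage_q z.1 * (A.2 * (A.1 * z.2.1 + z.2.2) + z.2.1) +
       (A.1 * z.2.1 + z.2.2))%N].
  move=> -[i [x y]] /=; have [xy|nxy] := boolP (coprime x y); last by exists (0, 0)%N.
  by have [A AP] := prepare_residue (i + 31) (stage_d_gt0 i) xy (stage_coprime i); exists A.
pose fix st i := if i is j.+1 then
    let A := F (j, coordinates j (st j)) in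
    (stage_step j A (st j).1, stage_step j A (st j).2)
  else ((1, 0), (0, 1))%N.
pose A i := F (i, coordinates i (st i)).
pose a k := if (k %% 3 == 0)%N then (A (k %/ 3)%N).1.-1
  else if (k %% 3 == 1)%N then (A (k %/ 3)%N).2.-1 else (stage_q (k %/ 3)).-1.
pose d k := if (k %% 3 == 2)%N then stage_d (k %/ 3) else 1%N.
have rem3 i : [/\ (i * 3 %% 3 = 0)%N, ((i * 3).+1 %% 3 = 1)%N & ((i * 3).+2 %% 3 = 2)%N].
  by split; lia.
have div3 i : [/\ (i * 3 %/ 3 = i)%N, ((i * 3).+1 %/ 3 = i)%N & ((i * 3).+2 %/ 3 = i)%N].
  by split; lia.
have dE i : [/\ d (i * 3) = 1, d (i * 3).+1 = 1 & d (i * 3).+2 = stage_d i]%N.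
  by have [r0 r1 r2] := rem3 i; have [q0 q1 q2] := div3 i; rewrite /d r0 r1 r2 q2.
have aE i : [/\ a (i * 3) = (A i).1.-1, a (i * 3).+1 = (A i).2.-1 & a (i * 3).+2 = (stage_q i).-1]%N.
  by have [r0 r1 r2] := rem3 i; have [q0 q1 q2] := div3 i; rewrite /a r0 r1 r2 q0 q1 q2.
have cov i : covolume d (i * 3) = (even_part i * odd_part i)%N.
  elim: i => [|i IH]; first by rewrite /covolume /even_part /odd_part !big_ord0.
  have -> : (i.+1 * 3 = (i * 3).+3)%N by [].
  have [d0 d1 d2] := dE i; rewrite !covolumeS IH d0 d1 d2 !muln1 even_partS odd_partS.
  by case: odd; rewrite muln1 ?mulnA // mulnAC.
have vecS x x' k : vec a d x x' k.+1 = level_step (a k).+1 (d k) (vec a d x x' k) by [].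
clearbody a d.
have inv i : [/\ st i = (vec a d 1 0 (i * 3), vec a d 0 1 (i * 3)),
    (even_part i %| hl a d (i * 3))%N && (even_part i %| hp a d (i * 3))%N,
    (odd_part i %| ml a d (i * 3))%N && (odd_part i %| mp a d (i * 3))%N & 
    coprime (coordinates i (st i)).1 (coordinates i (st i)).2].
  have cop j : st j = (vec a d 1 0 (j * 3), vec a d 0 1 (j * 3)) ->
    (even_part j %| hl a d (j * 3))%N && (even_part j %| hp a d (j * 3))%N ->
    (odd_part j %| ml a d (j * 3))%N && (odd_part j %| mp a d (j * 3))%N ->
    coprime (coordinates j (st j)).1 (coordinates j (st j)).2.
    move=> e /andP[/dvdnP[h1 h1E] /dvdnP[h2 h2E]] /andP[/dvdnP[l1 l1E] /dvdnP[l2 l2E]].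
    have := det_heights a d (j * 3); rewrite h1E h2E l1E l2E cov !PoszM => det.
    have u0 := even_part_gt0 j; have v0 := odd_part_gt0 j.
    have uv : (even_part j)%:Z * (odd_part j)%:Z != 0 by rewrite mulf_neq0 // -lt0n.
    have {}det : h1%:Z * l2%:Z - l1%:Z * h2%:Z = (-1) ^+ (j * 3).
      by apply: (mulfI uv); rewrite [RHS]mulrC -det; ring.
    have unit1 (g : nat) : (g%:Z %| (-1) ^+ (j * 3))%Z -> g = 1%N.
      by rewrite dvdzE abszX /= exp1n dvdn1 => /eqP.
    rewrite /coordinates e /= -/(hl a d (j * 3)) -/(hp a d (j * 3)) -/(ml a d (j * 3)) -/(mp a d (j * 3)).
    rewrite h1E h2E l1E l2E; case: odd => /=; rewrite !mulnK // /coprime; apply/eqP/unit1; rewrite -det.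
      have g1 : ((gcdn l1 l2)%:Z %| l1%:Z)%Z by rewrite dvdzE /= dvdn_gcdl.
      have g2 : ((gcdn l1 l2)%:Z %| l2%:Z)%Z by rewrite dvdzE /= dvdn_gcdr.
      by apply: rpredB; [exact: dvdz_mull|exact: dvdz_mulr].
    have g1 : ((gcdn h1 h2)%:Z %| h1%:Z)%Z by rewrite dvdzE /= dvdn_gcdl.
    have g2 : ((gcdn h1 h2)%:Z %| h2%:Z)%Z by rewrite dvdzE /= dvdn_gcdr.
    by apply: rpredB; [exact: dvdz_mulr|exact: dvdz_mull].
  elim: i => [|i [e hh mm xy]].
    have e0 : st 0 = (vec a d 1 0 (0 * 3), vec a d 0 1 (0 * 3)) by [].
    have h0 : (even_part 0 %| hl a d (0 * 3))%N && (even_part 0 %| hp a d (0 * 3))%N.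
      by rewrite /even_part big_ord0 !dvd1n.
    have m0 : (odd_part 0 %| ml a d (0 * 3))%N && (odd_part 0 %| mp a d (0 * 3))%N.
      by rewrite /odd_part big_ord0 !dvd1n.
    by split=> //; exact: cop.
  have [A1 A2 AD] := FP (i, coordinates i (st i)) xy; rewrite -/(A i) /= in A1 A2 AD.
  have [d0 d1 d2] := dE i; have [a0 a1 a2] := aE i.
  have vE x x' : vec a d x x' (i.+1 * 3) = stage_step i (A i) (vec a d x x' (i * 3)).
    have -> : (i.+1 * 3 = (i * 3).+3)%N by [].
    rewrite (vecS _ _ (i * 3).+2) (vecS _ _ (i * 3).+1) (vecS _ _ (i * 3)%N) d0 d1 d2 a0 a1 a2.
    have p3 : (0 < stage_q i)%N by rewrite /stage_q; case: odd.
    have p1 : (0 < (A i).1)%N by apply: leq_trans A1; rewrite addnS.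
    have p2 : (0 < (A i).2)%N by apply: leq_trans A2; rewrite addnS.
    by rewrite (prednK p1) (prednK p2) (prednK p3).
  have e' : st i.+1 = (vec a d 1 0 (i.+1 * 3), vec a d 0 1 (i.+1 * 3)).
    by rewrite !vE [LHS]/= -/(A i) e.
  have hh' : (even_part i.+1 %| hl a d (i.+1 * 3))%N && (even_part i.+1 %| hp a d (i.+1 * 3))%N.
    rewrite /hl /hp vE; move: hh => /andP[h1 h2]; move: AD; rewrite even_partS /coordinates e.
    case: odd => AD; first by rewrite muln1; exact: stage_step_dvd.
    exact: stage_step_refine.
  have mm' : (odd_part i.+1 %| ml a d (i.+1 * 3))%N && (odd_part i.+1 %| mp a d (i.+1 * 3))%N.
    rewrite /ml /mp vE; move: mm => /andP[h1 h2]; move: AD; rewrite odd_partS /coordinates e.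
    case: odd => AD; last by rewrite muln1; exact: stage_step_dvd.
    exact: stage_step_refine.
  by split=> //; exact: cop.
exists a, d; split=> // i.
  have [_ _ _ xy] := inv i; have [A1 A2 _] := FP (i, coordinates i (st i)) xy.
  rewrite -/(A i) /= in A1 A2; have [-> -> ->] := aE i; split=> //; lia.
by have [_ /andP[? ?] /andP[? ?] _] := inv i.
Qed.
End Stages.

(** * Growth of the complexity *)

Section ComplexityRatio.
Variables (R : realType) (a d : nat -> nat) (delta : R).
Hypothesis a_gt1 : forall k, (1 < a k)%N.
Hypothesis d_gt0 : forall k, (0 < d k)%N.
Hypothesis d_le_a : forall k, (d k <= a k)%N.
Hypothesis a_infty : forall B, exists K, forall k, (K <= k)%N -> (B <= a k)%N.
Hypothesis delta01 : 0 <= delta < 1.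
Hypothesis density_le : forall e : R, 0 < e -> exists K, forall k, (K <= k)%N ->
  (d k)%:R <= (delta + e) * (a k + d k)%:R.
Hypothesis density_ge : forall (e : R) K, 0 < e -> exists2 k, (K <= k)%N &
  (delta - e) * (a k + d k)%:R <= (d k)%:R.
Local Notation hl := (hl a d).
Local Notation low := (low a d).
Local Notation high := (high a d).
Local Notation p := (complexity (block_subshift a d)).

Let low_ge k : (a k * hl k <= low k)%N.
Proof. by rewrite /low; lia. Qed.

Let low_gt k : (k < low k)%N.
Proof.
have := low_ge k; have := hl_gt d a_gt1 k; have := a_gt1 k.
by move: (hl k) (low k) => h l; nia.
Qed.

(** For [low k < q <= low k.+1] the excess of the complexity over [q] is at
    most [3 * hl k], which is negligible as [q >= a k * hl k], plus [t] with
    [t / q <= d k / (a k + d k)]. *)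
Lemma complexity_ratio_le (e : R) : 0 < e -> exists Q, forall q, (Q <= q)%N ->
  (p q)%:R / q%:R <= 1 + delta + e.
Proof.
move=> e0; have [K1 K1P] := density_le (divr_gt0 e0 (ltr0n R 2)).
have [B BP] : exists B : nat, 6 / e < B%:R by exists (Num.trunc (6 / e)).+1; exact: truncnS_gt.
have [K2 K2P] := a_infty B; pose K := maxn K1 K2.
exists (low K).+1 => q Kq.
have ex : exists k, (q <= low k.+1)%N && (K <= k)%N.
  exists (maxn q K); rewrite leq_maxr andbT (leq_trans _ (ltnW (low_gt _))) //.
  by rewrite (leq_trans (leq_maxl q K)).
case: (ex_minnP ex) => k /andP[qk Kk] kmin.
have lq : (low k < q)%N.
  move: Kk; rewrite leq_eqVlt => /predU1P[<- //|Kk].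
  rewrite ltnNge; apply/negP => ql; case: k qk Kk ql kmin => // k qk Kk ql kmin.
  by have := kmin k; rewrite ql /= -ltnS Kk ltnn => /(_ isT).
have h0 := hl_gt0 a d k; have lg := low_ge k.
have le := complexity_le a_gt1 d_gt0 d_le_a qk; move: le.
set t := minn _ _ => le.
have td : (t * (a k + d k) <= q * d k)%N.
  have t1 : (t <= q - low k)%N by exact: geq_minl.
  have t2 : (t <= d k * hl k)%N by rewrite (leq_trans (geq_minr _ _)) // leq_mul2r leq_subr orbT.
  have t3 : (t + a k * hl k <= q)%N by lia.
  have t4 : (t * a k <= d k * hl k * a k)%N by rewrite leq_mul2r t2 orbT.
  have t5 : ((t + a k * hl k) * d k <= q * d k)%N by rewrite leq_mul2r t3 orbT.
  by apply: leq_trans t5; rewrite mulnDr mulnDl addnC leq_add2l (leq_trans t4) // mulnC mulnA mulnAC.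
have q0 : 0 < q%:R :> R by rewrite ltr0n; lia.
have ad0 : 0 < (a k + d k)%:R :> R by rewrite ltr0n; have := d_gt0 k; lia.
have tR : t%:R <= (delta + e / 2) * q%:R :> R.
  have Kk1 := K1P k (leq_trans (leq_maxl _ _) Kk).
  rewrite -(ler_pM2r ad0) -natrM (@le_trans _ _ ((q * d k)%:R)) ?ler_nat //.
  by rewrite natrM mulrC mulrAC ler_pM2r.
have hR : 3 * (hl k)%:R <= e / 2 * q%:R :> R.
  have Ba : B%:R <= (a k)%:R :> R by rewrite ler_nat; exact: K2P (leq_trans (leq_maxr _ _) Kk).
  have hq : (a k)%:R * (hl k)%:R <= q%:R :> R by rewrite -natrM ler_nat; lia.
  have b1 : 6 < e * (a k)%:R.
    by rewrite mulrC -ltr_pdivrMr // (lt_le_trans BP).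
  have hpos : 0 < (hl k)%:R :> R by rewrite ltr0n.
  have b2 : 6 * (hl k)%:R <= e * (a k)%:R * (hl k)%:R by rewrite ler_pM2r // ltW.
  have b3 : e * ((a k)%:R * (hl k)%:R) <= e * q%:R by rewrite ler_pM2l.
  by lra.
have pR : (p q)%:R <= q%:R + 3 * (hl k)%:R + t%:R :> R.
  have le2 : (p q <= q + 3 * hl k + t)%N by lia.
  by rewrite -natrM -!natrD ler_nat.
by rewrite ler_pdivrMr //; lra.
Qed.

(** At the end of the exceptional interval of level [k] the excess over [q] is
    [(d k - 1) * hl k], while [q] is about [(a k + d k) * hl k]. *)
Lemma complexity_ratio_ge (e : R) Q : 0 < e -> exists2 q, (Q <= q)%N &
  1 + delta - e <= (p q)%:R / q%:R.
Proof.
move=> e0; have /andP[dl0 dl1] := delta01.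
have [B BP] : exists B : nat, 12 / e < B%:R by exists (Num.trunc (12 / e)).+1; exact: truncnS_gt.
have [K2 K2P] := a_infty B.
have [k Kk kP] := density_ge (maxn K2 Q) (divr_gt0 e0 (ltr0n R 2)).
have Ba : B%:R <= (a k)%:R :> R by rewrite ler_nat; exact: K2P (leq_trans (leq_maxl _ _) Kk).
have hE := highE a d_gt0 k; have hle := high_le d a_gt1 k; have lk := low_gt k.
exists (high k).+1; first by rewrite (leq_trans (leq_maxr K2 Q)) // (leq_trans Kk) // hE leqW // (leq_trans (ltnW lk)) // leq_addr.
have q0 : 0 < ((high k).+1)%:R :> R by rewrite ltr0n.
have lq : (low k < (high k).+1 <= (high k).+1)%N by rewrite leqnn andbT hE ltnS leq_addr.
have pg := complexity_high a_gt1 d_gt0 lq.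
have pR : ((high k).+1)%:R + (d k - 1)%:R * (hl k)%:R <= (p (high k).+1)%:R :> R.
  rewrite -natrM -natrD ler_nat (leq_trans _ pg) // leq_add2l hE.
  by move: ((d k - 1) * hl k)%N => w; lia.
have h1 : 1 <= (hl k)%:R :> R by rewrite ler1n hl_gt0.
have qR : ((high k).+1)%:R <= ((a k + d k)%:R + 5) * (hl k)%:R :> R.
  rewrite -natrD -natrM ler_nat; have := hl_gt0 a d k.
  by move: hle; move: (hl k) (high k) => h H; nia.
have dR : (d k - 1)%:R = (d k)%:R - 1 :> R by rewrite natrB.
have b1 : 12 < e * (a k)%:R by rewrite mulrC -ltr_pdivrMr // (lt_le_trans BP).
have d0 : 0 <= (d k)%:R :> R by [].
rewrite ler_pdivlMr //.
have [neg|pos] := leP (delta - e) 0.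
  apply: le_trans pR; apply: (@le_trans _ _ (1 * ((high k).+1)%:R)).
    by rewrite ler_pM2r //; lra.
  by rewrite mul1r lerDl mulr_ge0.
have b2 : (delta - e) * ((high k).+1)%:R <= (delta - e) * (((a k + d k)%:R + 5) * (hl k)%:R).
  by rewrite ler_pM2l.
have b3 : (delta - e) * ((a k + d k)%:R + 5) <= (d k)%:R - 1.
  have : 0 <= e * (d k)%:R by rewrite mulr_ge0 // ltW.
  by move: kP; rewrite natrD => kP1 ?; lra.
have b4 : (delta - e) * ((a k + d k)%:R + 5) * (hl k)%:R <= ((d k)%:R - 1) * (hl k)%:R.
  by rewrite ler_pM2r //; lra.
by move: pR; rewrite dR; lra.
Qed.

Lemma complexity_limsup :
  limn_esup (fun q => ((p q)%:R / q%:R)%:E) = (1 + delta)%:E :> \bar R.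
Proof.
apply/eqP; rewrite eq_le; apply/andP; split.
  apply/lee_addgt0Pr => e e0; have [Q QP] := complexity_ratio_le e0.
  apply: (@le_trans _ _ (ereal_sup [set ((p q)%:R / q%:R : R)%:E | q in [set q | (Q <= q)%N]])).
    by apply: ereal_inf_lbound; exists [set q | (Q <= q)%N] => //; exists Q.
  by apply: ge_ereal_sup => _ [q Qq <-]; rewrite -EFinD lee_fin; exact: QP.
apply: le_ereal_inf_tmp => _ [V [Q _ QV] <-].
apply/lee_subgt0Pr => e e0; have [q Qq qP] := complexity_ratio_ge Q e0.
apply: (@le_trans _ _ ((p q)%:R / q%:R : R)%:E); first by rewrite -EFinB lee_fin.
by apply: ereal_sup_ubound; exists q => //; exact: QV.
Qed.

Lemma complexity_lim : delta = 0 -> ((p q)%:R / q%:R : R) @[q --> \oo] --> (1 : R).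
Proof.
move=> dl0; apply/cvgrPdist_le => e e0; have [Q QP] := complexity_ratio_le e0.
near=> q; have q0 : (0 < q)%N by near: q; exists 1%N.
have Qq : (Q <= q)%N by near: q; exists Q.
have := QP q Qq; rewrite dl0 addr0 => up.
have lo : 1 <= (p q)%:R / q%:R :> R.
  by rewrite ler_pdivlMr ?ltr0n // mul1r ler_nat ltnW // complexity_ge.
by rewrite ler_norml; apply/andP; split; lra.
Unshelve. all: by end_near. Qed.

End ComplexityRatio.

(** * Block lengths with prescribed factor and complexity *)

Section StageFacts.
Variables (R : realType) (o w : nat -> nat) (a d : nat -> nat).
Hypothesis o_gt0 : forall k, (0 < o k)%N.
Hypothesis w_gt : forall j, (j.+1 < w j)%N.
Local Notation stage_d := (stage_d o).
Local Notation stage_q := (stage_q o w).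
Local Notation even_part := (even_part o).
Local Notation odd_part := (odd_part o).
Hypothesis dE : forall i, [/\ d (i * 3) = 1, d (i * 3).+1 = 1 & d (i * 3).+2 = stage_d i]%N.
Hypothesis aE : forall i, [/\ (i + 30 <= a (i * 3))%N, (i + 30 <= a (i * 3).+1)%N &
                    a (i * 3).+2 = (stage_q i).-1].
Hypothesis dvdE : forall i,
  [/\ (even_part i %| hl a d (i * 3))%N, (even_part i %| hp a d (i * 3))%N,
      (odd_part i %| ml a d (i * 3))%N & (odd_part i %| mp a d (i * 3))%N].

Lemma stage_ind (P : nat -> Prop) : (forall i, [/\ P (i * 3)%N, P (i * 3).+1 & P (i * 3).+2]) ->
  forall k, P k.
Proof.
move=> H k; have [P0 P1 P2] := H (k %/ 3)%N; rewrite (divn_eq k 3).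
have := ltn_pmod k (isT : (0 < 3)%N); case: (k %% 3)%N => [|[|[|//]]] _.
- by rewrite addn0.
- by rewrite addn1.
- by rewrite addn2.
Qed.

Let div3 i : [/\ (i * 3 %/ 3 = i)%N, ((i * 3).+1 %/ 3 = i)%N & ((i * 3).+2 %/ 3 = i)%N].
Proof. by split; lia. Qed.

Definition om k := even_part (k %/ 3).
Definition nm k := odd_part (k %/ 3).

Lemma levels_d_gt0 k : (0 < d k)%N.
Proof.
move: k; apply: stage_ind => i; have [-> -> ->] := dE i; split=> //.
exact: stage_d_gt0 o_gt0 i.
Qed.

Lemma levels_a_d k : [/\ (1 < a k)%N, (d k <= a k)%N & (k %/ 6 <= a k)%N].
Proof.
move: k; apply: stage_ind => i; have [-> -> ->] := dE i; have [a0 a1 ->] := aE i.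
have /andP[q1 q2] := stage_q_gt o_gt0 w_gt i.
split; [by split; lia|by split; lia|split=> //].
rewrite /stage_q; case: odd => /=.
  have le : ((i * 3).+2 %/ 6 <= i./2)%N by rewrite -divn2; lia.
  by apply: leq_trans le _; have := w_gt i./2; generalize (w i./2) (i./2) => v j; nia.
have le : ((i * 3).+2 %/ 6 <= i + 30)%N by lia.
by apply: leq_trans le _; rewrite leq_pmull.
Qed.

Lemma levels_small k : (3 * (d k * d k.+1) <= a k * a k.+1)%N.
Proof.
have H j : [/\ (1 < a j)%N, (d j <= a j)%N & (j %/ 6 <= a j)%N] := levels_a_d j.
move: k; apply: stage_ind => i; have [d0 d1 d2] := dE i; have [a0 a1 a2] := aE i.
have [d3 _ _] := dE i.+1; have [a3 _ _] := aE i.+1.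
have [_ h2 _] := H (i * 3).+2.
rewrite -[(i * 3).+3]/(i.+1 * 3)%N d0 d1 d3; split; first by nia.
  by rewrite mul1n; apply: leq_mul => //; lia.
by rewrite muln1 mulnC; apply: leq_mul => //; lia.
Qed.

Lemma levels_dvd k :
  [/\ (om k %| hl a d k)%N, (om k %| hp a d k)%N, (nm k %| ml a d k)%N & (nm k %| mp a d k)%N].
Proof.
have step g x x' j : (g %| (vec a d x x' j).1)%N -> (g %| (vec a d x x' j).2)%N ->
    (g %| (vec a d x x' j.+1).1)%N /\ (g %| (vec a d x x' j.+1).2)%N.
  by move=> g1 g2 /=; rewrite dvdn_add ?dvdn_mull.
move: k; apply: stage_ind => i; have [q0 q1 q2] := div3 i; rewrite /om /nm q0 q1 q2.
have [h0 h0' m0 m0'] := dvdE i.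
have [h1 h1'] := step _ _ _ _ h0 h0'; have [m1 m1'] := step _ _ _ _ m0 m0'.
by have [h2 h2'] := step _ _ _ _ h1 h1'; have [m2 m2'] := step _ _ _ _ m1 m1'.
Qed.

Lemma levels_covolume k : (om k * nm k)%N = covolume d k.
Proof.
have cov i : covolume d (i * 3) = (even_part i * odd_part i)%N.
  elim: i => [|i IH].
    by rewrite /covolume /even_part /odd_part !big_ord0.
  have -> : (i.+1 * 3 = (i * 3).+3)%N by [].
  have [d0 d1 d2] := dE i; rewrite !covolumeS IH d0 d1 d2 !muln1 even_partS odd_partS.
  by case: odd; rewrite muln1 ?mulnA // mulnAC.
move: k; apply: stage_ind => i; have [q0 q1 q2] := div3 i; rewrite /om /nm q0 q1 q2.
by have [d0 d1 d2] := dE i; rewrite !covolumeS cov d0 d1 !muln1.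
Qed.

Lemma even_part_dvd i j : (i <= j)%N -> (even_part i %| even_part j)%N.
Proof.
move=> ij; rewrite -(subnK ij); elim: (j - i)%N => [|n IH]; first by rewrite add0n.
by rewrite addSn even_partS dvdn_mulr.
Qed.

Lemma odd_part_dvd i j : (i <= j)%N -> (odd_part i %| odd_part j)%N.
Proof.
move=> ij; rewrite -(subnK ij); elim: (j - i)%N => [|n IH]; first by rewrite add0n.
by rewrite addSn odd_partS dvdn_mulr.
Qed.

Lemma nm_cofinal N : (0 < N)%N -> exists K, (N %| nm K)%N.
Proof.
move=> N0; exists ((N.-1).*2.+2 * 3)%N; have [q0 _ _] := div3 (N.-1).*2.+2.
rewrite /nm q0 odd_partS /= odd_double /= /stage_d /= odd_double /=.
by rewrite uphalf_double prednK // dvdn_mull // expnS dvdn_mulr.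
Qed.

(** Each modulus of the odometer is reached at the beginning of an even stage,
    and every stage begins with Sturmian levels, at which [a k] is large. *)
Lemma levels_mef (ell : nat -> option nat) :
  has_maximal_equicontinuous_factor (block_subshift a d) (@left_shift bool)
    (@odometer_rotation o (adelic_nilmanifold R ell) (alpha R ell a d)).
Proof.
apply: (@block_mef R ell o a d om nm (fun j => (j * 2 * 3)%N)) => //.
- by move=> k; have [] := levels_a_d k.
- exact: levels_d_gt0.
- by move=> k; have [] := levels_a_d k.
- exact: levels_small.
- by move=> k; have [] := levels_dvd k.
- by move=> k; have [] := levels_dvd k.
- by move=> k; have [] := levels_dvd k.
- by move=> k; have [] := levels_dvd k.
- exact: levels_covolume.
- by move=> i j ij; apply: even_part_dvd; exact: leq_div2r.
- by move=> i j ij; apply: odd_part_dvd; exact: leq_div2r.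
- exact: nm_cofinal.
- by move=> j; rewrite /om mulnK // even_part_modulus.
- by move=> k; exists k; rewrite -even_part_modulus; apply: even_part_dvd; lia.
- move=> N; exists (N * 3)%N; have [d0 _ _] := dE N; have [a0 _ _] := aE N.
  by split=> //; lia.
Qed.

Lemma levels_a_infty B : exists K, forall k, (K <= k)%N -> (B <= a k)%N.
Proof. by exists (B * 6)%N => k Bk; have [_ _] := levels_a_d k; lia. Qed.

Variable delta : R.
Hypothesis delta01 : 0 <= delta < 1.
Hypothesis w_delta : (fun j => (j.+1)%:R / (j.+1 + w j)%:R : R) @ \oo --> delta.

Let w_densityP i : odd i -> d (i * 3).+2 = (i./2.+1 ^ 2)%N /\
  a (i * 3).+2 = (i./2.+1 * w i./2)%N.
Proof.
move=> oi; have [_ _ ->] := dE i; have [_ _ ->] := aE i.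
by rewrite /stage_d /stage_q oi.
Qed.

Let w_density j : (j.+1 ^ 2)%:R = j.+1%:R / (j.+1 + w j)%:R * (j.+1 * w j + j.+1 ^ 2)%:R :> R.
Proof.
have -> : (j.+1 * w j + j.+1 ^ 2 = j.+1 * (j.+1 + w j))%N by ring.
have n0 : (j.+1 + w j)%:R != 0 :> R by rewrite pnatr_eq0.
by rewrite natrM natrX mulrCA mulrA -[RHS]mulrA mulfVK // expr2.
Qed.

(** Only the odd stages have [d k / (a k + d k)] close to [delta]; at the
    other levels [d k] is small compared to [a k]. *)
Lemma levels_density_le (e : R) : 0 < e -> exists K, forall k, (K <= k)%N ->
  (d k)%:R <= (delta + e) * (a k + d k)%:R.
Proof.
move=> e0; have /andP[dl0 _] := delta01.
have [B BP] : exists B : nat, e^-1 < B%:R by exists (Num.trunc e^-1).+1; exact: truncnS_gt.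
have [J _ JP] : \forall j \near \oo, (j.+1)%:R / (j.+1 + w j)%:R < delta + e.
  by move/cvgrPdist_lt: w_delta => /(_ _ e0); apply: filterS => j; rewrite ltr_norml => /andP[? ?]; lra.
exists ((J.*2 + B).+1 * 3)%N.
have sparse k : (B * d k <= a k)%N -> (d k)%:R <= (delta + e) * (a k + d k)%:R.
  move=> Bd; have : B%:R * (d k)%:R <= (a k)%:R :> R by rewrite -natrM ler_nat.
  have B1 : 1 <= e * B%:R by rewrite mulrC -ler_pdivrMr // mul1r ltW.
  have d0 : 0 <= (d k)%:R :> R by [].
  have a0 : 0 <= (a k)%:R :> R by [].
  have b1 : (d k)%:R <= e * B%:R * (d k)%:R by rewrite ler_peMl.
  have b3 : 0 <= delta * ((a k)%:R + (d k)%:R) by rewrite mulr_ge0 // addr_ge0.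
  have b4 : 0 <= e * (d k)%:R by rewrite mulr_ge0 // ltW.
  rewrite natrD => b2; have : e * (B%:R * (d k)%:R) <= e * (a k)%:R by rewrite ler_pM2l.
  by lra.
apply: stage_ind => i; have [d0 d1 d2] := dE i; have [a0 a1 a2] := aE i; split=> Ki.
- by apply: sparse; rewrite d0; lia.
- by apply: sparse; rewrite d1; lia.
have [oi|ei] := boolP (odd i); last first.
  apply: sparse; rewrite d2 a2 /stage_d /stage_q (negPf ei) /= mulnC leq_mul2l.
  by apply/orP; right; lia.
have [-> ->] := w_densityP oi; rewrite {1}w_density ler_wpM2r // ltW //.
by apply: JP => /=; lia.
Qed.

Lemma levels_density_ge (e : R) K : 0 < e -> exists2 k, (K <= k)%N &
  (delta - e) * (a k + d k)%:R <= (d k)%:R.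
Proof.
move=> e0.
have [J _ JP] : \forall j \near \oo, delta - e < (j.+1)%:R / (j.+1 + w j)%:R.
  by move/cvgrPdist_lt: w_delta => /(_ _ e0); apply: filterS => j; rewrite ltr_norml => /andP[? ?]; lra.
pose i := (maxn J K).*2.+1; have oi : odd i by rewrite /= odd_double.
have i2 : i./2 = maxn J K by rewrite /= uphalf_double.
exists (i * 3).+2; first by have := leq_maxr J K; rewrite /i; lia.
have [-> ->] := w_densityP oi; rewrite [leRHS]w_density ler_wpM2r // ltW //.
by apply: JP; rewrite i2 /= leq_maxl.
Qed.

End StageFacts.

Lemma exists_block_subshift (R : realType) (o w : nat -> nat) (ell : nat -> option nat) (delta : R) :
  (forall k, (0 < o k)%N) -> (forall j, (j.+1 < w j)%N) -> 0 <= delta < 1 ->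
  (fun j => (j.+1)%:R / (j.+1 + w j)%:R : R) @ \oo --> delta ->
  exists X : set (full_shift bool),
    [/\ minimal_subshift X, infinite_set X /\ uniquely_ergodic R X,
        delta = 0 -> ((complexity X q)%:R / q%:R : R) @[q --> \oo] --> (1 : R),
        limn_esup (fun q => ((complexity X q)%:R / q%:R)%:E) = (1 + delta)%:E :> \bar R &
        exists alpha : adelic_nilmanifold R ell,
          has_maximal_equicontinuous_factor X (@left_shift bool)
            (@odometer_rotation o (adelic_nilmanifold R ell) alpha)].
Proof.
move=> o_gt0 w_gt dl wd; have [a [d [dE aE dvdE]]] := @exists_levels o w o_gt0.
have ad := levels_a_d o_gt0 w_gt dE aE.
have a_gt1 k : (1 < a k)%N by have [] := ad k.
have d_le_a k : (d k <= a k)%N by have [] := ad k.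
have d_gt0 := levels_d_gt0 o_gt0 dE.
have a_infty := levels_a_infty o_gt0 w_gt dE aE.
have dn_le := levels_density_le dE aE dl wd.
have dn_ge := levels_density_ge dE aE dl wd.
exists (block_subshift a d); split.
- exact: block_subshift_minimal.
- split; first exact: infinite_of_complexity (block_subshift_subshift a d) (complexity_ge a_gt1 d_gt0).
  apply: block_subshift_uniquely_ergodic => // B; have [K KP] := a_infty B.
  by exists (maxn B K); split; [exact: leq_maxl|apply: KP; exact: leq_maxr].
- exact: complexity_lim.
- exact: complexity_limsup.
exists (alpha R ell a d); exact: (levels_mef R o_gt0 w_gt dE aE dvdE ell).
Qed.

Theorem theorem8p1 (R : realType) (o : nat -> nat) (ell : nat -> option nat)
    (o_gt0 : forall k : nat, (0 < o k)%N) :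
  (exists (A : alphabetType) (X : set (full_shift A)),
     [/\ minimal_subshift X, infinite_set X,
         ((complexity X q)%:R / q%:R : R) @[q --> \oo] --> (1 : R) &
         exists alpha : adelic_nilmanifold R ell,
           has_maximal_equicontinuous_factor X (@left_shift A)
             (@odometer_rotation o (adelic_nilmanifold R ell) alpha)])
  /\
  (~ finite_group_extension_of_circle R (adelic_nilmanifold R ell) \/
     infinite_set (odometer o) ->
   forall delta : R, 0 < delta < 1 / 2 ->
   exists (A : alphabetType) (X : set (full_shift A)),
     [/\ minimal_subshift X, uniquely_ergodic R X,
         limn_esup (fun q => ((complexity X q)%:R / q%:R)%:E) =
           (1 + delta)%:E :> \bar R &
         exists alpha : adelic_nilmanifold R ell,
           has_maximal_equicontinuous_factor X (@left_shift A)
             (@odometer_rotation o (adelic_nilmanifold R ell) alpha)]).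
Proof.
split.
  (* any [w j] of larger order than [j] makes the densities tend to 0 *)
  have w_gt j : (j.+1 < (j.+1 ^ 2).+1)%N by rewrite ltnS expnS leq_pmulr // expn_gt0.
  have wd : (fun j => (j.+1)%:R / (j.+1 + (j.+1 ^ 2).+1)%:R : R) @ \oo --> (0 : R).
    apply: (@squeeze_cvgr _ _ _ _ (fun=> 0) (fun j => (j.+1)%:R^-1)).
    - apply: nearW => j; rewrite divr_ge0 //=.
      rewrite ler_pdivrMr ?ltr0n ?addSn // ler_pdivlMl ?ltr0n // -natrM ler_nat; lia.
    - exact: cvg_cst.
    - exact: cvg_harmonic.
  have dl : 0 <= (0 : R) < 1 by rewrite lexx ltr01.
  have [X [mX [iX _] cX _ eX]] := exists_block_subshift ell o_gt0 w_gt dl wd.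
  by exists bool, X; split=> //; exact: cX.
move=> _ delta /andP[dl0 dl2].
pose kap := (1 - delta) / delta; have kap1 : 1 < kap by rewrite ltr_pdivlMr //; lra.
(* then [(j + 1) / (j + 1 + w j)] tends to [1 / (1 + kap) = delta] *)
pose w j := (Num.trunc (j.+1%:R * kap)).+2.
have tr j : (Num.trunc (j.+1%:R * kap))%:R <= j.+1%:R * kap < (Num.trunc (j.+1%:R * kap)).+1%:R.
  by apply: truncn_itv; rewrite mulr_ge0 // ltW // (lt_trans _ kap1).
have w_gt j : (j.+1 < w j)%N.
  have /andP[_ t2] := tr j; rewrite /w ltnS -(ltr_nat R); apply: le_lt_trans t2.
  apply: (@le_trans _ _ j.+1%:R); first by rewrite ler_nat.
  by rewrite ler_peMr // ltW.
have wd : (fun j => (j.+1)%:R / (j.+1 + w j)%:R : R) @ \oo --> delta.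
  apply: (@squeeze_cvgr _ _ _ _ (fun j => delta - (j.+1)%:R^-1) (fun=> delta)).
  - apply: nearW => j; have /andP[t1 t2] := tr j; set n : R := j.+1%:R.
    have n0 : 0 < n by rewrite ltr0n.
    have wE : (j.+1 + w j)%:R = n + (Num.trunc (n * kap))%:R + 2 by rewrite /w natrD -addn2 natrD addrA.
    have nk : n * kap = n / delta - n by rewrite /kap; field; rewrite gt_eqF.
    have nd : delta * (n / delta) = n by field; rewrite gt_eqF.
    rewrite -[(Num.trunc _).+1%:R]natr1 in t2; rewrite -/n nk in t1 t2 wE; rewrite wE.
    have t0 : 0 <= (Num.trunc (n / delta - n))%:R :> R by [].
    have tp : 0 < n + (Num.trunc (n / delta - n))%:R + 2 by lra.
    move: t1 t2 t0 tp; move: (Num.trunc _)%:R => t t1 t2 t0 tp; apply/andP; split.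
      rewrite ler_pdivlMr //; have [neg|pos] := leP (delta - n^-1) 0.
        by apply: (@le_trans _ _ 0); [rewrite mulr_le0_ge0 // ltW|exact: ltW].
      have b1 : (delta - n^-1) * (n + t + 2) <= (delta - n^-1) * (n / delta + 2).
        by rewrite ler_pM2l //; lra.
      have b2 : (delta - n^-1) * (n / delta + 2) = n + 2 * delta - delta^-1 - 2 / n.
        by field; rewrite !gt_eqF.
      have b3 : 0 <= 2 / n by rewrite divr_ge0 // ltW.
      have b4 : 1 <= delta^-1 by rewrite invf_ge1 //; lra.
      apply: le_trans b1 _; rewrite b2; move: b3 b4; move: (2 / n) (delta^-1) => u v b3 b4.
      by lra.
    have b1 : delta * (n / delta) <= delta * (n + t + 2).
      rewrite ler_pM2l //; move: t2; move: (n / delta) => u t2; lra.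
    by rewrite ler_pdivrMr // -[X in X <= _]nd.
  - rewrite -[X in _ --> X]subr0; apply: cvgB; [exact: cvg_cst|exact: cvg_harmonic].
  - exact: cvg_cst.
have dl : 0 <= delta < 1 by lra.
have [X [mX [_ uX] _ sX eX]] := exists_block_subshift ell o_gt0 w_gt dl wd.
by exists bool, X; split.
Qed.
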